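(* (a) If $G$ is a biextraspecial group of rank $m$, then $m$ is even. (b) For each even positive integer $m$ there are, up to isomorphism, exactly two biextraspecial groups of rank $m$, denoted $B^{+}(m)$ and $B^{-}(m)$, where $B^{\varepsilon}(m)$ is of type $\varepsilon\in\{+,-\}$. (c) For each even positive integer $m$ and $\varepsilon\in\{+,-\}$, the outer automorphism group $\mathrm{Out}(B^{\varepsilon}(m))$ is an extension of the $m$-dimensional nondegenerate orthogonal $GF(2)$-space $V$ of type $\varepsilon$ by the corresponding orthogonal group $O^{\varepsilon}_m(2)$, i.e. there is a short exact sequence $1\to V\to \mathrm{Out}(B^{\varepsilon}(m))\to O^{\varepsilon}_m(2)\to 1$ (with $V$ viewed as an additive group); this extension is non-split, except when $m=2$ or $m=4$, in which case it is split.
   Context: Biextraspecial groups. $L_2(2)=SL_2(2)\cong S_3$; its natural module is $GF(2)^2$. For $m\ge 1$, a finite group $G$ is a biextraspecial group of rank $m$ if: (B1) $G$ has a normal $2$-subgroup $Q$ of order $2^{2+2m}$ with $G/Q\cong L_2(2)$; (B2) the centre $Z=Z(Q)$, with the action of $G/Q$ by conjugation, is the natural $L_2(2)$-module (so $Z\cong 2^2$); (B3) $Q/Z$ is elementary abelian of order $2^{2m}$ and, as a module for $G/Q\cong L_2(2)$ over $GF(2)$, all its composition factors are natural modules. Dents. A dent of $G$ is a normal subgroup $D$ of $G$ with $Z<D<Q$ such that $D/Z$ is an irreducible submodule of $Q/Z$ (allowing $D=Q$ formally if $Q/Z$ itself is irreducible). Every dent is abelian and is isomorphic to $2^4$ (elementary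 abelian; the dent is then called singular) or to $4^2=C_4\times C_4$ (non-singular). For distinct dents $D_1,D_2$, let $\varphi:D_1/Z\to D_2/Z$ be the unique $L_2(2)$-isomorphism; the diagonal dent $D_1+D_2$ is the full preimage in $Q$ of $\{u\cdot u\varphi: u\in D_1/Z\}$. The dent space $\mathcal D$ is the set of all dents together with a formal zero $0_{\mathcal D}$, with $D+D=0_{\mathcal D}$; it is an $m$-dimensional $GF(2)$-vector space. It carries the nondegenerate alternating form $\beta(D_1,D_2)=0$ if $[D_1,D_2]=1$ and $1$ otherwise (with $\beta=0$ if an argument is $0_{\mathcal D}$), and the quadratic form $q$ with associated bilinear form $\beta$ given by $q(D)=0$ if $D$ is singular, $q(D)=1$ if $D$ is non-singular, $q(0_{\mathcal D})=0$. Type. The type $\varepsilon\in\{+,-\}$ of $G$ is the type of $q$: $+$ if the maximal totally singular subspaces have dimension $m/2$, and $-$ otherwise (dimension $m/2-1$). $O^{\varepsilon}_m(2)$ is the full isometry group of a nondegenerate quadratic form of type $\varepsilon$ on $GF(2)^m$. *)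

(* Defs.v *)
From mathcomp Require Import all_boot all_order all_algebra all_fingroup all_solvable.

Set Implicit Arguments.
Unset Strict Implicit.
Unset Printing Implicit Defensive.

Import GRing.Theory.
Local Open Scope group_scope.

Inductive sign : Set := Plus | Minus.

(* L_2(2) = SL_2(2), acting on row vectors from the right so as to match the
   right action [x ^ g] by conjugation. *)
Definition SL22 : {set {'GL_2['F_2]}} :=
  [set A : {'GL_2['F_2]} | (\det (GLval A) == 1)%R].

Section Biextraspecial.

Variable gT : finGroupType.
Implicit Types G Q U V D : {group gT}.

(* The section U / V of G is a natural module: h induces an isomorphism of
   U / V onto GF(2)^2 (with its additive group law) that carries conjugation
   by G to the matrix action given by f : G / Q -> SL_2(2). *)
Definition natural_section G Q (f : coset_of Q -> {'GL_2['F_2]}) V U : Prop :=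
  exists h : {morphism U >-> 'rV['F_2]_2},
    [/\ 'ker h = V, h @* U = [set: 'rV['F_2]_2]
      & {in U & G, forall u g,
           h (u ^ g) = (h u *m GLval (f (coset Q g)))%R}].

(* A G-submodule of Q / Z is W / Z for a normal subgroup W of G with
   Z <= W <= Q, so the composition factors of Q / Z are the chief factors
   U / V of G with Z <= V and U <= Q. *)
Definition biextraspecial_wrt (m : nat) G Q : Prop :=
  [/\ (0 < m)%N, Q <| G, #|Q| = (2 ^ (2 + 2 * m))%N
    & exists f : {morphism (G / Q) >-> {'GL_2['F_2]}},
      [/\ isom (G / Q) SL22 f,
          natural_section G f 1%G 'Z(Q)%G,
          2.-abelem (Q / 'Z(Q)),
          #|Q / 'Z(Q)| = (2 ^ (2 * m))%N
        & forall V U, 'Z(Q) \subset V -> U \subset Q ->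
            chief_factor G V U -> natural_section G f V U]].

Definition biextraspecial (m : nat) G : Prop :=
  exists Q, biextraspecial_wrt m G Q.

(* D = Q is allowed, and happens only when Q / Z is itself irreducible. *)
Definition is_dent G Q D : bool :=
  [&& D <| G, 'Z(Q) \proper D, D \subset Q
    & minnormal (D / 'Z(Q)) (G / 'Z(Q))].

Definition singular D : bool := 2.-abelem D && (#|D| == 2 ^ 4)%N.

(* D is the full preimage of { u * phi u | u in D1 / Z } for an isomorphism
   phi of G / Q-modules from D1 / Z onto D2 / Z. *)
Definition is_diagonal G Q D1 D2 D : bool :=
  [exists phi : {ffun coset_of 'Z(Q) -> coset_of 'Z(Q)},
    [&& misom (D1 / 'Z(Q)) (D2 / 'Z(Q)) phi,
        [forall u in D1 / 'Z(Q), forall g in G / 'Z(Q),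
           phi (u ^ g) == phi u ^ g]
      & D :==: coset 'Z(Q) @*^-1 [set u * phi u | u in D1 / 'Z(Q)]]].

Definition dent G Q := {D : {group gT} | is_dent G Q D}.

(* [None] is the formal zero. *)
Definition dent_space G Q := option (dent G Q).

Definition dent_add G Q (x y : dent_space G Q) : dent_space G Q :=
  match x, y with
  | None, _ => y
  | _, None => x
  | Some D1, Some D2 =>
      if D1 == D2 then None
      else [pick D : dent G Q | is_diagonal G Q (val D1) (val D2) (val D)]
  end.

Definition dent_q G Q (x : dent_space G Q) : 'F_2 :=
  match x with
  | None => 0%R
  | Some D => if singular (val D) then 0%R else 1%R
  end.

End Biextraspecial.

(* The carrier T is meant to be a GF(2)-space with addition add and zero z, so
   that subspaces are the additively closed subsets containing z, and those of
   dimension k are those with 2 ^ k elements.  The operations are explicit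
   because the dent space is not equipped with an algebraic structure. *)
Section QuadraticType.

Variables (T : finType) (z : T) (add : T -> T -> T) (q : T -> 'F_2).

Definition subspace (W : {set T}) : bool :=
  (z \in W) && [forall u in W, forall v in W, add u v \in W].

Definition totally_singular (W : {set T}) : bool :=
  subspace W && [forall u in W, q u == 0%R].

Definition quadratic_type (m : nat) : sign :=
  if [forall W : {set T}, maxset totally_singular W ==> (#|W| == 2 ^ (m./2))%N]
  then Plus else Minus.

End QuadraticType.

Definition biextraspecial_of_type (m : nat) (e : sign)
    (gT : finGroupType) (G : {group gT}) : Prop :=
  exists Q : {group gT}, biextraspecial_wrt m G Q /\
    quadratic_type None (@dent_add gT G Q) (@dent_q gT G Q) m = e.

Section Orthogonal.

Local Open Scope ring_scope.

Variables (m : nat) (q : 'rV['F_2]_m -> 'F_2).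

Definition polar (u v : 'rV['F_2]_m) : 'F_2 := q (u + v) - q u - q v.

Definition quadratic_form : Prop :=
  (forall (a : 'F_2) v, q (a *: v) = a ^+ 2 * q v) /\
  (forall u, scalar (polar u)).

Definition nondegenerate : Prop :=
  forall u, (forall v, polar u v = 0) -> u = 0.

Definition orthogonal_space (e : sign) : Prop :=
  [/\ quadratic_form, nondegenerate
    & quadratic_type 0 (fun u v : 'rV['F_2]_m => u + v) q m = e].

Definition orthogonal_group : {set {perm 'rV['F_2]_m}} :=
  [set s : {perm 'rV['F_2]_m} |
    [forall a : 'F_2, forall u, forall v, s (a *: u + v) == a *: s u + s v]
    && [forall v, q (s v) == q v]].

End Orthogonal.

Section Out.

Variables (gT : finGroupType) (G : {group gT}).

Definition Inn : {set {perm gT}} := conj_aut G @* G.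

Definition Out : {set coset_of Inn} := Aut G / Inn.

Canonical Inn_group := [group of Inn].
Canonical Out_group := [group of Out].

End Out.

(* Main.v *)
(* In a biextraspecial group G choose t of order 3 and an involution s
   inverting it, together generating a complement to Q.  Since the composition
   factors of Q are natural modules, q * q^t * q^(t^2) = 1 for every q in Q.
   This forces E = C_Q(s) to be extraspecial of order 2^(1 + m), so that m is
   even; moreover Q = E * E^t with E and E^t meeting trivially, and
   [y^t, x] = [y, x] * [y, x]^t for x, y in E.  Hence E determines the
   multiplication of G: isomorphisms between the groups E extend to the groups
   G, and, the pairs (s, t) being conjugate in G, Out G is isomorphic to Aut E.
   The dents are the groups Z * <x, x^t> with x in E outside Z(E), so the dent
   space is E / Z(E) with the quadratic form given by squaring, and the groups
   G are classified by the extraspecial 2-groups E.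

   Write E as V * GF(2) with multiplication twisted by a bilinear f such that
   f(v, v) = q(v).  The automorphisms of E are the (v, c) |-> (g v, c + h v)
   with g an isometry of q and h a cochain for the coboundary of f along g; the
   inner ones have g = 1 and h linear.
   If m >= 6, there are four nonsingular, mutually orthogonal vectors with sum
   0.  In a complement of Inn E, the lift of the transvection at x has h x = 1
   because its square is 1, and h y = 0 for y nonsingular, orthogonal to x and
   distinct from x because the lifts at x and y commute; as h is additive on
   these four vectors, this is a contradiction.
   If m = 2 or 4, then for a suitable f there is a basis of V partitioned into
   blocks of even size such that the isometries permute the blocks, each
   enlarged by its sum; the automorphisms whose h is constant on each enlarged
   block form a complement. *)

From HB Require Import structures.
Require Import Defs.
From mathcomp Require Import all_boot all_order all_algebra all_fingroup all_solvable.
From mathcomp Require Import ring.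

Set Implicit Arguments.
Unset Strict Implicit.
Unset Printing Implicit Defensive.

Import GRing.Theory.
Local Open Scope group_scope.

(** Types are never compared by exhibiting isometries. A totally singular subspace lifts to an
    elementary abelian subgroup of E containing Z(E), and all maximal elementary abelian subgroups
    of an extraspecial group have the same rank. So for the dent space, for q and for the model the
    type is one and the same test, ['r_2(E) == (m./2).+1]. There are just two extraspecial groups of
    order 2^(m+1), told apart by this rank, so the test also decides isomorphism of the groups E,
    hence of the groups G.

    Existence needs an explicit group. The model takes V (x) N for Q/Z and N for Z, where N is the
    natural module, with a cocycle made from f and an invariant map from N (x) N to N. In
    characteristic 2 the asymmetric f is essential: it yields the quadratic form f(v, v), while f +
    f^T only yields the polar form.

    The bound m >= 6 is a dimension count: the third of the nonsingular vectors has to be orthogonal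
    to the first two and outside their span, which needs m - 2 > 2. *)

(** * Frames *)

(* The complement <t, s> to Q is a copy of L_2(2); frame_fixZ says that t has no
   fixed point on Q / Z. *)
Record frame (gT : finGroupType) (G Q : {group gT}) (s t : gT) : Prop := Frame {
  frame_sdprod : Q ><| (<[t]> <*> <[s]>) = G;
  frame_pgroup : 2.-group Q;
  frame_order_t : #[t] = 3;
  frame_order_s : #[s] = 2;
  frame_inv : t ^ s = t^-1;
  frame_fix : 'C_Q[t] = 1;
  frame_fixZ : forall y, y \in Q -> [~ y, t] \in 'Z(Q) -> y \in 'Z(Q);
  frame_cardZ : #|'Z(Q)| = 4;
  frame_abelemZ : 2.-abelem 'Z(Q);
  frame_abelem : 2.-abelem (Q / 'Z(Q)) }.

(** * Computation in GF(2) and with 2 x 2 matrices over it *)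

Lemma F2P (x : 'F_2) : x = 0%R \/ x = 1%R.
Proof.
by case: x => [[|[|x]] lt_x]; [left | right | ]; try apply: val_inj.
Qed.

Lemma ord2P (i : 'I_2) : i = ord0 \/ i = ord_max.
Proof.
by case: i => [[|[|x]] lt_x]; [left | right | ]; try apply: val_inj.
Qed.

Lemma SL22_eqT : SL22 = [set: {'GL_2['F_2]}].
Proof.
apply/setP=> A; rewrite !inE; have := GL_det A.
by have [-> | -> _] := F2P (\det (GLval A))%R; rewrite eqxx.
Qed.

Lemma card_SL22 : #|SL22| = 6.
Proof. by rewrite SL22_eqT card_GL_2 card_Fp. Qed.

Lemma det_mx22 (R : comNzRingType) (A : 'M[R]_2) :
  (\det A = A ord0 ord0 * A ord_max ord_max - A ord0 ord_max * A ord_max ord0)%R.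
Proof.
rewrite (expand_det_row _ ord0) !big_ord_recl big_ord0 /cofactor !det_mx11 !mxE /=.
rewrite addr0 /bump /= !addn0 addn1 expr0 expr1 mul1r mulN1r mulrN.
by congr (A _ _ * A _ _ - A _ _ * A _ _)%R; apply: val_inj.
Qed.

Lemma big_ord2 (R : nmodType) (F : 'I_2 -> R) :
  (\sum_i F i = F ord0 + F ord_max)%R.
Proof.
rewrite !big_ord_recl big_ord0 addr0.
by congr (_ + F _)%R; apply: val_inj.
Qed.

(** With determinant 1 and a nonzero fixed vector, A has 1 as a double eigenvalue, so (A - 1)^2 = 0.
    The proof enumerates the entries. *)
Lemma mx2_cubic (A : 'M['F_2]_2) (v : 'rV['F_2]_2) :
  (v *m A = v -> v != 0 -> \det A != 0 -> A *m A = 1%:M)%R.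
Proof.
rewrite det_mx22 => /rowP vA; have:= vA ord0; have:= vA ord_max.
rewrite !mxE !big_ord2 => e0 e1 v0 dA.
have v01 : (v ord0 ord0 != 0)%R || (v ord0 ord_max != 0)%R.
  apply: contraR v0; rewrite negb_or !negbK => /andP[/eqP v00 /eqP v01].
  by apply/eqP/rowP=> i; rewrite !mxE; have [->|->] := ord2P i.
apply/matrixP=> i j; rewrite !mxE big_ord2.
move: e0 e1 v01 dA.
have [->|->] := F2P (v ord0 ord0); have [->|->] := F2P (v ord0 ord_max);
have [a|a] := F2P (A ord0 ord0); have [b|b] := F2P (A ord0 ord_max);
have [c|c] := F2P (A ord_max ord0); have [d|d] := F2P (A ord_max ord_max);
rewrite ?a ?b ?c ?d //;
by have [->|->] := ord2P i; have [->|->] := ord2P j; rewrite ?a ?b ?c ?d // => *; apply: val_inj.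
Qed.

(** Source of every fixed-point statement about t: elements of order 3 act on the natural module
    without nonzero fixed vectors. *)
Lemma GL22_order3_fix (A : {'GL_2['F_2]}) (v : 'rV['F_2]_2) :
  #[A] = 3 -> (v *m GLval A = v)%R -> (v = 0)%R.
Proof.
move=> oA vA; apply/eqP/negPn/negP=> v0.
have /eqP := mx2_cubic vA v0 (GL_det A); apply/negP/eqP=> AA.
suff: #[A] %| 2 by rewrite oA.
by rewrite order_dvdn expgS expg1; apply/eqP/val_inj.
Qed.

Lemma prime2 : prime 2. Proof. by []. Qed.

Lemma sqg (gT : finGroupType) (x : gT) : x ^+ 2 = x * x. Proof. by []. Qed.

Section FrameExists.

Variables (gT : finGroupType) (m : nat) (G Q : {group gT}).
Hypothesis GQ : biextraspecial_wrt m G Q.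

(** The complement to Q is the normalizer of a subgroup of order 3, obtained by a Frattini argument;
    s is any involution in it. *)
Lemma biextraspecial_frame : exists s t, frame G Q s t.
Proof.
case: GQ => _ nQG oQ [f [isof [hZ [kerZ imZ actZ]] abQ _ chief]].
have [sQG nQ] := andP nQG.
have pQ : 2.-group Q by rewrite /pgroup oQ pnatX.
rewrite SL22_eqT in isof; have [injf imf] := isomP isof.
have oGQ : #|G / Q| = 6 by rewrite -(card_injm injf) // imf; have:= card_SL22; rewrite SL22_eqT.
have oG : #|G| = (#|Q| * 6)%N by rewrite -(Lagrange sQG) -card_quotient // oGQ.
have sZQ : 'Z(Q) \subset Q := center_sub Q.
have nZG : 'Z(Q) <| G := gFnormal_trans _ nQG.
have nZQ : 'Z(Q) <| Q := center_normal Q.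
have [t tG ot] : {t | t \in G & #[t] = 3}.
  by apply: Cauchy => //; rewrite oG dvdn_mull.
have tNQ : t \in 'N(Q) := subsetP nQ t tG.
have tnQ : t \notin Q.
  apply/negP=> /(mem_p_elt pQ); rewrite /p_elt ot; by [].
have oct : #[coset Q t] = 3.
  apply: nt_prime_order => //; first by rewrite -morphX // -ot expg_order morph1.
  by apply: contra tnQ => /eqP/coset_idr->.
have oA : #[f (coset Q t)] = 3.
  by rewrite (order_injm injf) ?mem_quotient.
have fixZ : forall y, y \in Q -> [~ y, t] \in 'Z(Q) -> y \in 'Z(Q).
  move=> y Qy cyZ; apply/negPn/negP=> nyZ.
  (* A chief factor U / V that detects y: U is a minimal normal subgroup of G between Z and Q
     containing y, so y lies outside any V maximal in U. The image of y in the natural module U / V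
     is then fixed by an element of order 3. *)
  pose P (U : {group gT}) := [&& U <| G, 'Z(Q) \subset U, U \subset Q & y \in U].
  have PQ : P Q by rewrite /P nQG sZQ subxx.
  have [U /mingroupP[/and4P[nUG sZU sUQ yU] minU] _] := mingroup_exists PQ.
  pose R (V : {group gT}) := (V \proper U) && (G \subset 'N(V)).
  have RZ : R 'Z(Q)%G.
    rewrite /R (normal_norm nZG) andbT properE sZU.
    by apply: contra nyZ => /subsetP->.
  have [V maxV sZV] := maxgroup_exists RZ.
  have /maxgroupP[/andP[pVU nVG] _] := maxV.
  have cf : chief_factor G V U by rewrite /chief_factor /maxnormal maxV.
  have [h [kerh _ acth]] := chief V U sZV sUQ cf.
  have nyV : y \notin V.
    apply/negP=> yV; have: V :=: U.
      apply: minU; last exact: proper_sub.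
      by rewrite /P sZV yV (subset_trans (proper_sub pVU)) // /normal nVG
        (subset_trans (proper_sub pVU)) ?normal_sub.
    by move=> eVU; rewrite eVU properxx in pVU.
  have cV : [~ y, t] \in V by apply: (subsetP sZV).
  have kc : h [~ y, t] = 1 by apply: mker; rewrite kerh.
  have cU : [~ y, t] \in U by apply: (subsetP (proper_sub pVU)).
  have hy : h (y ^ t) = h y.
    have -> : y ^ t = y * [~ y, t] by rewrite commgEl mulKVg.
    by rewrite morphM // kc mulg1.
  have hy0 : h y = 1.
    by apply: (GL22_order3_fix oA); rewrite -acth.
  by case/negP: nyV; rewrite -kerh; apply/kerP.
have fixQ : 'C_Q[t] = 1.
  apply/trivgP/subsetP=> y /setIP[Qy /cent1P cyt].
  have yZ : y \in 'Z(Q) by apply: fixZ => //; move/commgP: cyt => /eqP->; rewrite group1.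
  have hy0 : hZ y = 1.
    apply: (GL22_order3_fix oA); rewrite -actZ //.
    by congr (hZ _); apply/conjg_fixP/commgP.
  by rewrite -(kerZ) ; apply/kerP.
have injZ : 'injm hZ by rewrite kerZ.
have oZ : #|'Z(Q)| = 4.
  by rewrite -(card_injm injZ) // imZ cardsT card_mx card_Fp.
have rV2 : forall v : 'rV['F_2]_2, v * v = 1.
  by move=> v; apply/rowP=> i; rewrite !mxE; have [->|->] := F2P (v ord0 i); apply: val_inj.
have abZ : 2.-abelem 'Z(Q).
  apply/abelemP => //; split; first exact: center_abelian.
  move=> x xZ; apply: (injmP injZ) => //; rewrite ?groupX //.
  by rewrite morphX // morph1 sqg rV2.
pose P := <[t]>; have oP : #|P| = 3 by [].
have tPQ : Q :&: P = 1.
  by apply: coprime_TIg; rewrite oQ oP coprimeXl.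
have nQP : P \subset 'N(Q) by rewrite cycle_subG.
have sPG : P \subset G by rewrite cycle_subG.
(* K has index 2, hence is normal, and P is a Sylow 3-subgroup of K; Frattini gives G = K N = Q N
   with N the normalizer of P. *)
pose K := (Q <*> P)%G.
have sKG : K \subset G by rewrite join_subG sQG.
have eK : K :=: Q * P by rewrite /= norm_joinEr.
have oK : #|K| = (#|Q| * 3)%N by rewrite eK TI_cardMg // oP.
have nKG : K <| G.
  apply: index2_normal => //; apply/eqP.
  by rewrite -(eqn_pmul2l (cardG_gt0 K)) Lagrange // oG oK -mulnA.
have sylP : 3.-Sylow(K) P.
  rewrite pHallE joing_subr /= oK oQ oP partnM ?expn_gt0 //.
  by rewrite -oQ part_p'nat ?part_pnat_id // (pi_pnat pQ).
have fr := Frattini_arg nKG sylP.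
pose N := ('N_G(P))%G.
have eG : Q * N = G.
  have sPN : P \subset N by rewrite subsetI sPG normG.
  by move: fr; rewrite eK -mulgA (mulSGid sPN).
have tQN : Q :&: N = 1.
  apply/trivgP; rewrite -fixQ; apply/subsetP=> y /setIP[Qy /setIP[_ yN]].
  rewrite inE Qy; apply/cent1P/commgP.
  have: [~ y, t] \in Q :&: P.
    apply/setIP; split; first by rewrite commgEl groupM ?groupV // memJ_norm.
    by rewrite commgEr groupM ?cycle_id // memJ_norm ?groupV ?cycle_id.
  by rewrite tPQ inE.
have oN : #|N| = 6.
  by apply/eqP; rewrite -(eqn_pmul2l (cardG_gt0 Q)) -oG -eG TI_cardMg.
have [s sN os] : {s | s \in N & #[s] = 2} by apply: Cauchy => //; rewrite oN.
have [sG sNP] := setIP sN.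
have ts : t ^ s = t^-1.
  have: t ^ s \in P by rewrite memJ_norm // cycle_id.
  have -> : P = [set 1; t; t^-1].
    apply/eqP; rewrite eq_sym eqEcard oP; apply/andP; split.
      by apply/subsetP=> x /setUP[/set2P[]|/set1P] ->; rewrite ?groupV ?cycle_id.
    have t1 : t != 1 by rewrite -order_gt1 ot.
    have tV : t^-1 != t.
      rewrite eq_invg_mul; apply/negP => tt.
      by have: #[t] %| 2; [rewrite order_dvdn sqg | rewrite ot].
    by rewrite setUC cardsU1 cards2 !inE negb_or eq_invg1 t1 tV eq_sym t1.
  case/setUP=> [/set2P[/eqP|ts]|/set1P//].
    by rewrite conjg_eq1 -order_eq1 ot.
  (* Suppose that s centralizes t. A nontrivial fixed point z of s in Z yields a second one, z^t, so
     s centralizes Z, which has order 4. As G / Q acts faithfully on Z, s lies in Q, against Q :&: N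
     = 1. *)
  exfalso.
  have [z zZ [z1 zs]] : exists2 z, z \in 'Z(Q) & z != 1 /\ z ^ s = z.
    have : 'Z(Q) != 1 by rewrite -cardG_gt1 oZ.
    case/trivgPn=> z zZ z1; have zsZ : z ^ s \in 'Z(Q).
      by rewrite memJ_norm // (subsetP (normal_norm nZG)).
    have [zz|zz] := eqVneq (z ^ s) z; first by exists z.
    have ab : commute z (z ^ s) by apply: (centsP (center_abelian Q)).
    exists (z * z ^ s); first by rewrite groupM.
    split; last by rewrite conjMg -conjgM -sqg -os expg_order conjg1 ab.
    apply: contra zz; rewrite -eq_invg_mul => /eqP<-.
    by rewrite eq_invg_mul -sqg; have [_ ->] := abelemP prime2 abZ.
  have sNQ : s \in 'N(Q) := subsetP nQ s sG.
  have cst : commute s t by apply/commute_sym/commgP/conjg_fixP.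
  have zt : z ^ t != z.
    apply: contra z1 => /eqP zt; rewrite -in_set1 -[[set 1]]fixQ inE (subsetP sZQ) //=.
    by apply/cent1P/commgP/conjg_fixP.
  have sZC : 'Z(Q) \subset 'C[s].
    have oC : #|'C_('Z(Q))[s]| %| 4 by rewrite -oZ cardSg ?subsetIl.
    have C2 : 2 < #|'C_('Z(Q))[s]|.
      have <- : #|[set 1; z; z ^ t]| = 3.
        by rewrite setUC cardsU1 cards2 !inE negb_or conjg_eq1 z1 zt eq_sym z1.
      apply/subset_leq_card; rewrite !subUset !sub1set group1.
      apply/andP; split; apply/setIP; split=> //.
      - by apply/cent1P/commgP/conjg_fixP.
      - by rewrite memJ_norm // (subsetP (normal_norm nZG)).
      by apply/cent1P/commgP/conjg_fixP; rewrite -conjgM -cst conjgM zs.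
    apply/setIidPl/eqP; rewrite eqEcard subsetIl oZ.
    by case: #|_| oC C2 => [|[|[|[|[|]]]]].
  have B1 : f (coset Q s) = 1.
    apply: val_inj; change (GLval (f (coset Q s)) = 1%:M)%R; apply/row_matrixP=> i.
    have : row i 1%:M%R \in hZ @* 'Z(Q) by rewrite imZ inE.
    case/morphimP=> y _ yZ ey.
    have: y ^ s = y by apply/conjg_fixP/commgP/cent1P/(subsetP sZC).
    by move/(congr1 hZ); rewrite actZ // -ey -row_mul mul1mx.
  have: coset Q s = 1.
    by apply: (injmP injf); rewrite ?mem_quotient ?group1 // morph1.
  move/coset_idr=> /(_ sNQ) Qs.
  have: s \in Q :&: N by rewrite inE Qs.
  by rewrite tQN inE -order_eq1 os.
exists s, t; split=> //.
have eN : <[t]> <*> <[s]> = N.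
  apply/eqP; rewrite eqEcard join_subG !cycle_subG sN inE tG.
  rewrite (subsetP (normG _)) ?cycle_id //= oN.
  have o2 : 2 %| #|<[t]> <*> <[s]>| by rewrite -os [#[s]]/order cardSg ?joing_subr.
  have o3 : 3 %| #|<[t]> <*> <[s]>| by rewrite -oP cardSg ?joing_subl.
  by apply: dvdn_leq => //; rewrite (@Gauss_dvd 2 3) // o2.
by rewrite eN sdprodE // (subset_trans _ nQ) ?subsetIl.
Qed.

End FrameExists.

(** * Calculus in a frame *)

Section Frame.

Variables (gT : finGroupType) (G Q : {group gT}) (s t : gT).
Hypothesis fr : frame G Q s t.

Let E := ('C_Q[s])%G.

Lemma frame_normal : Q <| G.
Proof. by have [nQ _ _ _ _] := sdprod_context (frame_sdprod fr). Qed.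

Lemma frame_memt : t \in G.
Proof.
have [_ sSG _ _ _] := sdprod_context (frame_sdprod fr).
by apply: (subsetP sSG); rewrite mem_gen // inE cycle_id.
Qed.

Lemma frame_mems : s \in G.
Proof.
have [_ sSG _ _ _] := sdprod_context (frame_sdprod fr).
by apply: (subsetP sSG); rewrite mem_gen // inE cycle_id orbT.
Qed.

Lemma frame_Jt x : x \in Q -> x ^ t \in Q.
Proof. by move=> Qx; rewrite memJ_norm // (subsetP (normal_norm frame_normal)) // frame_memt. Qed.

Lemma frame_Js x : x \in Q -> x ^ s \in Q.
Proof. by move=> Qx; rewrite memJ_norm // (subsetP (normal_norm frame_normal)) // frame_mems. Qed.

Lemma frame_JZt x : x \in 'Z(Q) -> x ^ t \in 'Z(Q).
Proof.
move=> Zx; have nZ : 'Z(Q) <| G := gFnormal_trans _ frame_normal.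
by rewrite memJ_norm // (subsetP (normal_norm nZ)) // frame_memt.
Qed.

Lemma frame_JZs x : x \in 'Z(Q) -> x ^ s \in 'Z(Q).
Proof.
move=> Zx; have nZ : 'Z(Q) <| G := gFnormal_trans _ frame_normal.
by rewrite memJ_norm // (subsetP (normal_norm nZ)) // frame_mems.
Qed.

Lemma frame_ttt : t * t * t = 1.
Proof. by rewrite -(expg_order t) (frame_order_t fr) -mulgA. Qed.

Lemma frame_ss : s * s = 1.
Proof. by rewrite -(expg_order s) (frame_order_s fr). Qed.

Lemma frame_tV : t^-1 = t * t.
Proof. by apply/eqP; rewrite eq_invg_mul mulgA frame_ttt. Qed.

Lemma frame_Jss x : (x ^ s) ^ s = x.
Proof. by rewrite -conjgM frame_ss conjg1. Qed.

Lemma frame_Jttt x : ((x ^ t) ^ t) ^ t = x.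
Proof. by rewrite -!conjgM mulgA frame_ttt conjg1. Qed.

Lemma frame_Jts x : (x ^ t) ^ s = ((x ^ s) ^ t) ^ t.
Proof.
rewrite -!conjgM -frame_tV -(frame_inv fr) [t ^ s]conjgE mulKVg.
by [].
Qed.

Lemma frame_ZQ x : x \in 'Z(Q) -> x \in Q.
Proof. by apply/subsetP/center_sub. Qed.

Lemma frame_Zcom x y : x \in 'Z(Q) -> y \in Q -> commute x y.
Proof. by move=> /centerP[_ cx] Qy; apply: cx. Qed.

Lemma frame_Zsq x : x \in 'Z(Q) -> x * x = 1.
Proof. by have [_ H] := abelemP prime2 (frame_abelemZ fr); move/H. Qed.

Lemma frame_ZV x : x \in 'Z(Q) -> x^-1 = x.
Proof. by move=> Zx; apply/eqP; rewrite eq_invg_mul frame_Zsq. Qed.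

Lemma frame_comZ x y : x \in Q -> y \in Q -> [~ x, y] \in 'Z(Q).
Proof.
move=> Qx Qy; have sQ'Z: Q^`(1) \subset 'Z(Q).
  by rewrite der1_min ?gFnorm // (abelem_abelian (frame_abelem fr)).
by apply: (subsetP sQ'Z); rewrite mem_commg.
Qed.

Lemma frame_sqZ x : x \in Q -> x * x \in 'Z(Q).
Proof.
move=> Qx; have nZ : Q \subset 'N('Z(Q)) by rewrite gFnorm.
rewrite coset_idr ?groupM ?(subsetP nZ) // morphM ?(subsetP nZ) //.
by have [_ H] := abelemP prime2 (frame_abelem fr); apply: H; rewrite mem_quotient.
Qed.

Lemma frame_commMr x y z : x \in Q -> y \in Q -> z \in Q ->
  [~ x, y * z] = [~ x, y] * [~ x, z].
Proof.
move=> Qx Qy Qz; rewrite commgMJ.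
have -> : [~ x, y] ^ z = [~ x, y].
  by apply/conjg_fixP/commgP/frame_Zcom => //; apply: frame_comZ.
by apply/commute_sym/frame_Zcom; rewrite ?frame_comZ // frame_ZQ // frame_comZ.
Qed.

(* Conjugation and commutators are abstracted so that rewriting with group
   identities cannot unfold them. *)
Section Calculus.

Variables (jt js : gT -> gT) (com : gT -> gT -> gT).
Hypotheses (jtE : forall x, x ^ t = jt x) (jsE : forall x, x ^ s = js x).
Hypothesis comE : forall x y, [~ x, y] = com x y.

Let jtM x y : jt (x * y) = jt x * jt y. Proof. by rewrite -!jtE conjMg. Qed.
Let jsM x y : js (x * y) = js x * js y. Proof. by rewrite -!jsE conjMg. Qed.
Let jtV x : jt x^-1 = (jt x)^-1. Proof. by rewrite -!jtE conjVg. Qed.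
Let jsV x : js x^-1 = (js x)^-1. Proof. by rewrite -!jsE conjVg. Qed.
Let jttt x : jt (jt (jt x)) = x. Proof. by rewrite -!jtE frame_Jttt. Qed.
Let jss x : js (js x) = x. Proof. by rewrite -!jsE frame_Jss. Qed.
Let jts x : js (jt x) = jt (jt (js x)). Proof. by rewrite -!jtE -!jsE frame_Jts. Qed.
Let jtQ x : x \in Q -> jt x \in Q. Proof. by rewrite -jtE; apply: frame_Jt. Qed.
Let jsQ x : x \in Q -> js x \in Q. Proof. by rewrite -jsE; apply: frame_Js. Qed.
Let jtZ x : x \in 'Z(Q) -> jt x \in 'Z(Q). Proof. by rewrite -jtE; apply: frame_JZt. Qed.
Let jsZ x : x \in 'Z(Q) -> js x \in 'Z(Q). Proof. by rewrite -jsE; apply: frame_JZs. Qed.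
Let comZ x y : x \in Q -> y \in Q -> com x y \in 'Z(Q).
Proof. by rewrite -comE; apply: frame_comZ. Qed.
Let comMr x y z : x \in Q -> y \in Q -> z \in Q -> com x (y * z) = com x y * com x z.
Proof. by rewrite -!comE; apply: frame_commMr. Qed.
Let comV x y : (com x y)^-1 = com y x. Proof. by rewrite -!comE invg_comm. Qed.
Let com1 x : com x 1 = 1. Proof. by rewrite -!comE commg1. Qed.
Let comC x y : x * y = y * x * com x y. Proof. by rewrite -comE commgC. Qed.
Let comJt x y : jt (com x y) = com (jt x) (jt y). Proof. by rewrite -!comE -!jtE conjRg. Qed.
Let jt_fix x : x \in Q -> jt x = x -> x = 1.
Proof.
move=> Qx; rewrite -jtE => /conjg_fixP/commgP/cent1P c.
have: x \in 'C_Q[t] by rewrite inE Qx.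
by rewrite (frame_fix fr) => /set1P.
Qed.
Let EP x : (x \in E) = (x \in Q) && (js x == x).
Proof.
rewrite inE -jsE; congr (_ && _); apply/cent1P/eqP=> [c|c].
  by apply/conjg_fixP/commgP.
by apply/commgP/conjg_fixP.
Qed.
Let Es x : x \in E -> js x = x. Proof. by rewrite EP => /andP[_ /eqP]. Qed.
Let EQ x : x \in E -> x \in Q. Proof. by case/setIP. Qed.
Let ZQ := frame_ZQ.
Let Zcom := frame_Zcom.
Let ZV := frame_ZV.
Let Zsq := frame_Zsq.

(* The norm of x lies in Z, and is fixed by t because it is central. *)
Lemma norm_jt x : x \in Q -> x * jt x * jt (jt x) = 1.
Proof.
move=> Qx; set y := _ * _ * _.
have Qy : y \in Q by rewrite !groupM ?jtQ ?jtQ.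
have yt : jt y = x^-1 * y * x by rewrite /y !jtM jttt !mulgA mulVg mul1g.
have Zy : y \in 'Z(Q).
  apply: (frame_fixZ fr) => //; rewrite commgEl jtE yt.
  by rewrite -mulgA -conjgE -commgEl frame_comZ.
apply: jt_fix => //; rewrite yt -mulgA (Zcom Zy Qx) mulKg //.
Qed.

Lemma jtt x : x \in Q -> jt (jt x) = (jt x)^-1 * x^-1.
Proof. by move=> Qx; apply/eqP; rewrite -invMg eq_sym eq_invg_mul norm_jt. Qed.

(** For x in E, s sends x^t to x^(t^2); if it fixes x^t, then t fixes x, and t has no nontrivial
    fixed point in Q. *)
Lemma tiEEt_jt x : x \in E -> jt x \in E -> x = 1.
Proof.
move=> Ex Ey; apply: jt_fix; first exact: EQ.
have := Es Ey; rewrite jts (Es Ex) => e.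
by rewrite -{2}(jttt x) !e.
Qed.

(** Fixed points of s in Q / Z lift to fixed points in Q. Here z is itself fixed by s, and s sends
    z^t to z^t * z, so the correction z^t absorbs z. *)
Lemma lift_js y z : y \in Q -> z \in 'Z(Q) -> js y = y * z ->
  exists2 w, w \in 'Z(Q) & y * w \in E.
Proof.
move=> Qy Zz ys; have Zzt := jtZ Zz.
have zs : js z = z.
  have zz: z * js z = 1.
    by apply: (mulgI y); rewrite mulgA -ys -jsM -ys jss mulg1.
  by apply: (mulgI z); rewrite zz Zsq.
exists (jt z) => //; rewrite EP groupM ?(ZQ Zzt) //= jsM ys jts zs jtt ?ZQ //.
by rewrite (ZV Zz) (ZV Zzt) -(Zcom Zz (ZQ Zzt)) mulgA -(mulgA y) Zsq // mulg1.
Qed.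

Lemma EEt_jt q : q \in Q -> exists x y, [/\ x \in E, y \in E & q = x * jt y].
Proof.
(* The centre is decomposed first, because a general q is only decomposed up to a central factor. *)
have liftZ z : z \in 'Z(Q) -> exists x y, [/\ x \in E, y \in E & z = x * jt y].
  move=> Zz; have Zzs := jsZ Zz; have ab := Zcom Zz (ZQ Zzs).
  set u := z * js z; have Zu : u \in 'Z(Q) by rewrite groupM.
  have Eu : u \in E by rewrite EP ZQ //= jsM jss /u ab.
  exists (z * jt u), u; split=> //; last by rewrite -mulgA Zsq ?jtZ // mulg1.
  rewrite EP groupM ?(ZQ (jtZ Zu)) ?ZQ // jsM jts (Es Eu) jtt ?ZQ //.
  rewrite (ZV Zu) (ZV (jtZ Zu)) (Zcom (jtZ Zu) (ZQ Zu)) mulgA; apply/eqP.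
  by congr (_ * _); rewrite /u ab mulgA Zsq // mul1g.
(* If q = x * jt y, then q^-1 * js q is y modulo Z. *)
move=> Qq; set v := q^-1 * js q.
have Qv : v \in Q by rewrite groupM ?groupV ?jsQ.
have vs : js v = v^-1 by rewrite /v jsM jsV jss invMg invgK.
have [w Zw Evw] : exists2 w, w \in 'Z(Q) & v * w \in E.
  apply: (@lift_js _ (v^-1 * v^-1)) => //; first by rewrite frame_sqZ ?groupV.
  by rewrite vs mulKVg.
have [y vE Ey] : exists2 y, v = y * w & y \in E.
  by exists (v * w); rewrite // -mulgA Zsq // mulg1.
have [Qy Qw] := (EQ Ey, ZQ Zw).
have [Qyt Zwt] := (jtQ Qy, jtZ Zw).
have Qq' : q * (jt y)^-1 \in Q by rewrite groupM ?groupV.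
(* Removing y^t leaves an element fixed by s modulo Z, so [lift_js] corrects it into E; the
   correction w' is then decomposed by [liftZ]. *)
have [w' Zw' Ex] : exists2 w, w \in 'Z(Q) & q * (jt y)^-1 * w \in E.
  have Zyy := frame_sqZ Qy; have Zyyt := frame_sqZ Qyt.
  apply: (@lift_js _ (y * y * (jt y * jt y) * w)) => //; first by apply: groupM => //; apply: groupM.
  rewrite jsM jsV jts (Es Ey) jtt // invMg !invgK -(mulKVg q (js q)) -/v vE.
  rewrite -!mulgA; congr (_ * _); rewrite (mulgA y y) (mulgA _ (y * y)).
  rewrite -(Zcom Zyy) ?groupV // -mulgA mulKg.
  by rewrite (Zcom Zw (groupM Qy Qyt)) !mulgA.
set x := q * _ * w' in Ex.
have [a [b [Ea Eb ew]]] : exists x y, [/\ x \in E, y \in E & w'^-1 = x * jt y].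
  by apply: liftZ; rewrite groupV.
exists (x * a), (b * y); split; [exact: groupM | exact: groupM |].
rewrite jtM mulgA -(mulgA x) -ew /x mulgK mulgKV //.
Qed.

(** Collection in class 2, in the shape of the norm of a product. *)
Lemma mul3_com x y x1 y1 x2 y2 : x \in Q -> y \in Q ->
    x1 \in Q -> y1 \in Q -> x2 \in Q -> y2 \in Q ->
  x * y * (x1 * y1) * (x2 * y2) =
    x * x1 * x2 * (y * y1 * y2) * (com y x1 * com y x2 * com y1 x2).
Proof.
move=> Qx Qy Qx1 Qy1 Qx2 Qy2.
have Z1 := comZ Qy Qx1; have Z2 := comZ Qy Qx2; have Z3 := comZ Qy1 Qx2.
have -> : x * y * (x1 * y1) * (x2 * y2) = x * (y * x1) * (y1 * x2) * y2.
  by rewrite !mulgA.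
rewrite (comC y x1) (comC y1 x2) -!mulgA; congr (_ * (_ * _)).
set c1 := com y x1 in Z1 *; set c2 := com y x2 in Z2 *; set c3 := com y1 x2 in Z3 *.
have Q3 := ZQ Z3; rewrite (Zcom Z1); last by rewrite !groupM.
have [Q1 Q2] := (ZQ Z1, ZQ Z2).
rewrite [LHS](_ : _ = (y * x2) * (y1 * (c3 * y2)) * c1); last by rewrite !mulgA.
rewrite (comC y x2) -/c2 (Zcom Z3 Qy2) -!mulgA; congr (_ * (_ * _)).
rewrite (Zcom Z2); last by do 3?apply: groupM.
rewrite -!mulgA; congr (_ * (_ * _)).
by rewrite (Zcom Z3) ?mulgA //; apply: groupM.
Qed.

(* Expand the norm of x * y. *)
Lemma com_jt x y : x \in E -> y \in E -> jt (com y (jt x)) = com y x.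
Proof.
move=> Ex Ey; have [Qx Qy] := (EQ Ex, EQ Ey).
have [Qx' Qy'] := (jtQ Qx, jtQ Qy).
have [Qx'' Qy''] := (jtQ Qx', jtQ Qy').
have e1 : com y x * com y (jt x) * com y (jt (jt x)) = 1.
  by rewrite -!comMr ?groupM // norm_jt // com1.
have Zb := comZ Qy Qx; have Zc := comZ Qy Qx'; have Zd := comZ Qy Qx''.
have Zd' := comZ Qy' Qx''.
have e2 : com y (jt x) * com y (jt (jt x)) * com (jt y) (jt (jt x)) = 1.
  have := norm_jt (groupM Qx Qy); rewrite !jtM mul3_com //.
  by rewrite !norm_jt // !mul1g.
rewrite comJt; apply: (mulgI (com y (jt x) * com y (jt (jt x)))).
rewrite e2 -(Zcom Zb) ?mulgA ?e1 //.
by rewrite groupM // ZQ.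
Qed.

(** Exchanging x and y in [com_jt] and inverting gives the t-conjugate of the left side; one
    conjugation is undone by z^(t^2) = z^t * z on Z. *)
Lemma com_jty x y : x \in E -> y \in E -> com (jt y) x = com y x * jt (com y x).
Proof.
move=> Ex Ey; have [Qx Qy] := (EQ Ex, EQ Ey).
have [Qx' Qy'] := (jtQ Qx, jtQ Qy).
have Z1 := comZ Qy Qx; have Z2 := comZ Qy' Qx.
have e : jt (com (jt y) x) = com y x.
  by rewrite -[com (jt y) x]comV jtV com_jt // comV.
rewrite -e -{1}(jttt (com (jt y) x)) (jtt (ZQ (jtZ Z2))).
rewrite (ZV (jtZ Z2)) (ZV (jtZ (jtZ Z2))).
by rewrite (Zcom (jtZ (jtZ Z2)) (ZQ (jtZ Z2))).
Qed.

(** The right side uses only products and commutators of E: this is why E determines the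
    multiplication of Q. *)
Lemma mul_jt x y x1 y1 : x \in E -> y \in E -> x1 \in E -> y1 \in E ->
  x * jt y * (x1 * jt y1) = (x * x1 * com y x1) * jt (y * y1 * com y x1).
Proof.
move=> Ex Ey Ex1 Ey1.
have [Qx Qy] := (EQ Ex, EQ Ey).
have [Qx1 Qy1] := (EQ Ex1, EQ Ey1).
have Zb := comZ Qy Qx1; have Zbt := jtZ Zb.
rewrite -[LHS]mulgA [jt y * _]mulgA [jt y * x1]comC com_jty // !jtM.
set b := com y x1 in Zb Zbt *.
rewrite -!mulgA; congr (_ * (_ * _)).
rewrite !mulgA -(Zcom Zb) ?jtQ // -!mulgA; congr (_ * (_ * _)).
by rewrite (Zcom Zbt) ?jtQ.
Qed.

End Calculus.

(** * The factorization of Q into E and its conjugate *)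

Lemma frame_EP x : (x \in E) = (x \in Q) && (x ^ s == x).
Proof.
rewrite inE; congr (_ && _); apply/cent1P/eqP=> [c|c].
  by apply/conjg_fixP/commgP.
by apply/commgP/conjg_fixP.
Qed.

Lemma frame_EQ x : x \in E -> x \in Q. Proof. by case/setIP. Qed.

Lemma frame_Es x : x \in E -> x ^ s = x.
Proof. by rewrite frame_EP => /andP[_ /eqP]. Qed.

Let jt0 x : x ^ t = (conjg^~ t) x. Proof. by []. Qed.
Let js0 x : x ^ s = (conjg^~ s) x. Proof. by []. Qed.
Let com0 (x y : gT) : [~ x, y] = commg x y. Proof. by []. Qed.

Lemma frame_tiEEt : E :&: E :^ t = 1.
Proof.
apply/trivgP/subsetP=> x /setIP[Ex]; rewrite mem_conjg => Ey.
have /(_ (x ^ t^-1)) := tiEEt_jt jt0 js0; rewrite /= conjgKV => H.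
by rewrite inE -(conjgKV t x) (H Ey Ex) conj1g.
Qed.

Lemma frame_EEt : E * E :^ t = Q.
Proof.
apply/eqP; rewrite eqEsubset mul_subG ?subsetIl //=; last first.
  by rewrite sub_conjg (normP _) ?subsetIl // groupV (subsetP (normal_norm frame_normal)) // frame_memt.
apply/subsetP=> q Qq; have [x [y [Ex Ey ->]]] := EEt_jt jt0 js0 Qq.
by apply: mem_mulg => //; rewrite memJ_conjg.
Qed.

Lemma frame_lift y : y \in Q -> y^-1 * y ^ s \in 'Z(Q) ->
  exists2 w, w \in 'Z(Q) & y * w \in E.
Proof. by move=> Qy Zys; apply: (lift_js jt0 js0 Qy Zys); rewrite mulKVg. Qed.

Lemma frame_Jtt x : x \in Q -> (x ^ t) ^ t = (x ^ t)^-1 * x^-1.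
Proof. exact: (jtt jt0). Qed.

Lemma frame_comt x y : x \in E -> y \in E -> [~ y, x ^ t] ^ t = [~ y, x].
Proof. exact: (com_jt jt0 com0). Qed.

Lemma frame_mul x y x1 y1 : x \in E -> y \in E -> x1 \in E -> y1 \in E ->
  x * y ^ t * (x1 * y1 ^ t) = (x * x1 * [~ y, x1]) * (y * y1 * [~ y, x1]) ^ t.
Proof. exact: (mul_jt jt0 com0). Qed.

Lemma frame_cardQ : #|Q| = (#|E| ^ 2)%N.
Proof. by rewrite -{1}frame_EEt TI_cardMg ?frame_tiEEt // cardJg expnS expn1. Qed.

Lemma frame_cardG : #|G| = (#|Q| * 6)%N.
Proof.
rewrite -(sdprod_card (frame_sdprod fr)); congr (_ * _)%N.
have nts : <[s]> \subset 'N(<[t]>).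
  by rewrite norms_cycle (frame_inv fr) groupV cycle_id.
rewrite norm_joinEr // TI_cardMg.
  by rewrite -!orderE (frame_order_t fr) (frame_order_s fr).
by apply: coprime_TIg; rewrite -!orderE (frame_order_t fr) (frame_order_s fr).
Qed.

(** * The centre of E, and E as an extraspecial group *)

(** For z in Z the product z * z^s is fixed by s, so a trivial intersection would force s to
    centralize Z; then Z would lie in E and in E^t, which meet trivially. *)
Lemma frame_nontrivial_centerE : 'Z(Q) :&: E != 1.
Proof.
apply/eqP=> ti; have nZ : 'Z(Q) <| G := gFnormal_trans _ frame_normal.
have sZE : 'Z(Q) \subset E.
  apply/subsetP=> z Zz; rewrite frame_EP frame_ZQ //=.
  have Zzs := frame_JZs Zz; have ab := frame_Zcom Zz (frame_ZQ Zzs).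
  have: z * z ^ s \in 'Z(Q) :&: E.
    rewrite inE groupM // frame_EP groupM ?(frame_ZQ Zzs) ?frame_ZQ //=.
    by rewrite conjMg frame_Jss ab.
  by rewrite ti => /set1P/eqP; rewrite -eq_invg_mul frame_ZV // eq_sym.
have: 'Z(Q) \subset E :&: E :^ t.
  rewrite subsetI sZE -{1}(normP (subsetP (normal_norm nZ) t frame_memt)).
  by rewrite conjSg.
rewrite frame_tiEEt => /subset_leq_card.
by rewrite (frame_cardZ fr) cards1.
Qed.

(** The intersection A and its conjugate A^t meet trivially inside Z, so |A|^2 <= 4. *)
Lemma frame_card_centerE : #|'Z(Q) :&: E| = 2.
Proof.
set A := ('Z(Q) :&: E)%G.
have nZ : 'Z(Q) <| G := gFnormal_trans _ frame_normal.
have tiA : A :&: A :^ t = 1.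
  by apply/trivgP; rewrite -frame_tiEEt setISS ?conjSg ?subsetIr.
have: A * A :^ t \subset 'Z(Q).
  rewrite mul_subG ?subsetIl //.
  apply/subsetP=> x; rewrite mem_conjg => /setIP[Zx _].
  by rewrite -(conjgKV t x); apply: frame_JZt.
move/subset_leq_card; rewrite TI_cardMg // cardJg (frame_cardZ fr).
have: 1 < #|A| by rewrite cardG_gt1 frame_nontrivial_centerE.
by rewrite mulnn (@leq_exp2r _ 2 2) // => A1 A2; apply/eqP; rewrite eqn_leq A2.
Qed.

(** An element y of Z(E) also commutes with E^t, because [y, x^t] is conjugate to [y, x] for x in E;
    hence it is central in Q = E * E^t. *)
Lemma frame_centerE : 'Z(E) = 'Z(Q) :&: E.
Proof.
apply/setP=> y; apply/idP/idP=> [/centerP[Ey cy]|/setIP[/centerP[Qy cy] Ey]]; last first.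
  by apply/centerP; split=> // x /frame_EQ; apply: cy.
rewrite inE Ey andbT; apply/centerP; split=> [|q]; first exact: frame_EQ.
rewrite -{1}frame_EEt => /mulsgP[x z Ex]; rewrite mem_conjg => Ez ->.
apply: commuteM; first exact: cy.
apply/commgP; rewrite -[z](conjgKV t) -(conjg_eq1 _ t) frame_comt //.
by apply/commgP; apply: cy.
Qed.

Lemma frame_pgroupE : 2.-group E.
Proof. by apply: pgroupS (frame_pgroup fr); apply: subsetIl. Qed.

(** An abelian E would equal its centre of order 2, making |Q| = |E|^2 = 4; the hypothesis excludes
    this. *)
Lemma frame_extraspecial : 4 < #|Q| -> extraspecial E.
Proof.
move=> Q4; have oZ : #|'Z(E)| = 2 by rewrite frame_centerE frame_card_centerE.
split; last by rewrite oZ.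
have nabE : ~~ abelian E.
  apply: contraL Q4 => /center_idP EZ.
  by rewrite frame_cardQ -EZ oZ.
have sE'Z : E^`(1) \subset 'Z(E).
  rewrite gen_subG; apply/subsetP=> _ /imset2P[x y Ex Ey ->].
  by rewrite [_ \in _](_ : _ = ([~ x, y] \in 'Z(E))) // frame_centerE inE frame_comZ ?frame_EQ ?groupR.
have eE' : E^`(1) = 'Z(E).
  apply/eqP; rewrite eqEcard sE'Z oZ cardG_gt1.
  by apply: contra nabE => /eqP/derG1P.
split=> //; rewrite (Phi_joing frame_pgroupE) eE'; apply/joing_idPl.
rewrite (MhoE _ frame_pgroupE) gen_subG; apply/subsetP=> _ /imsetP[x Ex ->].
rewrite expn1 [_ \in _](_ : _ = (x ^+ 2 \in 'Z(E))) // frame_centerE.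
by apply/setIP; split; [apply: frame_sqZ; apply: frame_EQ | apply: groupX].
Qed.

End Frame.

(** * Extending isomorphisms of C_Q(s) *)

Lemma morph_act_cycle (aT rT : finGroupType) (H : {group aT}) (x : aT)
    (fH : {morphism H >-> rT}) (fK : {morphism <[x]> >-> rT}) :
    x \in 'N(H) -> {in H, forall h, fH (h ^ x) = fH h ^ fK x} ->
  {in H & <[x]>, morph_act 'J 'J fH fK}.
Proof.
move=> nHx fHx h _ Hh /cycleP[i ->] /=; rewrite morphX ?cycle_id //.
elim: i => [|i IHi]; first by rewrite !expg0 !conjg1.
by rewrite !expgSr !conjgM fHx ?IHi // memJ_norm // groupX.
Qed.

Section Extension.

Variables (gT hT : finGroupType).
Variables (G Q : {group gT}) (s t : gT) (G' Q' : {group hT}) (s' t' : hT).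
Hypotheses (fr : frame G Q s t) (fr' : frame G' Q' s' t').

Let E := ('C_Q[s])%G.
Let E' := ('C_Q'[s'])%G.

Variable f : {morphism E >-> hT}.
Hypotheses (injf : 'injm f) (imf : f @* E = E').

(** The map x * y^t |-> f x * (f y)^t' for x, y in E, expressed through the unique factorization of
    Q. *)
Definition extension_fun q :=
  f (divgr E (E :^ t) q) * f (remgr E (E :^ t) q ^ t^-1) ^ t'.

Let fE x : x \in E -> f x \in E'.
Proof. by move=> Ex; rewrite -imf mem_morphim. Qed.

Lemma extension_funE x y : x \in E -> y \in E ->
  extension_fun (x * y ^ t) = f x * f y ^ t'.
Proof.
move=> Ex Ey; rewrite /extension_fun.
have ti : E :&: (E :^ t)%G = 1 := frame_tiEEt fr.
have Eyt : y ^ t \in (E :^ t)%G by rewrite memJ_conjg.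
by rewrite (divgrMid ti) // (remgrMid ti) // conjgK.
Qed.

(** On both sides [frame_mul] gives the product by the same formula in terms of E, and f respects
    products and commutators. *)
Lemma extension_funM : {in Q &, {morph extension_fun : x y / x * y}}.
Proof.
move=> q q1; rewrite -(frame_EEt fr).
move=> /mulsgP[x y' Ex]; rewrite mem_conjg => Ey ->.
move=> /mulsgP[x1 y1' Ex1]; rewrite mem_conjg => Ey1 ->.
rewrite -[y'](conjgKV t) -[y1'](conjgKV t).
move: (y' ^ t^-1) (y1' ^ t^-1) Ey Ey1 => y y1 Ey Ey1.
have Ec : [~ y, x1] \in E by rewrite groupR.
rewrite (frame_mul fr) // (extension_funE (groupM (groupM Ex Ex1) Ec) (groupM (groupM Ey Ey1) Ec)).
rewrite (extension_funE Ex Ey) (extension_funE Ex1 Ey1) (frame_mul fr') ?fE //.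
rewrite (morphM _ (groupM Ex Ex1) Ec) (morphM _ Ex Ex1).
by rewrite (morphM _ (groupM Ey Ey1) Ec) (morphM _ Ey Ey1) morphR.
Qed.

Canonical extension_morphism := Morphism extension_funM.

Lemma extension_id x : x \in E -> extension_fun x = f x.
Proof.
by move=> Ex; rewrite -{1}[x]mulg1 -(conj1g t) extension_funE // morph1 conj1g mulg1.
Qed.

Lemma extension_idt x : x \in E -> extension_fun (x ^ t) = f x ^ t'.
Proof.
by move=> Ex; rewrite -{1}[x ^ t]mul1g extension_funE // morph1 mul1g.
Qed.

Lemma extension_Jt q : q \in Q -> extension_fun (q ^ t) = extension_fun q ^ t'.
Proof.
rewrite -(frame_EEt fr) => /mulsgP[x y' Ex]; rewrite mem_conjg => Ey ->.
rewrite -[y'](conjgKV t); move: (y' ^ t^-1) Ey => y Ey.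
have [Qx Qy] := (frame_EQ Ex, frame_EQ Ey).
have [Qxt Qyt] := (frame_Jt fr Qx, frame_Jt fr Qy).
have [Qy1 Qyt1] := (groupVr Qy, groupVr Qyt).
rewrite conjMg (frame_Jtt fr) // (extension_funM Qxt (groupM Qyt1 Qy1)).
rewrite (extension_funM Qyt1 Qy1) (extension_funM Qx Qyt).
rewrite (morphV extension_morphism Qyt) (morphV extension_morphism Qy) /=.
rewrite !extension_idt // !extension_id // conjMg (frame_Jtt fr') //.
exact: frame_EQ (fE Ey).
Qed.

Lemma extension_Js q : q \in Q -> extension_fun (q ^ s) = extension_fun q ^ s'.
Proof.
rewrite -(frame_EEt fr) => /mulsgP[x y' Ex]; rewrite mem_conjg => Ey ->.
rewrite -[y'](conjgKV t); move: (y' ^ t^-1) Ey => y Ey.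
have [Qx Qy] := (frame_EQ Ex, frame_EQ Ey).
have [Qxt Qyt] := (frame_Jt fr Qx, frame_Jt fr Qy).
rewrite conjMg (frame_Jts fr) (frame_Es Ex) (frame_Es Ey).
rewrite (extension_funM Qx (frame_Jt fr Qyt)) (extension_funM Qx Qyt).
rewrite (extension_Jt Qyt) (extension_idt Ey) (extension_id Ex).
by rewrite [RHS]conjMg (frame_Jts fr') (frame_Es (fE Ex)) (frame_Es (fE Ey)).
Qed.

(** The map on Q is extended over the semidirect products K = Q ><| <[t]> and G = K ><| <[s]>. Since
    |E| determines |G|, surjectivity gives injectivity. *)
Lemma frame_extension : exists phi : {morphism G >-> hT},
  [/\ 'injm phi, phi @* G = G', phi t = t', phi s = s' & {in E, phi =1 f}].
Proof.
have [[nQG Gt] Gs] := (frame_normal fr, frame_memt fr, frame_mems fr).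
have nQt : t \in 'N(Q) := subsetP (normal_norm nQG) t Gt.
have nQs : s \in 'N(Q) := subsetP (normal_norm nQG) s Gs.
have oQ : #|Q| = #|Q'|.
  by rewrite (frame_cardQ fr) (frame_cardQ fr') -[#|'C_Q'[s']|](congr1 (fun A : {set _} => #|A|) imf) card_injm.
have oG : #|G| = #|G'| by rewrite (frame_cardG fr) (frame_cardG fr') oQ.
have dt : #[t'] %| #[t] by rewrite (frame_order_t fr) (frame_order_t fr').
have ds : #[s'] %| #[s] by rewrite (frame_order_s fr) (frame_order_s fr').
pose ft := eltm_morphism dt; pose fs := eltm_morphism ds.
have actt : {in Q & <[t]>, morph_act 'J 'J extension_morphism ft}.
  apply: morph_act_cycle => // q Qq /=; rewrite extension_Jt //.
  by rewrite eltm_id.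
have tiQt : Q :&: <[t]> = 1.
  apply: coprime_TIg; rewrite -orderE (frame_order_t fr).
  by apply: pnat_coprime (frame_pgroup fr) _.
pose K := (Q <*> <[t]>)%G.
have eK : Q ><| <[t]> = K.
  by rewrite sdprodE ?cycle_subG //= norm_joinEr ?cycle_subG.
pose fK := sdprodm_morphism eK actt.
have oK : #|K| = (#|Q| * 3)%N.
  by rewrite -(sdprod_card eK) -orderE (frame_order_t fr).
have nKs : s \in 'N(K).
  rewrite inE conjYg join_subG; apply/andP; split.
    by rewrite (normP nQs) joing_subl.
  by rewrite -cycleJ (frame_inv fr) cycleV joing_subr.
have eKs : K ><| <[s]> = G.
  have KsG : K * <[s]> = G.
    by rewrite -norm_joinEr ?cycle_subG // -(sdprodWY (frame_sdprod fr)) joingA.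
  rewrite sdprodE ?cycle_subG //; apply: cardMg_TI.
  by rewrite KsG oK -orderE (frame_order_s fr) -mulnA (frame_cardG fr).
have fKt : fK t = t'.
  by rewrite /= sdprodmEr ?cycle_id //= eltm_id.
have fKq q : q \in Q -> fK q = extension_fun q.
  by move=> Qq; rewrite /= sdprodmEl.
have acts : {in K & <[s]>, morph_act 'J 'J fK fs}.
  apply: morph_act_cycle => // k Kk; have: k \in Q * <[t]> by rewrite (sdprodW eK).
  case/mulsgP=> q a Qq /cycleP[i ->] ->.
  have Qqs : q ^ s \in Q := frame_Js fr Qq.
  have KQ x : x \in Q -> x \in K by move=> Qx; rewrite mem_gen // inE Qx.
  have Kt : t \in K by rewrite mem_gen // inE cycle_id orbT.
  have fss : fs s = s' by rewrite /= eltm_id.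
  rewrite conjMg conjXg (frame_inv fr) (morphM fK (KQ _ Qqs) (groupX i (groupVr Kt))).
  rewrite (morphX fK i (groupVr Kt)) (morphV fK Kt) (morphM fK (KQ _ Qq) (groupX i Kt)).
  rewrite (morphX fK i Kt) fKt (fKq _ Qqs) (fKq _ Qq) (extension_Js Qq) fss.
  by rewrite [RHS]conjMg conjXg (frame_inv fr').
pose phi := sdprodm_morphism eKs acts.
have phit : phi t = t'.
  have Kt : t \in K by rewrite mem_gen // inE cycle_id orbT.
  by rewrite /phi /= sdprodmEl // fKt.
have phis : phi s = s' by rewrite /phi /= sdprodmEr ?cycle_id //= eltm_id.
have phiE : {in E, phi =1 f}.
  move=> x Ex; have Qx := frame_EQ Ex.
  have Kx : x \in K by rewrite mem_gen // inE Qx.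
  by rewrite /phi /= sdprodmEl // fKq // extension_id.
have sQG := normal_sub nQG.
have imphi : phi @* G = G'.
  apply/eqP; rewrite eq_sym eqEcard -oG leq_morphim andbT.
  have st' : t' \in phi @* G by rewrite -phit mem_morphim.
  have ss' : s' \in phi @* G by rewrite -phis mem_morphim.
  have sE' : E' \subset phi @* G.
    rewrite -imf; apply/subsetP=> _ /morphimP[x Ex _ ->].
    by rewrite -phiE // mem_morphim // (subsetP sQG) // (frame_EQ Ex).
  rewrite -(sdprodW (frame_sdprod fr')) mul_subG ?join_subG ?cycle_subG ?st' //.
  rewrite -(frame_EEt fr') mul_subG //.
  by apply/subsetP=> x; rewrite mem_conjg => /(subsetP sE'); rewrite groupJr ?groupV.
exists phi; split=> //.
by rewrite -card_im_injm imphi oG.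
Qed.

End Extension.

(** * Conjugacy of frames and outer automorphisms *)

Section FrameConjugacy.

Variables (gT : finGroupType) (G Q : {group gT}) (s t : gT).
Hypothesis fr : frame G Q s t.

Let S := (<[t]> <*> <[s]>)%G.
Let E := ('C_Q[s])%G.

Lemma frame_decomp g : g \in G -> exists q a, [/\ q \in Q, a \in S & g = q * a].
Proof.
rewrite -(sdprodW (frame_sdprod fr)) => /mulsgP[q a Qq Sa ->].
by exists q, a.
Qed.

Lemma frame_Jcyct a : a \in <[t]> -> a ^ s = a^-1.
Proof. by case/cycleP=> i ->; rewrite conjXg (frame_inv fr) expgVn. Qed.

Lemma frame_cyct_sq a : a \in <[t]> -> a^-1 * a^-1 = a.
Proof.
case/cycleP=> i ->; apply/eqP; rewrite -invMg eq_invg_mul -!expgMn; last by [].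
  by rewrite (frame_ttt fr) expg1n.
by apply/commute_sym; apply: commuteM.
Qed.

Lemma frame_S a : a \in S -> exists2 b, b \in <[t]> & a = b \/ a = b * s.
Proof.
have nts : <[s]> \subset 'N(<[t]>).
  by rewrite norms_cycle (frame_inv fr) groupV cycle_id.
rewrite /= norm_joinEr // => /mulsgP[b c tb].
have -> : <[s]>%G = [set 1; s] :> {set gT} by rewrite -cycle2g ?(frame_order_s fr).
by case/set2P=> ->-> ; exists b => //; [left; rewrite mulg1 | right].
Qed.

Lemma frame_tnV : t^-1 != t.
Proof.
rewrite eq_invg_mul; apply/negP => tt.
by have: #[t] %| 2; [rewrite order_dvdn sqg | rewrite (frame_order_t fr)].
Qed.

Lemma frame_centS_t a : a \in S -> commute a t -> a \in <[t]>.
Proof.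
case/frame_S=> b tb [-> //|->] cbs; case/negP: frame_tnV; apply/eqP.
have ct : commute b t by case/cycleP: tb => i ->; apply/commute_sym/commuteX.
have : t ^ (b * s) = t by apply/conjg_fixP/commgP/commute_sym.
rewrite conjgM; have -> : t ^ b = t by apply/conjg_fixP/commgP/commute_sym.
by rewrite (frame_inv fr).
Qed.

(** If q in Q sends t into <t>, then [t, q] lies in Q and in <t>, so q centralizes t and is trivial;
    thus S is the normalizer of <t>. *)
Lemma frame_norm_t g : g \in G -> t ^ g \in <[t]> -> g \in S.
Proof.
move=> Gg; have [q [a [Qq Sa ->]]] := frame_decomp Gg.
rewrite conjgM => tqa.
have nta : a^-1 \in 'N(<[t]>).
  rewrite groupV; apply: subsetP Sa; rewrite join_subG normG norms_cycle.
  by rewrite (frame_inv fr) groupV cycle_id.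
have tq : t ^ q \in <[t]> by rewrite -(memJ_norm _ nta) conjgK in tqa.
have nQt : t \in 'N(Q) := subsetP (normal_norm (frame_normal fr)) t (frame_memt fr).
have tiQt : Q :&: <[t]> = 1.
  apply: coprime_TIg; rewrite -orderE (frame_order_t fr).
  by apply: pnat_coprime (frame_pgroup fr) _.
have : [~ t, q] \in Q :&: <[t]>.
  apply/setIP; split; last by rewrite commgEl groupM ?groupV ?cycle_id.
  by rewrite commgEr groupM // memJ_norm ?groupV.
rewrite tiQt => /set1P/eqP/commgP ctq.
have: q \in 'C_Q[t] by rewrite inE Qq; apply/cent1P.
by rewrite (frame_fix fr) => /set1P ->; rewrite mul1g.
Qed.

(** Such a g lies in <t>, where s acts by inversion, so g = g^-1 has order dividing both 2 and 3.
    This is what separates the inner automorphisms from those fixing s and t. *)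
Lemma frame_cent g : g \in G -> commute g t -> commute g s -> g = 1.
Proof.
move=> Gg ct cs; have tg : t ^ g = t by apply/conjg_fixP/commgP/commute_sym.
have Sg : g \in S by apply: frame_norm_t; rewrite // tg cycle_id.
have tg' := frame_centS_t Sg ct.
have gs : g ^ s = g by apply/conjg_fixP/commgP.
have gV : g^-1 = g by rewrite -frame_Jcyct.
by rewrite -(frame_cyct_sq tg') {2}gV mulVg.
Qed.

(** Makes Q characteristic and independent of all choices. An element of S in the 2-core commutes
    with t, as the 2-core meets <t> trivially; hence it lies in <t> and is trivial. *)
Lemma frame_pcore : 'O_2(G) = Q.
Proof.
apply/eqP; rewrite eqEsubset pcore_max ?(frame_pgroup fr) ?(frame_normal fr) // andbT.
apply/subsetP=> x Px; have Gx := subsetP (pcore_sub _ _) x Px.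
have [q [a [Qq Sa ex]]] := frame_decomp Gx.
have sQP : Q \subset 'O_2(G) by rewrite pcore_max ?(frame_pgroup fr) ?(frame_normal fr).
have Pa : a \in 'O_2(G).
  by rewrite -(mulKg q a) -ex groupM ?groupV // (subsetP sQP).
have nPt : t \in 'N('O_2(G)).
  by apply: (subsetP (normal_norm (pcore_normal _ _))); apply: (frame_memt fr).
have tiPt : 'O_2(G) :&: <[t]> = 1.
  apply: coprime_TIg; rewrite -orderE (frame_order_t fr).
  by apply: pnat_coprime (pcore_pgroup 2 G) _.
have nta : a \in 'N(<[t]>).
  apply: subsetP Sa; rewrite join_subG normG norms_cycle.
  by rewrite (frame_inv fr) groupV cycle_id.
have : [~ a, t] \in 'O_2(G) :&: <[t]>.
  apply/setIP; split; first by rewrite commgEl groupM ?groupV // memJ_norm.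
  by rewrite commgEr groupM ?cycle_id // memJ_norm ?groupV ?cycle_id.
rewrite tiPt => /set1P/eqP/commgP cat.
have ta := frame_centS_t Sa cat.
have: a \in 'O_2(G) :&: <[t]> by rewrite inE Pa.
by rewrite tiPt => /set1P a1; rewrite ex a1 mulg1.
Qed.

Lemma frame_sylow x : x \in G -> #[x] = 3 -> 3.-Sylow(G) <[x]>.
Proof.
move=> Gx ox; rewrite pHallE cycle_subG Gx -orderE ox (frame_cardG fr) /=.
rewrite partnM // part_p'nat ?mul1n //; first by rewrite (@partnM 3 2 3) // part_p'nat ?part_pnat_id.
by apply: sub_in_pnat (frame_pgroup fr) => p _ /eqnP->.
Qed.

(** Sylow's theorem makes the subgroups of order 3 equal; what remains is conjugacy inside S, a copy
    of the symmetric group of degree 3. *)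
Lemma frame_conj s1 t1 : s1 \in G -> t1 \in G -> #[s1] = 2 -> #[t1] = 3 ->
  t1 ^ s1 = t1^-1 -> exists2 g, g \in G & s1 = s ^ g /\ t1 = t ^ g.
Proof.
move=> Gs1 Gt1 os1 ot1 ts1.
have [Gs Gt] := (frame_mems fr, frame_memt fr).
have [g Gg eg] := Sylow_trans (frame_sylow Gt (frame_order_t fr)) (frame_sylow Gt1 ot1).
pose s2 := s1 ^ g^-1; pose t2 := t1 ^ g^-1.
have et2 : <[t2]> = <[t]> by rewrite cycleJ eg conjsgK.
have Gs2 : s2 \in G by rewrite groupJ ?groupV.
have ts2 : t2 ^ s2 = t2^-1 by rewrite -conjJg ts1 conjVg.
have Ss2 : s2 \in S.
  have ns2 : s2 \in 'N(<[t]>) by rewrite -et2 inE -cycleJ ts2 cycleV.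
  by apply: frame_norm_t; rewrite // memJ_norm // cycle_id.
suff [h Gh [hs ht]] : exists2 h, h \in G & s2 = s ^ h /\ t2 = t ^ h.
  exists (h * g); first by rewrite groupM.
  by rewrite !conjgM -hs -ht !conjgKV.
have [b tb sb] := frame_S Ss2.
have Gb : b \in G by apply: subsetP tb; rewrite cycle_subG.
have {sb} sb : s2 = b * s.
  case: sb => // sb; have: #[s2] %| 3.
    by rewrite -(frame_order_t fr) sb order_dvdG.
  by rewrite /s2 orderJ os1.
(* As s inverts b and b^3 = 1, s^b = b^-2 * s = b * s: the involutions of S are conjugate under <t>.
   A remaining inversion of t is repaired below by conjugating with s first. *)
have bs : s ^ b = b * s.
  have -> : s ^ b = b^-1 * (s * b) by [].
  have -> : s * b = b^-1 * s by rewrite [RHS]conjgC conjVg frame_Jcyct ?invgK.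
  by rewrite mulgA frame_cyct_sq.
have tbt : t ^ b = t.
  by apply/conjg_fixP/commgP; case/cycleP: tb => i ->; apply: commuteX.
have t2t : t2 \in <[t]> by rewrite -et2 cycle_id.
have : t2 = t \/ t2 = t^-1.
  case/cyclePmin: t2t => i; rewrite (frame_order_t fr) => i3 e.
  case: i i3 e => [|[|[|//]]] _ e; [|by left|by right; rewrite (frame_tV fr)].
  have: #[t2] = 1%N by rewrite e order1.
  by rewrite /t2 orderJ ot1.
case=> e; [exists b => //| exists (s * b); first by rewrite groupM].
  by rewrite sb e bs tbt.
rewrite !conjgM [s ^ s]conjgE mulKg (frame_inv fr) conjVg tbt.
by rewrite sb bs e.
Qed.

Lemma frame_Aut_Q a : a \in Aut G -> a @: Q = Q.
Proof.
move=> Aa; have /charP[sQG chQ] : Q \char G by rewrite -frame_pcore pcore_char.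
rewrite -{2}(chQ [morphism of autm Aa]) ?injm_autm ?im_autm //.
by rewrite morphimEsub // autmE.
Qed.

Lemma frame_Aut_E a : a \in Aut G -> a s = s -> a \in 'N(E | 'P).
Proof.
move=> Aa as_; have [Gs sQG] := (frame_mems fr, normal_sub (frame_normal fr)).
have half b : b \in Aut G -> b s = s -> {in E, forall x, b x \in E}.
  move=> Ab bs x Ex; have Qx := frame_EQ Ex.
  rewrite frame_EP -{1}(frame_Aut_Q Ab) imset_f //=.
  rewrite -{1}bs -(autmE Ab) -morphJ ?(subsetP sQG _ Qx) //.
  by rewrite (frame_Es Ex).
apply/astabsP=> x; rewrite /= apermE; apply/idP/idP; last exact: half.
move=> Ex; rewrite -(permK a x); apply: half; rewrite ?groupV //.
by rewrite -{1}as_ permK.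
Qed.

Let cS : {group {perm gT}} := ('C_(Aut G)([set s; t] | 'P))%G.

Lemma frame_fixP a : reflect [/\ a \in Aut G, a s = s & a t = t] (a \in cS).
Proof.
apply: (iffP setIP) => [[Aa /astabP fa]|[Aa as_ at_]].
  by split=> //; apply: fa; rewrite !inE eqxx ?orbT.
by split=> //; apply/astabP=> x /set2P[] ->.
Qed.

Lemma frame_AutM a : a \in Aut G -> {in G &, {morph a : x y / x * y}}.
Proof. by rewrite inE => /andP[_ /morphicP]. Qed.

(** By [frame_conj] every automorphism agrees on s and t with an inner one, and by [frame_cent] only
    the trivial inner automorphism fixes both. *)
Lemma frame_Aut_sdprod : Inn G ><| cS = Aut G.
Proof.
have sIA : Inn G \subset Aut G by apply: Aut_conj_aut.
have autJ a x : a \in Aut G -> x \in G -> conj_aut G x ^ a = conj_aut G (a x).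
  move=> Aa Gx; have Gax : a x \in G by rewrite Aut_closed.
  have AG y : conj_aut G y \in Aut G by apply: Aut_aut.
  apply: (@eq_Aut _ G); rewrite ?groupJ ?AG //.
  move=> y Gy; rewrite conjgE !permM.
  have Gy' : a^-1 y \in G by rewrite Aut_closed ?groupV.
  rewrite !norm_conj_autE ?(subsetP (normG G)) //.
  have aM := frame_AutM Aa.
  by rewrite -[in RHS](permKV a y) -(morphJ (autm_morphism Aa)).
have nIA : Aut G \subset 'N(Inn G).
  apply/subsetP=> a Aa; rewrite inE; apply/subsetP=> _ /imsetP[_ /morphimP[x _ Gx ->] ->].
  by rewrite autJ // mem_morphim ?(subsetP (normG G)) ?Aut_closed.
rewrite sdprodE.
- apply/eqP; rewrite eqEsubset mul_subG ?subsetIl //=; apply/subsetP=> a Aa.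
  have [Gs Gt] := (frame_mems fr, frame_memt fr).
  have aM := frame_AutM Aa.
  have [g Gg [es et]] : exists2 g, g \in G & a s = s ^ g /\ a t = t ^ g.
    apply: frame_conj; rewrite ?Aut_closed //.
    - by rewrite -(autmE Aa) (order_injm (injm_autm Aa)) ?(frame_order_s fr).
    - by rewrite -(autmE Aa) (order_injm (injm_autm Aa)) ?(frame_order_t fr).
    by rewrite -(autmE Aa) -morphJ // (frame_inv fr) morphV.
  have Gg' : g^-1 \in 'N(G) by rewrite (subsetP (normG G)) ?groupV.
  have AG y : conj_aut G y \in Aut G by apply: Aut_aut.
  have ca : a * conj_aut G g^-1 \in cS.
    apply/frame_fixP; split; first by rewrite groupM.
      by rewrite permM norm_conj_autE ?Aut_closed // es conjgK.
    by rewrite permM norm_conj_autE ?Aut_closed // et conjgK.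
  have: a \in cS * Inn G.
    apply/mulsgP; exists (a * conj_aut G g^-1) (conj_aut G g^-1)^-1 => //.
      by rewrite groupV /Inn mem_morphim // groupV.
    by rewrite mulgK.
  by rewrite (normC (subset_trans (subsetIl _ _) nIA)).
- exact: subset_trans (subsetIl _ _) nIA.
apply/trivgP/subsetP=> _ /setIP[/morphimP[x nGx Gx ->] /frame_fixP[_ cs ct]].
have [Gs Gt] := (frame_mems fr, frame_memt fr).
rewrite (_ : x = 1) ?morph1 ?set11 //; apply: frame_cent => //.
  by apply/commute_sym/commgP/conjg_fixP; rewrite -(norm_conj_autE nGx).
by apply/commute_sym/commgP/conjg_fixP; rewrite -(norm_conj_autE nGx).
Qed.

(** Restriction to E. It is injective because E, s and t generate G, and onto by
    [frame_extension]. *)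
Lemma frame_fix_isog : cS \isog Aut E.
Proof.
have sEG : E \subset G.
  exact: subset_trans (subsetIl _ _) (normal_sub (frame_normal fr)).
have sCN : cS \subset 'N(E | 'P).
  by apply/subsetP=> a /frame_fixP[Aa sa _]; apply: frame_Aut_E.
pose r := [morphism of restrm sCN (restr_perm E)].
have rE a : a \in cS -> {in E, r a =1 a}.
  by move=> Ca x Ex; rewrite /r /= restr_permE // (subsetP sCN).
apply/isogP; exists r.
  apply/subsetP=> a ka; have Ca : a \in cS := subsetP (subsetIl _ _) a ka.
  have ra1 := mker ka.
  have [Aa as_ at_] := frame_fixP _ Ca.
  have aE x : x \in E -> a x = x by move=> Ex; rewrite -(rE _ Ca x Ex) ra1 perm1.
  apply/set1P/(@eq_Aut _ G) => // x Gx; rewrite perm1.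
  have [q [c [Qq Sc ->]]] := frame_decomp Gx.
  have [Gs Gt] := (frame_mems fr, frame_memt fr).
  have GQ : {subset Q <= G} := subsetP (normal_sub (frame_normal fr)).
  have at' b : b \in <[t]> -> a b = b.
    by case/cycleP=> i ->; rewrite -(autmE Aa) morphX //= autmE at_.
  have Gct b : b \in <[t]> -> b \in G by apply/subsetP; rewrite cycle_subG.
  have aQ : a q = q.
    move: Qq; rewrite -(frame_EEt fr) => /mulsgP[y z' Ey]; rewrite mem_conjg => Ez ->.
    rewrite -(conjgKV t z'); move: (z' ^ t^-1) Ez => z Ez.
    have [Qy Qz] := (frame_EQ Ey, frame_EQ Ez).
    rewrite -(autmE Aa) (morphM _ (GQ _ Qy) (groupJ (GQ _ Qz) Gt)).
    by rewrite (morphJ _ (GQ _ Qz) Gt) /= autmE aE // aE // at_.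
  have aS : a c = c.
    have [b tb [->|->]] := frame_S Sc; first exact: at'.
    by rewrite -(autmE Aa) (morphM _ (Gct _ tb) Gs) /= autmE at' // as_.
  have Gc : c \in G.
    have [b tb [->|->]] := frame_S Sc; first exact: Gct.
    by rewrite groupM // Gct.
  by rewrite -(autmE Aa) (morphM _ (GQ _ Qq) Gc) /= autmE aQ aS.
apply/eqP; rewrite eqEsubset; apply/andP; split.
  apply/subsetP=> _ /morphimP[a Ca _ ->]; have [Aa _ _] := frame_fixP _ Ca.
  by rewrite /r /=; apply: (Aut_restr_perm sEG Aa).
apply/subsetP=> b Ab.
have [phi [injphi imphi phit phis phiE]] := frame_extension fr fr (injm_autm Ab) (im_autm Ab).
have Aa : aut injphi imphi \in Aut G := Aut_aut injphi imphi.
have [Gs Gt] := (frame_mems fr, frame_memt fr).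
have Ca : aut injphi imphi \in cS by apply/frame_fixP; split=> //; rewrite autE.
apply/morphimP; exists (aut injphi imphi) => //.
apply: (@eq_Aut _ E) => //; first by rewrite /r /=; apply: (Aut_restr_perm sEG Aa).
move=> x Ex; rewrite rE // autE ?(subsetP sEG) // phiE //=.
Qed.

Theorem frame_Out_isog : Out G \isog Aut E.
Proof.
apply: isog_trans frame_fix_isog; rewrite isog_sym.
exact: sdprod_isog frame_Aut_sdprod.
Qed.

End FrameConjugacy.

(** * Submodules generated by fixed points *)

Section DentModule.

Variables (rT : finGroupType) (G Q : {group rT}) (s t : rT).
Hypotheses (nQG : Q <| G) (abQ : 2.-abelem Q) (Gt : t \in G) (Gs : s \in G).
Hypothesis genG : forall N : {group rT}, Q \subset N -> t \in N -> s \in N -> G \subset N.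
Hypothesis Qtt : forall a, a \in Q -> (a ^ t) ^ t = a * a ^ t.
Hypothesis Qfix : forall a, a \in Q -> a ^ t = a -> a = 1.
Hypothesis Qts : forall a, a \in Q -> (a ^ t) ^ s = ((a ^ s) ^ t) ^ t.
Hypothesis Qss : forall a, a \in Q -> (a ^ s) ^ s = a.

(** In this section Q plays the part of Q / Z. For a fixed by s, the group {1, a, a^t, a * a^t} is
    the submodule generated by a. *)
Definition orbit_group a := (<[a]> <*> <[a ^ t]>)%G.
Local Notation V := orbit_group.

Let Qsq a : a \in Q -> a * a = 1.
Proof. by have [_ H] := abelemP prime2 abQ; move/H. Qed.
Let Qcom a b : a \in Q -> b \in Q -> commute a b.
Proof. by move=> Qa Qb; apply: (centsP (abelem_abelian abQ)). Qed.
Let QJ a g : a \in Q -> g \in G -> a ^ g \in Q.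
Proof. by move=> Qa Gg; rewrite memJ_norm // (subsetP (normal_norm nQG)). Qed.

Let Qac a b c d : b \in Q -> c \in Q -> a * b * (c * d) = a * c * (b * d).
Proof. by move=> Qb Qc; rewrite !mulgA -(mulgA a b) (Qcom Qb Qc) !mulgA. Qed.

Let cycle2 a : a \in Q -> <[a]> = [set 1; a].
Proof.
move=> Qa; have [-> | a1] := eqVneq a 1; first by rewrite cycle1 setUid.
by apply: cycle2g; apply: (abelem_order_p abQ).
Qed.

Lemma orbit_groupE a : a \in Q -> V a = [set 1; a; a ^ t; a * a ^ t] :> {set rT}.
Proof.
move=> Qa; have Qat := QJ Qa Gt.
have cc : <[a ^ t]> \subset 'C(<[a]>).
  by apply: (sub_abelian_cent2 (abelem_abelian abQ)); rewrite cycle_subG.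
rewrite /= cent_joinEr //= !cycle2 //; apply/setP=> u; rewrite !inE -!orbA.
apply/mulsgP/or4P=> [[x y /set2P[]-> /set2P[]-> ->]|].
- by constructor 1; rewrite mulg1.
- by constructor 3; rewrite mul1g.
- by constructor 2; rewrite mulg1.
- by constructor 4.
case=> /eqP->.
- by exists 1 1; rewrite ?mulg1 ?set21.
- by exists a 1; rewrite ?mulg1 ?set21 ?set22.
- by exists 1 (a ^ t); rewrite ?mul1g ?set21 ?set22.
by exists a (a ^ t); rewrite ?set22.
Qed.

Lemma orbit_groupP a u : a \in Q ->
  reflect [\/ u = 1, u = a, u = a ^ t | u = a * a ^ t] (u \in V a).
Proof.
move=> Qa; rewrite [_ \in _](_ : _ = (u \in (V a : {set rT}))) // orbit_groupE // !inE -!orbA.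
by apply: (iffP or4P) => [] [] /eqP; [constructor 1|constructor 2|constructor 3|constructor 4
  |constructor 1|constructor 2|constructor 3|constructor 4].
Qed.

Lemma orbit_group_id a : a \in V a. Proof. by rewrite mem_gen // inE cycle_id. Qed.
Lemma orbit_group_idt a : a ^ t \in V a.
Proof. by rewrite mem_gen // inE cycle_id orbT. Qed.

Lemma orbit_group_sub a : a \in Q -> V a \subset Q.
Proof. by move=> Qa; rewrite join_subG !cycle_subG Qa QJ. Qed.

Lemma orbit_group_norm a : a \in Q -> a ^ s = a -> G \subset 'N(V a).
Proof.
move=> Qa sa; have sVQ := orbit_group_sub Qa; apply: genG.
- apply: subset_trans (cent_sub _); rewrite centsC.
  exact: subset_trans sVQ (abelem_abelian abQ).
- rewrite inE conjYg join_subG -!cycleJ !cycle_subG orbit_group_idt Qtt //.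
  by rewrite groupM ?orbit_group_id ?orbit_group_idt.
rewrite inE conjYg join_subG -!cycleJ !cycle_subG sa orbit_group_id Qts // sa Qtt //.
by rewrite groupM ?orbit_group_id ?orbit_group_idt.
Qed.

Lemma orbit_group_card a : a \in Q -> a != 1 -> #|V a| = 4.
Proof.
move=> Qa a1; have Qat := QJ Qa Gt.
have aat : a ^ t != a by apply: contra a1 => /eqP/(Qfix Qa)->.
have ca : 1 < #|<[a]>| by rewrite cardG_gt1 cycle_eq1.
have oa : #[a] = 2 by apply: (abelem_order_p abQ).
have oat : #[a ^ t] = 2 by rewrite orderJ.
have cc : <[a ^ t]> \subset 'C(<[a]>).
  by apply: (sub_abelian_cent2 (abelem_abelian abQ)); rewrite cycle_subG.
rewrite /= cent_joinEr // TI_cardMg -?orderE ?oa ?oat //.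
apply/trivgP/subsetP=> x; rewrite /= !cycle2 //= => /setIP[/set2P[-> _|->]]; first exact: set11.
by case/set2P=> [->|e]; rewrite ?set11 // -e eqxx in aat *.
Qed.

(** The involution s exchanges a^t and a * a^t, so a can be recovered from V a as its only
    nontrivial fixed point. *)
Lemma orbit_group_fix a u : a \in Q -> a ^ s = a -> u \in V a -> u ^ s = u ->
  u = 1 \/ u = a.
Proof.
move=> Qa sa Vu su; have Qat := QJ Qa Gt.
have [a1|a1] := eqVneq a 1.
  left; move: Vu; rewrite a1 => /(orbit_groupP _ (group1 Q)).
  by rewrite conj1g mulg1 => -[].
have aat : a ^ t <> a by move/(Qfix Qa)/eqP; apply/negP.
have tts : (a ^ t) ^ s = a * a ^ t by rewrite Qts // sa Qtt.
case/(orbit_groupP _ Qa): Vu => e; [by left|by right| |]; case/negP: a1; apply/eqP.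
  by move: su; rewrite e tts -[X in _ = X]mul1g => /mulIg.
move: su; rewrite e conjMg sa tts => /mulgI.
by rewrite -[X in _ = X]mul1g => /mulIg.
Qed.

Lemma orbit_group_minnormal a : a \in Q -> a ^ s = a -> a != 1 -> minnormal (V a) G.
Proof.
move=> Qa sa a1; apply/mingroupP; split.
  rewrite orbit_group_norm // andbT -cardG_gt1 orbit_group_card //.
move=> H /andP[/trivgPn[u Hu u1] nHG] sHV; apply/eqP; rewrite eqEsubset sHV.
have nHt : t \in 'N(H) := subsetP nHG t Gt.
suff Ha : a \in H by rewrite join_subG !cycle_subG Ha memJ_norm.
case/(orbit_groupP _ Qa): (subsetP sHV u Hu) => e.
- by rewrite e eqxx in u1.
- by rewrite -e.
- by rewrite -(memJ_norm _ nHt) -e.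
have eu : u = (a ^ t) ^ t by rewrite Qtt.
by rewrite -(memJ_norm _ nHt) -(memJ_norm _ nHt) -eu.
Qed.

(** Any x in W that s moves gives the nontrivial fixed point x * x^s; by minimality W is the
    submodule that this point generates. *)
Lemma minnormal_orbit (W : {group rT}) : W \subset Q -> minnormal W G ->
  exists2 a, a \in W & [/\ a != 1, a ^ s = a & W = V a].
Proof.
move=> sWQ /mingroupP[/andP[ntW nWG] minW].
have nWs : s \in 'N(W) := subsetP nWG s Gs.
have [a Wa [a1 sa]] : exists2 a, a \in W & a != 1 /\ a ^ s = a.
  have [x Wx x1] := trivgPn _ ntW; have Wxs : x ^ s \in W by rewrite memJ_norm.
  have [e|ne] := eqVneq (x ^ s) x; first by exists x.
  have [Qx Qxs] := (subsetP sWQ x Wx, subsetP sWQ _ Wxs).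
  exists (x * x ^ s); first by rewrite groupM.
  split; last by rewrite conjMg Qss // (Qcom Qx Qxs).
  apply: contra ne; rewrite -eq_invg_mul => /eqP<-.
  by rewrite eq_invg_mul Qsq.
exists a => //; split=> //; have Qa := subsetP sWQ a Wa.
apply/val_inj/esym/minW => /=.
  by rewrite orbit_group_norm // andbT -cardG_gt1 (orbit_group_card Qa).
by rewrite join_subG !cycle_subG Wa memJ_norm // (subsetP nWG).
Qed.

Lemma orbit_group_inj a b : a \in Q -> b \in Q -> a ^ s = a -> b ^ s = b ->
  V a = V b -> a = b.
Proof.
move=> Qa Qb sa sb e.
have := orbit_group_id a; rewrite e => /(orbit_group_fix Qb sb)/(_ sa).
case=> // a1; have := orbit_group_id b; rewrite -e => /(orbit_group_fix Qa sa)/(_ sb).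
by rewrite a1; case.
Qed.

Lemma orbit_group_TI a b : a \in Q -> b \in Q -> a ^ s = a -> b ^ s = b ->
  a != 1 -> b != 1 -> a != b -> V a :&: V b = 1.
Proof.
move=> Qa Qb sa sb a1 b1 ab; apply/eqP/negPn/negP=> nt.
have /mingroupP[_ mina] := orbit_group_minnormal Qa sa a1.
have /mingroupP[_ minb] := orbit_group_minnormal Qb sb b1.
have P : ((V a :&: V b)%G != 1%g :> {set rT}) && (G \subset 'N((V a :&: V b)%G)).
  by rewrite nt /= normsI ?orbit_group_norm.
have ea := mina _ P (subsetIl _ _); have eb := minb _ P (subsetIr _ _).
by case/eqP: ab; apply: orbit_group_inj => //; apply: val_inj; rewrite /= -ea -eb.
Qed.

(** An equivariant isomorphism preserves the fixed points of s, so it must send a to b; it is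
    therefore unique. *)
Lemma diagonal_orbit a b (phi : rT -> rT) :
    a \in Q -> b \in Q -> a ^ s = a -> b ^ s = b -> a != 1 ->
    misom (V a) (V b) phi ->
    {in V a & G, forall u g, phi (u ^ g) = phi u ^ g} ->
  [set u * phi u | u in V a] = V (a * b).
Proof.
move=> Qa Qb sa sb a1 /misomP[morphi isophi] phiJ.
have Va := orbit_group_id a; have Vat := orbit_group_idt a.
have phia : phi a = b.
  have [inj im] := isomP isophi.
  have Vb : phi a \in V b by rewrite -im (mem_morphim (morphm_morphism morphi)).
  have spa : phi a ^ s = phi a by rewrite -phiJ // sa.
  have [p1|//] := orbit_group_fix Qb sb Vb spa. case/eqP: a1; apply: (injmP inj) => //.
  by rewrite morph1.
have phi1 : phi 1 = 1 := morph1 (morphm_morphism morphi).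
have phit : phi (a ^ t) = b ^ t by rewrite phiJ // phia.
have phim : phi (a * a ^ t) = b * b ^ t.
  exact: etrans (morphM (morphm_morphism morphi) Va Vat) (congr2 mulg phia phit).
have ab : (a * b) ^ t = a ^ t * b ^ t by rewrite conjMg.
have [Qat Qbt] := (QJ Qa Gt, QJ Qb Gt).
have abt : a * a ^ t * (b * b ^ t) = a * b * (a ^ t * b ^ t).
  exact: Qac.
rewrite (orbit_groupE (groupM Qa Qb)) orbit_groupE // ab.
by rewrite !imsetU !imset_set1 phi1 phia phit phim mulg1 abt.
Qed.

Lemma orbit_diagonal a b :
    a \in Q -> b \in Q -> a ^ s = a -> b ^ s = b -> a != 1 -> b != 1 -> a != b ->
  exists phi : {ffun rT -> rT}, [/\ misom (V a) (V b) phi,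
    {in V a & G, forall u g, phi (u ^ g) = phi u ^ g}
    & [set u * phi u | u in V a] = V (a * b)].
Proof.
move=> Qa Qb sa sb a1 b1 ab; have Qab := groupM Qa Qb.
have sab : (a * b) ^ s = a * b by rewrite conjMg sa sb.
have ab1 : a * b != 1.
  by apply: contra ab; rewrite -eq_invg_mul => /eqP<-; rewrite eq_sym eq_invg_mul Qsq.
have ab_b : a * b != b by rewrite -{2}[b]mul1g (inj_eq (mulIg b)).
have ab_a : a * b != a by rewrite -{2}[a]mulg1 (inj_eq (mulgI a)).
have ti1 := orbit_group_TI Qa Qb sa sb a1 b1 ab.
have ti2 := orbit_group_TI Qab Qb sab sb ab1 b1 ab_b.
have ti3 := orbit_group_TI Qab Qa sab sa ab1 a1 ab_a.
have [sVa sVb] := (orbit_group_sub Qa, orbit_group_sub Qb).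
have abt : (a * b) ^ t = a ^ t * b ^ t by rewrite conjMg.
have [Qat Qbt] := (QJ Qa Gt, QJ Qb Gt).
have ex u : u \in V a -> exists2 v, v \in V b & u * v \in V (a * b).
  case/(orbit_groupP _ Qa)=> ->.
  - by exists 1; rewrite ?mulg1 ?group1.
  - by exists b; rewrite ?orbit_group_id.
  - by exists (b ^ t); rewrite -?abt ?orbit_group_idt.
  exists (b * b ^ t); first by rewrite groupM ?orbit_group_id ?orbit_group_idt.
  have -> : a * a ^ t * (b * b ^ t) = a * b * (a * b) ^ t.
    by rewrite abt Qac.
  by rewrite groupM ?orbit_group_id ?orbit_group_idt.
have uniq u v w : v \in V b -> w \in V b -> u * v \in V (a * b) -> u * w \in V (a * b) -> v = w.
  move=> Vv Vw Vuv Vuw; apply/eqP; rewrite eq_mulVg1; apply/eqP/set1P; rewrite -[[set 1]]ti2.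
  apply/setIP; split; last by rewrite groupM ?groupV.
  have -> : v^-1 * w = (u * v)^-1 * (u * w) by rewrite invMg -mulgA mulKg.
  by rewrite groupM ?groupV.
pose phi := [ffun u : rT => odflt 1 [pick v in V b | u * v \in V (a * b)]].
have phiP u : u \in V a -> phi u \in V b /\ u * phi u \in V (a * b).
  case/ex=> v Vv Vuv; rewrite /phi ffunE; case: pickP => [w /andP[]//|/(_ v)].
  by rewrite Vv Vuv.
have phi_eq u v : u \in V a -> v \in V b -> u * v \in V (a * b) -> phi u = v.
  by move=> Vu Vv Vuv; have [] := phiP u Vu => h1 h2; apply: (uniq u).
have phiM : morphic (V a) phi.
  apply/morphicP=> u v Vu Vv; have [bu cu] := phiP u Vu; have [bv cv] := phiP v Vv.
  apply: phi_eq; [exact: groupM | exact: groupM |].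
  rewrite Qac ?(subsetP sVa v Vv) ?(subsetP sVb _ bu) //.
  exact: groupM.
have inj : 'injm (morphm phiM).
  apply/subsetP=> u ku; have Vu : u \in V a := subsetP (subsetIl _ _) u ku.
  have pu1 : phi u = 1 := mker ku.
  have [_] := phiP u Vu; rewrite pu1 mulg1 => Vabu.
  have: u \in V (a * b) :&: V a by apply/setIP.
  by rewrite ti3.
exists phi; split.
- apply/misomP; exists phiM; apply/isomP; split=> //.
  apply/eqP; rewrite eqEcard card_injm // !orbit_group_card // andbT.
  by apply/subsetP=> _ /morphimP[u _ Vu ->]; case: (phiP u Vu).
- move=> u g Vu Gg; have [bu cu] := phiP u Vu.
  have nV c : c \in Q -> c ^ s = c -> g \in 'N(V c).
    by move=> Qc sc; apply: (subsetP (orbit_group_norm Qc sc)).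
  by apply: phi_eq; rewrite -?conjMg memJ_norm // nV.
apply/eqP; rewrite eqEcard (orbit_group_card Qab ab1); apply/andP; split.
  by apply/subsetP=> _ /imsetP[u Vu ->]; case: (phiP u Vu).
rewrite card_in_imset ?orbit_group_card // => u v Vu Vv e.
have [bu _] := phiP u Vu; have [bv _] := phiP v Vv.
apply/eqP; rewrite eq_mulVg1; apply/eqP/set1P; rewrite -[[set 1]]ti1.
apply/setIP; split; first by rewrite groupM ?groupV.
have -> : u^-1 * v = phi u * (phi v)^-1 by rewrite -(mulKg u (phi u)) e -!mulgA mulgV mulg1.
by rewrite groupM ?groupV.
Qed.

End DentModule.

(** * Type of an extraspecial 2-group *)

Section ExtraspecialType.

Variables (gT : finGroupType) (E : {group gT}) (T : finType).
Variables (z : T) (add : T -> T -> T) (q : T -> 'F_2) (d : gT -> T).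
Hypotheses (pE : 2.-group E) (esE : extraspecial E).
Hypothesis dM : {in E &, forall x y, d (x * y) = add (d x) (d y)}.
Hypothesis dS : forall w, exists2 x, x \in E & d x = w.
Hypothesis dZ : {in E, forall x, (d x == z) = (x \in 'Z(E))}.
Hypothesis dq : {in E, forall x, (q (d x) == 0%R) = (x ^+ 2 == 1)}.
Hypothesis addz : forall w, add w z = w.

Let oZ : #|'Z(E)| = 2.
Proof. exact: card_center_extraspecial pE esE. Qed.

Let sqZ x : x \in E -> x * x \in 'Z(E).
Proof.
have [[ePhi _] _] := esE; move=> Ex; rewrite -ePhi (Phi_joing pE).
by rewrite -sqg mem_gen // inE (Mho_p_elt 1) ?orbT // (mem_p_elt pE).
Qed.

Let dz c : c \in 'Z(E) -> d c = z.
Proof. by move=> Zc; apply/eqP; rewrite dZ // (subsetP (center_sub E)). Qed.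

Let dinj x y : x \in E -> y \in E -> (d x == d y) = (x^-1 * y \in 'Z(E)).
Proof.
move=> Ex Ey; apply/eqP/idP=> [e|Zxy].
  have Zxx := sqZ Ex; have Zxy : x * y \in 'Z(E).
    by rewrite -dZ ?groupM // dM // -e -dM // dz.
  have -> : x^-1 * y = (x * x)^-1 * (x * y) by rewrite invMg -mulgA mulKg.
  by apply: groupM => //; rewrite groupV.
have Exy := subsetP (center_sub E) _ Zxy.
by rewrite -[in RHS](mulKVg x y) dM // (dz Zxy) addz.
Qed.

Let lift (W : {set T}) := [set x in E | d x \in W].

Let card_lift W : #|lift W| = (2 * #|W|)%N.
Proof.
rewrite -sum1_card (partition_big d (mem W)) /= => [|x]; last by rewrite inE => /andP[].
rewrite mulnC -sum_nat_const; apply: eq_bigr => w Ww.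
have [x Ex dx] := dS w; rewrite -oZ -(card_lcoset 'Z(E) x) -sum1_card.
apply: eq_bigl => y; rewrite !inE mem_lcoset.
have [Ey|nEy] := boolP (y \in E); last first.
  by apply/esym/negP=> /(subsetP (center_sub E)); rewrite groupMl ?groupV // (negPf nEy).
rewrite -(dinj Ex Ey) dx /= eq_sym andb_idl // => /eqP<-.
by rewrite Ww.
Qed.

Let liftP W x : (x \in lift W) = (x \in E) && (d x \in W).
Proof. by rewrite inE. Qed.

Let lift_group W : subspace z add W -> group_set (lift W).
Proof.
case/andP=> Wz /forall_inP Wadd; apply/group_setP; split.
  by rewrite liftP group1 dz ?group1.
move=> x y; rewrite !liftP => /andP[Ex Wx] /andP[Ey Wy]; rewrite groupM // dM //.
exact: (forall_inP (Wadd _ Wx)).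
Qed.

Let lift_abelem W : totally_singular z add q W ->
  exists2 A : {group gT}, A \in 'E_2(E) & A = lift W :> {set gT}.
Proof.
case/andP=> sW /forall_inP qW; exists (Group (lift_group sW)) => //.
apply/pElemP; split; first by apply/subsetP=> x; rewrite /= liftP => /andP[].
apply: exponent2_abelem; apply/exponentP=> x; rewrite /= liftP => /andP[Ex Wx].
by apply/eqP; rewrite -dq // qW.
Qed.

Let image_singular (A : {group gT}) : A \in 'E_2(E) -> totally_singular z add q (d @: A).
Proof.
case/pElemP=> sAE abA; have EA := subsetP sAE.
apply/andP; split; [apply/andP; split|].
- by rewrite -(dz (group1 _)) imset_f.
- apply/forall_inP=> _ /imsetP[x Ax ->]; apply/forall_inP=> _ /imsetP[y Ay ->].
  by rewrite -dM ?EA // imset_f // groupM.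
apply/forall_inP=> _ /imsetP[x Ax ->]; rewrite dq ?EA //.
by have [_ ->] := abelemP prime2 abA.
Qed.

(** The full preimage of a maximal W is a maximal elementary abelian subgroup, since the image of a
    larger one would be totally singular. In an extraspecial group all of these have rank ['r_2(E)];
    the factor 2 is |Z(E)|. *)
Let card_max W : maxset (totally_singular z add q) W -> (2 * #|W|)%N = (2 ^ 'r_2(E))%N.
Proof.
case/maxsetP=> sW maxW; have [A EA eA] := lift_abelem sW.
rewrite -card_lift -eA; have [sAE abA] := pElemP EA.
suff /pnElemP[_ _ <-] : A \in 'E_2^('r_2(E))(E).
  by rewrite -card_pgroup // abelem_pgroup.
rewrite -(pmaxElem_extraspecial pE esE); apply/pmaxElemP; split=> // B EB sAB.
have sWB : W \subset d @: B.
  apply/subsetP=> w Ww; have [x Ex dx] := dS w; rewrite -dx imset_f //.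
  by apply: (subsetP sAB); rewrite -[_ \in _]/(x \in (A : {set gT})) eA liftP Ex dx.
have eW := maxW _ (image_singular EB) sWB.
apply/eqP; rewrite eqEsubset andbC sAB eA; apply/subsetP=> x Bx.
by have [sBE _] := pElemP EB; rewrite liftP (subsetP sBE) // -eW imset_f.
Qed.

(** Stated for an arbitrary carrier because it serves both for dents, which form an [option] type,
    and for row vectors. The successor accounts for Z(E) inside the preimage. *)
Lemma quadratic_type_extraspecial m :
  quadratic_type z add q m = if 'r_2(E) == (m./2).+1 then Plus else Minus.
Proof.
rewrite /quadratic_type; congr (if _ then _ else _).
(* The type is a statement about all maximal W, so one has to exist before the rank can be read
   off. *)
have [W maxW _] : {W | maxset (totally_singular z add q) W & [set z] \subset W}.
  apply: maxset_exists; apply/andP; split; [apply/andP; split|].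
  - exact: set11.
  - by apply/forall_inP=> _ /set1P->; apply/forall_inP=> _ /set1P->; rewrite addz set11.
  apply/forall_inP=> _ /set1P->; rewrite -(dz (group1 _)) dq ?group1 //.
  by rewrite expg1n.
have card_eq U : maxset (totally_singular z add q) U ->
    (#|U| == 2 ^ m./2)%N = ('r_2(E) == (m./2).+1).
  move/card_max => cU; rewrite -(eqn_pmul2l (isT : 0 < 2)) cU -expnS.
  by rewrite eqn_exp2l.
apply/forall_inP/idP=> [H|H U maxU]; first by rewrite -(card_eq _ maxW) H.
by rewrite card_eq.
Qed.

End ExtraspecialType.

(** * Dents *)

Section Dents.

Variables (gT : finGroupType) (G Q : {group gT}) (s t : gT).
Hypotheses (fr : frame G Q s t) (Q4 : 4 < #|Q|).

Let E := ('C_Q[s])%G.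
Let cz := coset 'Z(Q).
Let Gz := (G / 'Z(Q))%G.
Let Qz := (Q / 'Z(Q))%G.

Let nZG : 'Z(Q) <| G. Proof. exact: gFnormal_trans _ (frame_normal fr). Qed.
Let NG x : x \in G -> x \in 'N('Z(Q)).
Proof. exact/subsetP/normal_norm. Qed.
Let GQ x : x \in Q -> x \in G. Proof. exact/subsetP/normal_sub/(frame_normal fr). Qed.
Let NQ x : x \in Q -> x \in 'N('Z(Q)). Proof. by move/GQ/NG. Qed.
Let Gs : s \in G := frame_mems fr.
Let Gt : t \in G := frame_memt fr.
Let czJ x y : x \in G -> y \in G -> cz (x ^ y) = cz x ^ cz y.
Proof. by move=> Gx Gy; rewrite /cz morphJ ?NG. Qed.
Let czM x y : x \in G -> y \in G -> cz (x * y) = cz x * cz y.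
Proof. by move=> Gx Gy; rewrite /cz morphM ?NG. Qed.

Let cJt x : x \in Q -> cz (x ^ t) = cz x ^ cz t.
Proof. by move=> Qx; apply: czJ => //; apply: GQ. Qed.
Let cJs x : x \in Q -> cz (x ^ s) = cz x ^ cz s.
Proof. by move=> Qx; apply: czJ => //; apply: GQ. Qed.
Let cM x y : x \in Q -> y \in Q -> cz (x * y) = cz x * cz y.
Proof. by move=> Qx Qy; apply: czM; apply: GQ. Qed.
Let cV x : x \in Q -> cz x^-1 = (cz x)^-1.
Proof. by move=> Qx; rewrite /cz morphV // NQ. Qed.
Let c1Z x : x \in Q -> cz x = 1 -> x \in 'Z(Q).
Proof. by move=> Qx /coset_idr; apply; apply: NQ. Qed.

Let nQGz : Qz <| Gz. Proof. by rewrite quotient_normal ?(frame_normal fr). Qed.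
Let Gzt : cz t \in Gz. Proof. exact: mem_quotient. Qed.
Let Gzs : cz s \in Gz. Proof. exact: mem_quotient. Qed.

Let genGz (N : {group coset_of 'Z(Q)}) :
  Qz \subset N -> cz t \in N -> cz s \in N -> Gz \subset N.
Proof.
move=> sQN Nt Ns; apply/subsetP=> _ /morphimP[g _ Gg ->].
have [q [a [Qq Sa ->]]] := frame_decomp fr Gg.
have [b tb ab] := frame_S fr Sa.
have Nb : cz b \in N.
  by case/cycleP: tb => i ->; rewrite /cz morphX ?NG // groupX.
have Gb : b \in G by apply: subsetP tb; rewrite cycle_subG.
have Nq : cz q \in N by apply: (subsetP sQN); apply: mem_quotient.
suff: cz (q * a) \in N by [].
have Gq := GQ Qq.
by case: ab => ->; rewrite !czM ?groupM.
Qed.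

Let QzP a : a \in Qz -> exists2 x, x \in Q & a = cz x.
Proof. by case/morphimP=> x _ Qx ->; exists x. Qed.

Let Qztt a : a \in Qz -> (a ^ cz t) ^ cz t = a * a ^ cz t.
Proof.
move=> Qa; have [x Qx ea] := QzP Qa; have Qxt := frame_Jt fr Qx.
have [_ sq] := abelemP prime2 (frame_abelem fr).
have Qat : a ^ cz t \in Qz by rewrite memJ_norm // (subsetP (normal_norm nQGz)).
have Qaat : a * a ^ cz t \in Qz by rewrite groupM.
rewrite -[RHS](invgK) -[RHS]mul1g; apply/eqP; rewrite eq_sym mul1g invgK.
have -> : (a ^ cz t) ^ cz t = (a ^ cz t)^-1 * a^-1.
  by rewrite ea -!cJt // (frame_Jtt fr) // cM ?groupV // !cV.
by rewrite -invMg eq_sym eq_invg_mul -sqg sq.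
Qed.

Let Qzfix a : a \in Qz -> a ^ cz t = a -> a = 1.
Proof.
case/QzP=> x Qx ->; rewrite -cJt // => e; apply: coset_id.
have Qxt := frame_Jt fr Qx.
apply: (frame_fixZ fr) => //; apply: c1Z; first by rewrite commgEl groupM ?groupV.
by rewrite commgEl cM ?groupV // e cV // mulVg.
Qed.

Let Qzts a : a \in Qz -> (a ^ cz t) ^ cz s = ((a ^ cz s) ^ cz t) ^ cz t.
Proof.
case/QzP=> x Qx ->; have [Qxt Qxs] := (frame_Jt fr Qx, frame_Js fr Qx).
by rewrite -!(cJt, cJs) // ?(frame_Jts fr) //; apply: (frame_Jt fr).
Qed.

Let Qzss a : a \in Qz -> (a ^ cz s) ^ cz s = a.
Proof.
by case/QzP=> x Qx ->; rewrite -!cJs ?(frame_Js fr) // (frame_Jss fr).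
Qed.

Let cE x : x \in E -> cz x \in Qz.
Proof. by move/frame_EQ=> Qx; apply: mem_quotient. Qed.

Let cEs x : x \in E -> cz x ^ cz s = cz x.
Proof. by move=> Ex; rewrite -czJ ?(frame_Es Ex) // GQ // (frame_EQ Ex). Qed.

Let cE1 x : x \in E -> (cz x == 1) = (x \in 'Z(E)).
Proof.
move=> Ex; rewrite (frame_centerE fr) inE Ex andbT; apply/eqP/idP.
  by move/coset_idr; apply; apply: NQ (frame_EQ Ex).
exact: coset_id.
Qed.

Definition dent_of (x : gT) : {group gT} :=
  (coset 'Z(Q) @*^-1 (orbit_group (coset 'Z(Q) t) (coset 'Z(Q) x)))%G.

Let dentK x (D : {group gT}) : D = dent_of x ->
  D / 'Z(Q) = orbit_group (cz t) (cz x).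
Proof. by move->; apply: cosetpreK. Qed.

Lemma dent_ofP x : x \in E -> x \notin 'Z(E) -> is_dent G Q (dent_of x).
Proof.
move=> Ex nZx; have Qc := cE Ex; have sc := cEs Ex.
have c1 : cz x != 1 by rewrite cE1.
have sVQ : orbit_group (cz t) (cz x) \subset Qz.
  exact: (orbit_group_sub nQGz Gzt).
have nV := orbit_group_norm nQGz (frame_abelem fr) Gzt genGz Qztt Qzts Qc sc.
have sDQ : dent_of x \subset Q.
  by rewrite -(quotientGK (center_normal Q)) morphpreS.
apply/and4P; split=> //.
- rewrite -(quotientGK nZG) cosetpre_normal /normal nV andbT.
  exact: subset_trans sVQ (normal_sub nQGz).
- rewrite properE sub_cosetpre; apply/subsetPn; exists x.
    rewrite inE NQ ?(frame_EQ Ex) //= inE; exact: orbit_group_id.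
  by apply: contra nZx => Zx; rewrite (frame_centerE fr) inE Zx.
rewrite (dentK (erefl (dent_of x))); exact: (orbit_group_minnormal nQGz (frame_abelem fr) Gzt genGz Qztt Qzfix Qzts).
Qed.

(** D / Z is generated by a fixed point of s, and [frame_lift] lifts this point to E. *)
Lemma dent_of_onto D : is_dent G Q D ->
  exists2 x, x \in E & x \notin 'Z(E) /\ D = dent_of x.
Proof.
case/and4P=> nDG ZD sDQ minD.
have sZD := proper_sub ZD.
have [a Da [a1 sa eD]] := minnormal_orbit nQGz (frame_abelem fr) Gzt Gzs genGz
  Qztt Qzfix Qzts Qzss (quotientS _ sDQ) minD.
have [y NDy Dy ea] := morphimP Da; have Qy := subsetP sDQ y Dy.
have Zys : y^-1 * y ^ s \in 'Z(Q).
  have Qys := frame_Js fr Qy.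
  apply: c1Z; first by rewrite groupM ?groupV.
  by rewrite cM ?groupV // cV // cJs // (_ : cz y = a) // sa mulVg.
have [w Zw Ex] := frame_lift fr Qy Zys.
have ex : cz (y * w) = a by rewrite /cz coset_kerr.
exists (y * w) => //; split; first by rewrite -cE1 // ex.
have nZD : 'Z(Q) <| D.
  by rewrite /normal sZD (subset_trans sDQ) // (normal_norm (center_normal Q)).
apply: val_inj; rewrite /= -/cz ex.
transitivity (coset 'Z(Q) @*^-1 (D / 'Z(Q))); first by rewrite quotientGK.
by congr (_ @*^-1 _); have /= := congr1 val eD.
Qed.

(** For x in E outside Z(E), [insub] succeeds by [dent_ofP], so on E the value [None] only means the
    formal zero. *)
Definition dent_map (x : gT) : dent_space G Q :=
  if x \in 'Z(E) then None else insub (dent_of x).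

Let dent_mapT x : x \in E -> x \notin 'Z(E) ->
  exists2 D : dent G Q, dent_map x = Some D & val D = dent_of x.
Proof.
move=> Ex nZx; rewrite /dent_map (negPf nZx).
by case: insubP (dent_ofP Ex nZx) => [D _ eD _|/negPf->//]; exists D.
Qed.

Let dent_of_eq x y : x \in E -> y \in E -> (dent_of x == dent_of y) = (cz x == cz y).
Proof.
move=> Ex Ey; apply/eqP/eqP=> [e|e]; last by apply: val_inj; rewrite /= -/cz e.
apply: (orbit_group_inj nQGz (frame_abelem fr) Gzt Qztt Qzfix Qzts); rewrite ?cE ?cEs //.
by apply: val_inj; rewrite /= -(dentK (erefl (dent_of x))) e (dentK (erefl (dent_of y))).
Qed.

(** The [pick] in [dent_add] is pinned down from two sides: by [diagonal_orbit] every diagonal is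
    the dent of x * y, and by [orbit_diagonal] that dent is one. *)
Lemma dent_mapM : {in E &, forall x y,
  dent_map (x * y) = dent_add (dent_map x) (dent_map y)}.
Proof.
move=> x y Ex Ey; have Exy : x * y \in E by rewrite groupM.
have [Gx Gy] := (GQ (frame_EQ Ex), GQ (frame_EQ Ey)).
have [Zx|nZx] := boolP (x \in 'Z(E)).
  rewrite {2}/dent_map Zx /= /dent_map groupMl //; case: ifP => // _.
  congr insub; apply/eqP; rewrite dent_of_eq // czM //.
  by rewrite (eqP (_ : cz x == 1)) ?cE1 // mul1g.
have [D1 e1 v1] := dent_mapT Ex nZx; rewrite e1.
have [Zy|nZy] := boolP (y \in 'Z(E)).
  rewrite {2}/dent_map Zy /= -e1 /dent_map groupMr //; case: ifP => // _.
  congr insub; apply/eqP; rewrite dent_of_eq // czM //.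
  by rewrite (eqP (_ : cz y == 1)) ?cE1 // mulg1.
have [D2 e2 v2] := dent_mapT Ey nZy; rewrite e2 /=.
have eD : (D1 == D2) = (cz x == cz y) by rewrite -val_eqE v1 v2 dent_of_eq.
have sqx : cz x * cz x = 1.
  by have [_ sq] := abelemP prime2 (frame_abelem fr); rewrite -sqg sq ?cE.
have exy : (x * y \in 'Z(E)) = (D1 == D2).
  rewrite eD -cE1 // czM // -eq_invg_mul; congr (_ == _).
  by apply/eqP; rewrite eq_invg_mul sqx.
have [Zxy|nZxy] := boolP (x * y \in 'Z(E)).
  by rewrite /dent_map Zxy -exy Zxy.
rewrite -exy (negPf nZxy).
have [D3 e3 v3] := dent_mapT Exy nZxy; rewrite e3.
have [Qx Qy] := (cE Ex, cE Ey); have [sx sy] := (cEs Ex, cEs Ey).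
have [x1 y1] : cz x != 1 /\ cz y != 1 by rewrite !cE1.
have xy : cz x != cz y by rewrite -eD -exy.
case: pickP => [D /existsP[phi /and3P[iso /forall_inP equiv /eqP eqD]]|].
  congr Some; apply: val_inj; rewrite v3; apply: val_inj; rewrite [RHS]eqD /=.
  rewrite (dentK v1) (dentK v2) in iso; rewrite (dentK v1) in equiv *.
  rewrite (diagonal_orbit nQGz (frame_abelem fr) Gzt Gzs Qztt Qzfix Qzts Qx Qy sx sy x1 iso).
    by rewrite -czM.
  by move=> u g Vu Gg; apply/eqP; apply: (forall_inP (equiv u Vu)).
have [phi [iso equiv eV]] := orbit_diagonal nQGz (frame_abelem fr) Gzt genGz Qztt Qzfix Qzts
  Qx Qy sx sy x1 y1 xy.
move/(_ D3)/negbT/negP; case; rewrite /is_diagonal; apply/existsP; exists phi; rewrite (dentK v1) (dentK v2) iso /=.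
apply/andP; split.
  by apply/forall_inP=> u Vu; apply/forall_inP=> g Gg; rewrite equiv.
by rewrite eV v3 /= -/cz czM.
Qed.

Lemma dent_map_onto w : exists2 x, x \in E & dent_map x = w.
Proof.
case: w => [D|]; last by exists 1; rewrite ?group1 // /dent_map group1.
have [x Ex [nZx eD]] := dent_of_onto (valP D).
exists x => //; have [D' -> eD'] := dent_mapT Ex nZx.
by congr Some; apply: val_inj; rewrite eD' eD.
Qed.

Lemma dent_mapZ : {in E, forall x, (dent_map x == None) = (x \in 'Z(E))}.
Proof.
move=> x Ex; have [Zx|nZx] := boolP (x \in 'Z(E)); first by rewrite /dent_map Zx.
by have [D -> _] := dent_mapT Ex nZx.
Qed.

Lemma dent_of_mul x : x \in E ->
  dent_of x = 'Z(Q) * (<[x]> <*> <[x ^ t]>) :> {set gT}.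
Proof.
move=> Ex; have Qx := frame_EQ Ex; have Qxt := frame_Jt fr Qx.
have sNx : <[x]> \subset 'N('Z(Q)) by rewrite cycle_subG NQ.
have sNxt : <[x ^ t]> \subset 'N('Z(Q)) by rewrite cycle_subG NQ.
rewrite -quotientK ?join_subG ?sNx // quotientY //.
by rewrite !quotient_cycle ?NQ // -/cz cJt.
Qed.

(** The dent is Z * <x, x^t> of order 16, and x commutes with x^t because [x, x^t] is conjugate to
    [x, x]; so its exponent is 2 exactly when x^2 = 1. *)
Lemma singular_dent_of x : x \in E -> x \notin 'Z(E) ->
  singular (dent_of x) = (x ^+ 2 == 1).
Proof.
move=> Ex nZx; have Qx := frame_EQ Ex; have Qxt := frame_Jt fr Qx.
have card_D : #|dent_of x| = 16.
  rewrite card_cosetpre (frame_cardZ fr).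
  by rewrite (orbit_group_card nQGz (frame_abelem fr) Gzt Qzfix) ?cE1 ?cE.
rewrite /singular card_D eqxx andbT; apply/idP/eqP=> [abD|x2].
  have [_ ->] := abelemP prime2 abD; first by [].
  rewrite -[_ \in _]/(x \in (dent_of x : {set gT})) dent_of_mul //.
  apply/mulsgP; exists 1 x; rewrite ?group1 ?mul1g //.
  by apply: (subsetP (joing_subl _ _)); apply: cycle_id.
have cxxt : commute x (x ^ t).
  apply/commgP; rewrite -(conjg_eq1 _ t) (frame_comt fr Ex Ex).
  by apply/commgP.
have cc : <[x ^ t]> \subset 'C(<[x]>).
  by rewrite cycle_subG; apply/centP=> _ /cycleP[i ->]; apply/commuteX/commute_sym.
have xt2 : (x ^ t) ^+ 2 = 1 by rewrite -conjXg x2 conj1g.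
apply: exponent2_abelem; apply/exponentP=> d.
rewrite -[_ \in _]/(d \in (dent_of x : {set gT})) dent_of_mul // cent_joinEr //.
case/mulsgP=> z _ Zz /mulsgP[_ _ /cycleP[i ->] /cycleP[j ->] ->] ->.
have cij : commute (x ^+ i) ((x ^ t) ^+ j) by apply/commuteX/commute_sym/commuteX/commute_sym.
rewrite expgMn; last by apply: (frame_Zcom Zz); apply: groupM; apply: groupX.
rewrite expgMn // -!expgM ![(_ * 2)%N]mulnC !expgM x2 xt2 !expg1n !mulg1.
exact: (frame_Zsq fr Zz).
Qed.

Lemma dent_map_q : {in E, forall x, (dent_q (dent_map x) == 0%R) = (x ^+ 2 == 1)}.
Proof.
move=> x Ex; have [Zx|nZx] := boolP (x \in 'Z(E)).
  rewrite /dent_map Zx /= eqxx; apply/esym/eqP.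
  move: Zx; rewrite (frame_centerE fr) => /setIP[Zx _].
  exact: (frame_Zsq fr Zx).
have [D -> eD] := dent_mapT Ex nZx; rewrite /= eD singular_dent_of //.
by case: ifP.
Qed.

Theorem dent_type m :
  quadratic_type None (@dent_add gT G Q) (@dent_q gT G Q) m =
    if 'r_2(E) == (m./2).+1 then Plus else Minus.
Proof.
apply: (quadratic_type_extraspecial (frame_pgroupE fr) (frame_extraspecial fr Q4)
  dent_mapM dent_map_onto dent_mapZ dent_map_q).
by case.
Qed.

End Dents.

(** * Extensions with a bilinear cocycle *)

Section RingScope8.

Local Open Scope ring_scope.

Lemma addF2 (x : 'F_2) : x + x = 0.
Proof. by have [->|->] := F2P x; apply: val_inj. Qed.

Lemma oppF2 (x : 'F_2) : - x = x.
Proof. by apply/eqP; rewrite eq_sym -addr_eq0 addF2. Qed.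

Lemma addmx2 m n (A : 'M['F_2]_(m, n)) : A + A = 0.
Proof. by apply/matrixP=> i j; rewrite !mxE addF2. Qed.

Lemma oppmx2 m n (A : 'M['F_2]_(m, n)) : - A = A.
Proof. by apply/matrixP=> i j; rewrite !mxE oppF2. Qed.

Section BilinearForm.

Variable m : nat.
Implicit Types (f : 'M['F_2]_m) (u v w : 'rV['F_2]_m).

Definition blf f u v : 'F_2 := (u *m f *m v^T) 0 0.

Lemma blfDl f u u' v : blf f (u + u') v = blf f u v + blf f u' v.
Proof. by rewrite /blf !mulmxDl mxE. Qed.

Lemma blfDr f u v v' : blf f u (v + v') = blf f u v + blf f u v'.
Proof. by rewrite /blf linearD mulmxDr mxE. Qed.

Lemma blf0l f v : blf f 0 v = 0. Proof. by rewrite /blf !mul0mx mxE. Qed.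
Lemma blf0r f v : blf f v 0 = 0. Proof. by rewrite /blf trmx0 mulmx0 mxE. Qed.

Lemma blf_addl f g u v : blf (f + g) u v = blf f u v + blf g u v.
Proof. by rewrite /blf mulmxDr mulmxDl mxE. Qed.

Lemma blf_tr f u v : blf f^T u v = blf f v u.
Proof.
have -> : blf f v u = (v *m f *m u^T)^T 0 0 by rewrite mxE.
by rewrite !trmx_mul trmxK mulmxA.
Qed.

Lemma blfZl f a u v : blf f (a *: u) v = a * blf f u v.
Proof. by rewrite /blf -!scalemxAl mxE. Qed.

(** The polar form of v |-> f(v, v) in characteristic 2; it also gives the commutators in the
    extension, see [fext_comm]. *)
Definition sym_form f := f + f^T.

Lemma sym_formE f u v : blf (sym_form f) u v = blf f u v + blf f v u.
Proof. by rewrite blf_addl blf_tr. Qed.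

Lemma sym_formC f u v : blf (sym_form f) u v = blf (sym_form f) v u.
Proof. by rewrite !sym_formE addrC. Qed.

Lemma sym_formvv f u : blf (sym_form f) u u = 0.
Proof. by rewrite sym_formE addF2. Qed.

Lemma blf_unit f u : f \in unitmx -> (forall v, blf f u v = 0) -> u = 0.
Proof.
move=> uf H; suff: u *m f = 0.
  by move/(congr1 (mulmx^~ (invmx f))); rewrite mulmxK // mul0mx.
apply/rowP=> i; have := H (delta_mx 0 i).
by rewrite /blf trmx_delta -colE !mxE.
Qed.

Lemma blf_functional f (h : 'rV['F_2]_m -> 'F_2) : f \in unitmx ->
  (forall u v, h (u + v) = h u + h v) -> exists u, forall v, h v = blf f v u.
Proof.
move=> uf hD; have h0 : h 0 = 0.
  by have := hD 0 0; rewrite addr0 addF2.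
have hZ a v : h (a *: v) = a * h v.
  by have [->|->] := F2P a; rewrite ?scale0r ?mul0r ?scale1r ?mul1r.
pose c := \col_i h (delta_mx 0 i).
exists (invmx f *m c)^T => v; rewrite /blf trmxK -mulmxA (mulmxA f) mulmxV // mul1mx.
have -> : h v = h (\sum_j v 0 j *: delta_mx 0 j) by rewrite -row_sum_delta.
rewrite (big_morph h hD h0) mxE; apply: eq_bigr => j _.
by rewrite hZ mxE.
Qed.

End BilinearForm.

(* The extension of V = GF(2)^m by GF(2) with the bilinear cocycle f. *)
Definition fext m (_ : 'M['F_2]_m) : Type := ('rV['F_2]_m * 'F_2)%type.
HB.instance Definition _ m (f : 'M['F_2]_m) := Finite.on (fext f).

Section ExtensionGroup.

Variables (m : nat) (f : 'M['F_2]_m).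

Local Notation T := (fext f).

Definition fext_mul (x y : T) : T := (x.1 + y.1, x.2 + y.2 + blf f x.1 y.1).
Definition fext_one : T := (0, 0).
Definition fext_inv (x : T) : T := (x.1, x.2 + blf f x.1 x.1).

Lemma fext_mulA : associative fext_mul.
Proof.
move=> [u a] [v b] [w c]; congr (_, _); first exact: addrA.
by rewrite /= blfDl blfDr; ring.
Qed.

Lemma fext_mul1 : left_id fext_one fext_mul.
Proof. by case=> u a; rewrite /fext_mul /= blf0l addr0 !add0r. Qed.

Lemma fext_mulV : left_inverse fext_one fext_inv fext_mul.
Proof.
move=> [u a]; rewrite /fext_mul /=; congr (_, _); first exact: addmx2.
by have [->|->] := F2P a; have [->|->] := F2P (blf f u u); apply: val_inj.
Qed.

HB.instance Definition _ :=
  Finite_isGroup.Build T fext_mulA fext_mul1 fext_mulV.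

Local Open Scope group_scope.

Local Notation E := [set: T].

Lemma fextM (x y : T) : x * y = (x.1 + y.1, x.2 + y.2 + blf f x.1 y.1)%R :> T.
Proof. by []. Qed.

Lemma fext1 : 1 = (0, 0)%R :> T. Proof. by []. Qed.

Lemma fext_comm (x y : T) : x * y = y * x * ((0%R, blf (sym_form f) x.1 y.1) : T).
Proof.
rewrite !fextM /=; congr (_, _); first by rewrite addr0 addrC.
by rewrite blf0r addr0 sym_formE [(y.2 + x.2)%R]addrC -!addrA
  [(blf f y.1 x.1 + _)%R]addrC -addrA addF2 addr0.
Qed.

Lemma fext_sq (x : T) : x ^+ 2 = (0, blf f x.1 x.1)%R :> T.
Proof. by rewrite sqg fextM addmx2 addF2 add0r. Qed.

Lemma fext_central (c : 'F_2) (x : T) :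
  ((0%R, c) : T) * x = (x.1, x.2 + c)%R :> T.
Proof. by rewrite fextM /= blf0l add0r addr0 addrC. Qed.

Lemma card_fext : #|E| = (2 ^ m.+1)%N.
Proof. by rewrite cardsT card_prod card_mx !card_Fp // mul1n expnSr. Qed.

Lemma fext_pgroup : 2.-group E.
Proof. by rewrite /pgroup card_fext pnatX. Qed.

Hypothesis uf : sym_form f \in unitmx.

Lemma fext_center : 'Z(E) = [set x : T | x.1 == 0%R].
Proof.
apply/setP=> x; rewrite [RHS]inE; apply/centerP/eqP=> [[_ cx]|x0]; last first.
  split; rewrite ?inE // => y _; rewrite /commute fext_comm x0 blf0l.
  exact: (mulg1 (y * x)).
apply: blf_unit uf _ => v; have := cx (v, 0%R) (in_setT _).
rewrite /commute fext_comm -[RHS]mulg1 => /mulgI /(congr1 snd) /=.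
by [].
Qed.

Lemma card_fext_center : #|'Z(E)| = 2.
Proof.
rewrite fext_center; have -> : [set x : T | x.1 == 0%R] = [set 1; ((0%R, 1%R) : T)].
  apply/setP=> [[u a]]; rewrite !inE /= -!pair_eqE /=.
  by have [->|->] := F2P a; rewrite ?eqxx ?andbT ?andbF ?orbF.
rewrite cards2; suff -> : (1 : T) != ((0%R, 1%R) : T) by [].
by apply/eqP=> /(congr1 snd)/(congr1 val).
Qed.

Lemma fext_extraspecial : (0 < m)%N -> extraspecial E.
Proof.
move=> m0; split; last by rewrite card_fext_center.
have sE'Z : E^`(1) \subset 'Z(E).
  rewrite gen_subG; apply/subsetP=> _ /imset2P[x y _ _ ->].
  suff -> : [~ x, y] = ((0%R, blf (sym_form f) x.1 y.1) : T).
    by rewrite [_ \in _](_ : _ = (((0%R, blf (sym_form f) x.1 y.1) : T) \in 'Z(E))) // fext_center inE.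
  by apply: (mulgI (y * x)); rewrite -commgC -fext_comm.
have eE' : E^`(1) = 'Z(E).
  apply/eqP; rewrite eqEcard sE'Z card_fext_center cardG_gt1.
  apply/eqP=> /derG1P /center_idP /(congr1 (fun A : {set _} => #|A|)).
  by rewrite card_fext_center card_fext; case: (m) m0 => // n _ /eqP; rewrite (eqn_exp2l 1).
split=> //; rewrite (Phi_joing fext_pgroup) eE'; apply/joing_idPl.
rewrite (MhoE _ fext_pgroup) gen_subG; apply/subsetP=> _ /imsetP[x _ ->].
by rewrite expn1 fext_sq [_ \in _](_ : _ = (((0%R, blf f x.1 x.1) : T) \in 'Z(E))) // fext_center inE.
Qed.

Lemma fext_type (q : 'rV['F_2]_m -> 'F_2) :
    (0 < m)%N -> (forall v, q v = blf f v v) ->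
  quadratic_type 0%R (fun u v : 'rV['F_2]_m => u + v)%R q m =
    if 'r_2(E) == (m./2).+1 then Plus else Minus.
Proof.
move=> m0 qE.
apply: (@quadratic_type_extraspecial _ _ _ _ _ _ (fun x : T => x.1) fext_pgroup (fext_extraspecial m0)).
- by [].
- by move=> w; exists ((w, 0%R) : T).
- by move=> x _; rewrite fext_center inE.
- by move=> x _; rewrite qE fext_sq fext1 -pair_eqE /= eqxx.
by move=> w; rewrite addr0.
Qed.

End ExtensionGroup.

End RingScope8.

(** * The model group *)

Section RingScope9.

Local Open Scope ring_scope.

(* The SL_2(2)-invariant part N of N (x) N, for N = GF(4) the map
   x (x) y |-> conj (x * y) in the basis 1, w of GF(4). *)
Definition tensor_proj (M : 'M['F_2]_2) : 'rV['F_2]_2 :=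
  \row_j (M j j + M ord0 ord_max + M ord_max ord0).

Lemma tensor_projE M j :
  tensor_proj M ord0 j = M j j + M ord0 ord_max + M ord_max ord0.
Proof. by rewrite mxE. Qed.

Lemma tensor_projD M N : tensor_proj (M + N) = tensor_proj M + tensor_proj N.
Proof. by apply/rowP=> j; rewrite !mxE; ring. Qed.

Lemma tensor_proj0 : tensor_proj 0 = 0.
Proof. by apply/rowP=> j; rewrite !mxE !addr0. Qed.

Lemma tensor_proj_tr M : tensor_proj M^T = tensor_proj M.
Proof. by apply/rowP=> j; rewrite !mxE; ring. Qed.

(** Equivariance under L_2(2), checked by enumeration; the associativity of the model rests on
    it. *)
Lemma tensor_projJ (g : {'GL_2['F_2]}) M :
  tensor_proj ((GLval g)^T *m M *m GLval g) = tensor_proj M *m GLval g.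
Proof.
have := GL_det g; rewrite det_mx22; move: (GLval g) => {}g.
move=> dg; apply/rowP=> j; rewrite !mxE !big_ord2 !mxE !big_ord2 !mxE.
have [a|a] := F2P (g ord0 ord0); have [b|b] := F2P (g ord0 ord_max);
have [c|c] := F2P (g ord_max ord0); have [d|d] := F2P (g ord_max ord_max);
rewrite ?a ?b ?c ?d // in dg *; have [->|->] := ord2P j; rewrite ?a ?b ?c ?d;
have [->|->] := F2P (M ord0 ord0); have [->|->] := F2P (M ord0 ord_max);
have [->|->] := F2P (M ord_max ord0); have [->|->] := F2P (M ord_max ord_max);
by apply: val_inj.
Qed.

Definition gmx (g : {'GL_2['F_2]}) : 'M['F_2]_2 := GLval g.
Arguments gmx : simpl never.

Lemma gmxM g h : gmx (g * h)%g = gmx g *m gmx h. Proof. by []. Qed.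
Lemma gmx1 : gmx 1%g = 1%:M. Proof. by []. Qed.

Lemma addr_shuffle (V : zmodType) (a b c d e k : V) :
  a + (b + c + d) + (e + k) = a + b + e + c + (k + d).
Proof.
rewrite -!addrA; congr (_ + (_ + _)); rewrite [RHS]addrCA; congr (_ + _).
by rewrite addrC -addrA.
Qed.

(* Triples (w, z, g), with N = GF(2)^2 and g in L_2(2) = GL_2(2): the group
   (V (x) N) . N given by the cocycle tform below, extended by L_2(2). *)
Definition bx m (_ : 'M['F_2]_m) : Type :=
  ('M['F_2]_(m, 2) * 'rV['F_2]_2 * {'GL_2['F_2]})%type.
HB.instance Definition _ m (f : 'M['F_2]_m) := Finite.on (bx f).

Section ModelGroup.

Variables (m : nat) (f : 'M['F_2]_m).
Local Notation GL := {'GL_2['F_2]}.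

Definition tform (w w' : 'M['F_2]_(m, 2)) : 'rV['F_2]_2 := tensor_proj (w^T *m f *m w').

Lemma tformDl w w' v : tform (w + w') v = tform w v + tform w' v.
Proof. by rewrite /tform linearD !mulmxDl tensor_projD. Qed.
Lemma tformDr w v v' : tform w (v + v') = tform w v + tform w v'.
Proof. by rewrite /tform mulmxDr tensor_projD. Qed.
Lemma tform0l v : tform 0 v = 0.
Proof. by rewrite /tform trmx0 !mul0mx tensor_proj0. Qed.
Lemma tform0r v : tform v 0 = 0.
Proof. by rewrite /tform mulmx0 tensor_proj0. Qed.
Lemma tformJ w v (g : GL) : tform (w *m gmx g) (v *m gmx g) = tform w v *m gmx g.
Proof. by rewrite /tform trmx_mul -tensor_projJ !mulmxA. Qed.

Local Notation T := (bx f).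

(** A triple (w, z, g) stands for g followed by the element (w, z) of the 2-group; moving g' to the
    left across (w, z) multiplies w and z by g' on the right. *)
Definition bx_mul (x y : T) : T :=
  (x.1.1 *m gmx y.2 + y.1.1,
   x.1.2 *m gmx y.2 + y.1.2 + tform (x.1.1 *m gmx y.2) y.1.1,
   (x.2 * y.2)%g).
Definition bx_one : T := (0, 0, 1%g).
Definition bx_inv (x : T) : T :=
  (x.1.1 *m gmx x.2^-1%g, (x.1.2 + tform x.1.1 x.1.1) *m gmx x.2^-1%g, x.2^-1%g).

Lemma bx_mulA : associative bx_mul.
Proof.
move=> [[w z] g] [[w' z'] g'] [[v y] h]; rewrite /bx_mul /=.
congr (_, _, _); last exact: mulgA.
  by rewrite gmxM mulmxDl mulmxA addrA.
rewrite !gmxM !mulmxDl !mulmxA tformDr tformDl tformJ.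
exact: addr_shuffle.
Qed.

Lemma bx_mul1 : left_id bx_one bx_mul.
Proof.
by move=> [[w z] g]; rewrite /bx_mul /= !mul0mx tform0l !add0r addr0 mul1g.
Qed.

Lemma bx_mulV : left_inverse bx_one bx_inv bx_mul.
Proof.
move=> [[w z] g]; rewrite /bx_mul /bx_inv /= mulVg.
have gg k (x : 'M['F_2]_(k, 2)) : x *m gmx g^-1%g *m gmx g = x.
  by rewrite -mulmxA -gmxM mulVg gmx1 mulmx1.
by rewrite !gg addmx2 addrAC -(addrA z) addmx2 addr0 addmx2.
Qed.

HB.instance Definition _ :=
  Finite_isGroup.Build T bx_mulA bx_mul1 bx_mulV.

Local Open Scope group_scope.

Local Notation G := [set: T].

Definition bxe (w : 'M['F_2]_(m, 2)) (z : 'rV['F_2]_2) (g : GL) : T := (w, z, g).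

Lemma bxM w z g w' z' g' : bxe w z g * bxe w' z' g' =
  bxe (w *m gmx g' + w')%R (z *m gmx g' + z' + tform (w *m gmx g') w')%R (g * g').
Proof. by []. Qed.

Lemma bxJ w z w' z' g : bxe w z 1 ^ bxe w' z' g =
  bxe (w *m gmx g)%R
      (z *m gmx g + tform (w *m gmx g) w' + tform w' (w *m gmx g))%R 1.
Proof.
apply: (mulgI (bxe w' z' g)); rewrite -conjgC !bxM !mul1g !gmx1 !mulmx1 mulg1.
congr (_, _, _); first by rewrite addrC.
rewrite -[RHS]addrA -(addrA _ (tform w' _) (tform w' _)) addmx2 addr0.
by rewrite [RHS]addrA [(z' + _)%R]addrC.
Qed.

Definition bx_pr (x : T) : GL := x.2.
Lemma bx_prM : {in G &, {morph bx_pr : x y / x * y}}. Proof. by []. Qed.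
Canonical bx_pr_morphism := Morphism bx_prM.

Definition bxQ : {group T} := ('ker bx_pr)%G.

Lemma bxQP x : (x \in bxQ) = (x.2 == 1).
Proof. by rewrite !inE. Qed.

Lemma bxQE x : x \in bxQ -> x = bxe x.1.1 x.1.2 1.
Proof. by case: x => [[w z] g]; rewrite bxQP /= => /eqP->. Qed.

Lemma bxQ_mem w z : bxe w z 1 \in bxQ. Proof. by rewrite bxQP. Qed.

Definition bx_w (x : T) : 'M['F_2]_(m, 2) := x.1.1.
Lemma bx_wM : {in bxQ &, {morph bx_w : x y / x * y}}.
Proof. by move=> x y; rewrite !bxQP => _ /eqP y1; rewrite /bx_w /= y1 mulmx1. Qed.
Canonical bx_w_morphism := Morphism bx_wM.

Lemma card_bxQ : #|bxQ| = (2 ^ (2 + 2 * m))%N.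
Proof.
have -> : #|bxQ| = #|[set: 'M['F_2]_(m, 2) * 'rV['F_2]_2]|.
  have inj : injective (fun p : 'M['F_2]_(m, 2) * 'rV['F_2]_2 => bxe p.1 p.2 1).
    by move=> [w z] [w' z'] [-> ->].
  rewrite -(card_imset _ inj).
  apply: eq_card => x; apply/idP/imsetP=> [/bxQE ->|[p _ ->]].
    by exists x.1; rewrite ?inE.
  exact: bxQ_mem.
by rewrite cardsT card_prod !card_mx card_Fp // mul1n -expnD addnC mulnC.
Qed.

Hypothesis uf : sym_form f \in unitmx.

Lemma tform_sub w w' : (tform w w' + tform w' w)%R = tensor_proj (w^T *m sym_form f *m w').
Proof.
rewrite /sym_form mulmxDr mulmxDl tensor_projD; congr (_ + _)%R.
by rewrite -[RHS]tensor_proj_tr !trmx_mul !trmxK mulmxA.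
Qed.

(** The commutator of elements with first components w and w' is [tensor_proj] of w^T (f + f^T) w',
    so nondegeneracy forces w = 0 in the centre. *)
Lemma bx_center : 'Z(bxQ) = 'ker bx_w.
Proof.
apply/setP=> x; apply/centerP/idP=> [[Qx cx]|kx]; last first.
  have Qx : x \in bxQ := subsetP (subsetIl _ _) x kx.
  have x0 : x.1.1 = 0%R := mker kx.
  split=> // y Qy; rewrite (bxQE Qx) (bxQE Qy) /commute !bxM x0 !gmx1 !mulmx1.
  by rewrite tform0l tform0r add0r !addr0 [(x.1.2 + _)%R]addrC.
apply/kerP => //; rewrite /= /bx_w.
suff H : (x.1.1^T *m sym_form f = 0)%R.
  apply: trmx_inj; rewrite trmx0.
  by have := congr1 (mulmx^~ (invmx (sym_form f))) H; rewrite mulmxK // mul0mx.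
have {}cx w : tensor_proj (x.1.1^T *m sym_form f *m w) = 0%R.
  have := cx _ (bxQ_mem w 0); rewrite (bxQE Qx) /commute !bxM !gmx1 !mulmx1 => /(congr1 (fun p => p.1.2)) /= e.
  rewrite -tform_sub; move: e; rewrite add0r addr0 => /(canRL (addKr _)) ->.
  by rewrite addKr addmx2.
move: (x.1.1^T *m sym_form f)%R cx => u cx; apply/matrixP=> k i.
(* Against a matrix unit in column 0 the product has a single nonzero column, with entries u0 and
   u1; [tensor_proj] sends it to (u0 + u1, u1), which determines both. *)
have e j : (tensor_proj (u *m delta_mx i ord0) ord0 j = 0)%R by rewrite cx mxE.
have um a b : (u *m delta_mx i ord0 : 'M['F_2]_2)%R a b = if b == ord0 then u a i else 0%R.
  rewrite mxE (bigD1 i) //= big1 ?addr0 => [|l li]; rewrite mxE.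
    by rewrite eqxx /=; case: eqP; rewrite ?mulr1 ?mulr0.
  by rewrite (negPf li) mulr0.
have := e ord_max; have := e ord0; rewrite !tensor_projE !um /= ?add0r ?addr0.
by move=> e0 e1; move: e0; rewrite e1 addr0 mxE; have [->|->] := ord2P k.
Qed.

Lemma bx_wT : bx_w @* bxQ = [set: 'M['F_2]_(m, 2)].
Proof.
apply/setP=> w; rewrite inE; apply/morphimP; exists (bxe w 0 1) => //; exact: bxQ_mem.
Qed.

Lemma bx_abelem : 2.-abelem (bxQ / 'Z(bxQ)).
Proof.
rewrite bx_center (isog_abelem (first_isog bx_w_morphism)) /=.
by apply: exponent2_abelem; apply/exponentP=> x _; apply: addmx2.
Qed.

Lemma bx_cardQZ : #|bxQ / 'Z(bxQ)| = (2 ^ (2 * m))%N.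
Proof.
rewrite bx_center (card_isog (first_isog bx_w_morphism)) /= bx_wT cardsT card_mx.
by rewrite card_Fp // mulnC.
Qed.

End ModelGroup.

End RingScope9.

(** * The model is biextraspecial *)

Lemma mulmxE (m n : nat) (x y : 'M['F_2]_(m, n)) : x * y = (x + y)%R.
Proof. by []. Qed.

Definition mx22 (a b c d : 'F_2) : 'M['F_2]_2 :=
  (\matrix_(i, j) if i == ord0 then if j == ord0 then a else b
                  else if j == ord0 then c else d)%R.

Arguments mx22 (a b c d)%_ring_scope.

Lemma mx22_GL a b c d : (a * d - b * c = 1)%R -> exists g, gmx g = mx22 a b c d.
Proof.
move=> dA; have uA : mx22 a b c d \in unitmx.
  by rewrite unitmxE det_mx22 !mxE /= dA unitr1.
by exists (FinRing.unit _ uA).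
Qed.

(** GL_2(2) spans all 2 x 2 matrices, each matrix unit being a sum of two invertible ones.
    Submodules of V (x) N are therefore closed under right multiplication by any matrix. *)
Lemma GL22_span k (S : {group 'M['F_2]_(k, 2)}) :
    (forall x g, x \in S -> (x *m gmx g)%R \in S) ->
  forall x A, x \in S -> (x *m A)%R \in S.
Proof.
move=> SG x A Sx; pose P (B : 'M['F_2]_2) := (x *m B)%R \in S.
have PD B C : P B -> P C -> P (B + C)%R.
  by move=> PB PC; rewrite /P mulmxDr -mulmxE groupM.
have P0 : P 0%R by rewrite /P mulmx0 group1.
have PG a b c d : (a * d - b * c = 1)%R -> P (mx22 a b c d).
  by case/mx22_GL=> g <-; apply: SG.
have dE i j : P (delta_mx i j).
  have [i0|i0] := ord2P i; have [j0|j0] := ord2P j.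
  - suff -> : delta_mx i j = (mx22 1 1 1 0 + mx22 0 1 1 0)%R by apply: PD; apply: PG; apply: val_inj.
    by apply/matrixP=> a b; rewrite !mxE i0 j0; have [->|->] := ord2P a; have [->|->] := ord2P b; apply: val_inj.
  - suff -> : delta_mx i j = (mx22 1 0 0 1 + mx22 1 1 0 1)%R by apply: PD; apply: PG; apply: val_inj.
    by apply/matrixP=> a b; rewrite !mxE i0 j0; have [->|->] := ord2P a; have [->|->] := ord2P b; apply: val_inj.
  - suff -> : delta_mx i j = (mx22 1 0 0 1 + mx22 1 0 1 1)%R by apply: PD; apply: PG; apply: val_inj.
    by apply/matrixP=> a b; rewrite !mxE i0 j0; have [->|->] := ord2P a; have [->|->] := ord2P b; apply: val_inj.
  - suff -> : delta_mx i j = (mx22 0 1 1 1 + mx22 0 1 1 0)%R by apply: PD; apply: PG; apply: val_inj.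
    by apply/matrixP=> a b; rewrite !mxE i0 j0; have [->|->] := ord2P a; have [->|->] := ord2P b; apply: val_inj.
rewrite -/(P A) (matrix_sum_delta A); apply: (big_ind P) => // i _; apply: (big_ind P) => // j _.
by have [->|->] := F2P (A i j); rewrite ?scale0r ?scale1r.
Qed.

(** The rows of B run through S, so the columns of its cokernel matrix vanish on S, and one of them
    does not vanish on w. *)
Lemma separating_functional n (S : {set 'rV['F_2]_n}) w :
    0%R \in S -> {in S &, forall x y, (x + y)%R \in S} -> w \notin S ->
  exists c : 'cV['F_2]_n, {in S, forall x, x *m c = 0}%R /\ (w *m c != 0)%R.
Proof.
move=> S0 SD nSw; pose B : 'M['F_2]_(#|S|, n) := (\matrix_i enum_val i)%R.
have nwB : ~~ (w <= B)%MS.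
  apply: contra nSw => /submxP[y ->]; rewrite mulmx_sum_row.
  apply: (big_ind (fun x => x \in S)) => // i _.
  have [->|->] := F2P (y ord0 i); rewrite ?scale0r ?scale1r // rowK.
  exact: enum_valP.
rewrite submxE in nwB; have [j nz] : exists j, (w *m cokermx B)%R ord0 j != 0%R.
  apply/existsP; apply: contraR nwB => /existsPn H.
  by apply/eqP/rowP=> j; rewrite [RHS]mxE; apply/eqP; have := H j; rewrite negbK.
exists (col j (cokermx B)); split=> [x Sx|].
  have -> : x = row (enum_rank_in Sx x) B by rewrite rowK enum_rankK_in.
  by rewrite colE mulmxA -row_mul mulmx_coker row0 mul0mx.
apply: contra nz => /eqP; rewrite colE mulmxA -colE => /matrixP/(_ ord0 ord0).
by rewrite !mxE => ->.
Qed.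

Section ModelBiextraspecial.

Variables (m : nat) (f : 'M['F_2]_m).
Hypotheses (uf : sym_form f \in unitmx) (m0 : (0 < m)%N).

Local Notation G := [set: bx f].
Local Notation Q := (bxQ f).

Lemma bxQ_normal : Q <| [set: bx f].
Proof. exact: ker_normal. Qed.

Lemma bx_quotient_sub : 'ker (coset Q) \subset 'ker (@bx_pr m f).
Proof. by rewrite ker_coset. Qed.

Lemma bx_quotient_dom : [set: bx f] \subset 'N(Q).
Proof. exact: normal_norm bxQ_normal. Qed.

Definition bx_quotient := factm_morphism bx_quotient_sub bx_quotient_dom.

Lemma bx_quotientE g : bx_quotient (coset Q g) = g.2.
Proof. exact: (factmE bx_quotient_sub bx_quotient_dom (in_setT g)). Qed.

Lemma bx_pr_onto : (@bx_pr m f) @* G = [set: {'GL_2['F_2]}].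
Proof.
by apply/setP=> g; rewrite inE; apply/morphimP; exists (bxe f 0 0 g); rewrite ?inE.
Qed.

Lemma bx_quotient_isom : isom (G / Q) SL22 bx_quotient.
Proof.
rewrite SL22_eqT; apply/isomP; split.
  by apply/injm_factmP; rewrite ker_coset.
by rewrite [LHS](morphim_factm bx_quotient_sub bx_quotient_dom) bx_pr_onto.
Qed.

Lemma bx_natural_center : natural_section G bx_quotient 1%G 'Z(Q)%G.
Proof.
have zM : {in 'Z(Q)%G &, {morph (fun x : bx f => x.1.2) : x y / x * y}}.
  move=> x y; rewrite -![_ \in 'Z(Q)%G]/(_ \in 'Z(Q)) (bx_center uf) => kx ky.
  have Qx : x \in Q := subsetP (subsetIl _ _) x kx.
  have Qy : y \in Q := subsetP (subsetIl _ _) y ky.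
  have x0 : x.1.1 = 0%R := mker kx.
  by rewrite (bxQE Qx) (bxQE Qy) bxM x0 gmx1 !mulmx1 tform0l addr0.
have Z0 x : x \in 'Z(Q) -> x = bxe f 0 x.1.2 1.
  rewrite (bx_center uf) => kx; have x0 : x.1.1 = 0%R := mker kx.
  by rewrite {1}(bxQE (subsetP (subsetIl _ _) x kx)) x0.
have Zz z : bxe f 0 z 1 \in 'Z(Q).
  by rewrite (bx_center uf); apply/kerP => //; apply: bxQ_mem.
exists (Morphism zM); split.
- apply/trivgP/subsetP=> x kx; have Zx : x \in 'Z(Q) := subsetP (subsetIl _ _) x kx.
  by rewrite (Z0 x Zx) (_ : x.1.2 = 0%R) ?set11 //; apply: mker kx.
- apply/setP=> z; rewrite inE; apply/morphimP; exists (bxe f 0 z 1) => //; exact: Zz.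
move=> x g Zx _; rewrite bx_quotientE (Z0 x Zx).
change ((bxe f 0%R x.1.2 1 ^ g).1.2 = (x.1.2 *m gmx g.2)%R); case: g => [[w z] g].
by rewrite -/(bxe f w z g) bxJ mul0mx tform0l tform0r !addr0.
Qed.

(** Submodules of V (x) N have the form S0 (x) N. A functional on V that vanishes on S0 for the
    lower term V, but not on some x0 of U, is a module map w |-> lam w from U to N; maximality
    identifies its kernel, and irreducibility of N its image. *)
Lemma bx_natural_chief (V U : {group bx f}) : 'Z(Q) \subset V -> U \subset Q ->
  chief_factor G V U -> natural_section G bx_quotient V U.
Proof.
move=> sZV sUQ /andP[/maxgroupP[/andP[pVU nVG] maxV] nUG].
have sVU := proper_sub pVU; have sVQ := subset_trans sVU sUQ.
have wJ (x : bx f) (g : bx f) : x \in Q -> bx_w (x ^ g) = (bx_w x *m gmx g.2)%R.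
  by move=> Qx; rewrite (bxQE Qx); case: g => [[w z] g]; rewrite -/(bxe f w z g) bxJ.
pose S := (@bx_w m f @* V)%G.
have memV x : x \in Q -> (bx_w x \in S) = (x \in V).
  move=> Qx; apply/idP/idP=> [|Vx]; last exact: mem_morphim.
  case/morphimP=> y Qy Vy e; rewrite -(mulgKV y x) groupMr //.
  apply: (subsetP sZV); rewrite (bx_center uf); apply/kerP; rewrite ?groupM ?groupV //.
  by rewrite morphM ?groupV // morphV //= e mulgV.
have SG (x : 'M['F_2]_(m, 2)) g : x \in S -> (x *m gmx g)%R \in S.
  case/morphimP=> y Qy Vy ->.
  rewrite -[g]/((bxe f 0 0 g).2) -wJ // memV ?memJ_norm //.
    by rewrite (subsetP nVG) ?inE.
  by rewrite (subsetP bx_quotient_dom) ?inE.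
have SM := GL22_span SG.
have [x0 Ux0 nVx0] : exists2 x, x \in U & x \notin V by apply/subsetPn; case/andP: pVU.
have Qx0 := subsetP sUQ x0 Ux0.
have nSw : bx_w x0 \notin S by rewrite memV.
have colS (w : 'M['F_2]_(m, 2)) j k : (col j w *m delta_mx ord0 k = w *m delta_mx j k)%R.
  by rewrite colE -mulmxA mul_delta_mx.
pose S0 := [set a : 'rV['F_2]_m | (a^T *m delta_mx ord0 ord0)%R \in S].
(* Some column of x0 is outside S0, as otherwise x0 would be a sum of elements of S; [lam] separates
   that column from S0. *)
have [lam lamS lamw] : exists2 lam : 'rV['F_2]_m, forall w, w \in S -> (lam *m w = 0)%R
    & (lam *m bx_w x0 != 0)%R.
  have [j nSj] : exists j, (col j (bx_w x0))^T%R \notin S0.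
    apply/existsP; apply: contraR nSw => /existsPn H.
    have {}H j : (bx_w x0 *m delta_mx j ord0)%R \in S.
      by have := H j; rewrite negbK inE trmxK colS.
    have -> : bx_w x0 = (bx_w x0 *m (delta_mx ord0 ord0 : 'M_2) + bx_w x0 *m (delta_mx ord_max ord0 : 'M_2) *m (delta_mx ord0 ord_max : 'M_2))%R.
      rewrite -mulmxA mul_delta_mx -mulmxDr -[LHS]mulmx1; congr (_ *m _)%R.
      by apply/matrixP=> a b; rewrite !mxE; have [->|->] := ord2P a; have [->|->] := ord2P b; apply: val_inj.
    by rewrite -mulmxE groupM // SM.
  have [|x y|c [cS cw]] := separating_functional _ _ nSj.
  - by rewrite inE trmx0 mul0mx group1.
  - by rewrite !inE => Sx Sy; rewrite linearD mulmxDl -mulmxE groupM.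
  exists c^T%R => [w Sw|].
    apply/row_matrixP=> i; rewrite row0; apply: trmx_inj; rewrite trmx0.
    apply/matrixP=> a b.
    have {}cS k : ((col k w)^T *m c = 0)%R.
      by apply: cS; rewrite inE trmxK colS SM.
    have /matrixP/(_ ord0 ord0) := cS a.
    rewrite !mxE => e; rewrite -[RHS]e; apply: eq_bigr => l _.
    by rewrite !mxE !ord1 mulrC.
  apply: contra cw => /eqP e; apply/eqP/trmx_inj.
  by rewrite trmx_mul trmxK colE mulmxA e mul0mx trmx0.
have hM : {in U &, {morph (fun x : bx f => lam *m bx_w x : 'rV['F_2]_2)%R : x y / x * y}}.
  move=> x y Ux Uy /=; rewrite (bx_wM (subsetP sUQ x Ux) (subsetP sUQ y Uy)).
  exact: mulmxDr.
pose h := Morphism hM.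
have hJ u g : u \in U -> h (u ^ g) = (h u *m gmx g.2)%R.
  by move=> Uu; rewrite /= wJ ?mulmxA ?(subsetP sUQ).
exists h; split.
- apply: maxV.
    apply/andP; split.
      rewrite properE subsetIl; apply/subsetPn; exists x0 => //.
      by apply: contra lamw => /mker/= ->.
    apply/subsetP=> g _; rewrite inE; apply/subsetP=> _ /imsetP[x kx ->].
    have Ux : x \in U := subsetP (subsetIl _ _) x kx.
    apply/kerP; first by rewrite memJ_norm // (subsetP (normal_norm nUG)) ?inE.
    by rewrite hJ // (mker kx) mul0mx.
  apply/subsetP=> x Vx; apply/kerP; first exact: (subsetP sVU).
  by apply: lamS; rewrite memV ?(subsetP sVQ).
- have hG (x : 'M['F_2]_(1, 2)) g : x \in (h @* U)%G -> (x *m gmx g)%R \in (h @* U)%G.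
    case/morphimP=> y _ Uy ->; rewrite -[g]/((bxe f 0 0 g).2) -hJ // mem_morphim //.
      by rewrite memJ_norm // (subsetP (normal_norm nUG)) ?inE.
    by rewrite memJ_norm // (subsetP (normal_norm nUG)) ?inE.
  have hMx := GL22_span hG.
  have [j r1] : exists j, (lam *m bx_w x0)%R ord0 j = 1%R.
    have [j nz] : exists j, (lam *m bx_w x0)%R ord0 j != 0%R.
      apply/existsP; apply: contraR lamw => /existsPn H.
      by apply/eqP/rowP=> j; rewrite [RHS]mxE; apply/eqP; have := H j; rewrite negbK.
    by exists j; have [e|//] := F2P ((lam *m bx_w x0)%R ord0 j); rewrite e eqxx in nz.
  apply/setP=> v; rewrite inE -[LHS]/(v \in (h @* U)%G).
  (* The row lam x0 has entry 1 at j, so multiplying it by the matrix with v in row j and zeros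
     elsewhere gives v. *)
  have -> : v = (lam *m bx_w x0 *m (delta_mx j ord0 *m v))%R.
    rewrite mulmxA -colE; apply/rowP=> k; rewrite mxE big_ord1 mxE r1 mul1r //.
  by apply: hMx; apply: (mem_morphim h Ux0 Ux0).
by move=> u g Uu _; rewrite hJ // bx_quotientE.
Qed.

Theorem bx_biextraspecial : biextraspecial_wrt m [set: bx f] Q.
Proof.
split=> //; first exact: bxQ_normal; first exact: card_bxQ.
exists bx_quotient; split.
- exact: bx_quotient_isom.
- exact: bx_natural_center.
- exact: bx_abelem.
- exact: bx_cardQZ.
exact: bx_natural_chief.
Qed.

(** * The centralizer of an involution in the model *)

Lemma bxe0M g g' : bxe f 0 0 g * bxe f 0 0 g' = bxe f 0 0 (g * g').
Proof. by rewrite bxM !mul0mx tform0l !addr0. Qed.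

(** The vector (1, 1) of N is fixed by the coordinate swap and is idempotent for the product on N,
    since a + a + a = a; so the vectors u (x) (1, 1) reproduce the cocycle f. *)
Lemma tform_diag (u v : 'rV['F_2]_m) :
  tform f (u^T *m const_mx 1)%R (v^T *m const_mx 1)%R = const_mx (blf f u v) :> 'rV_2.
Proof.
rewrite /tform trmx_mul trmxK !mulmxA -(mulmxA _ u) -(mulmxA _ (u *m f)%R).
rewrite [(u *m f *m _)%R]mx11_scalar mul_mx_scalar -scalemxAl.
apply/rowP=> j; rewrite !mxE !big_ord1 !mxE !mulr1.
by rewrite -addrA addF2 addr0 /blf mxE.
Qed.

Definition fext_to_bx (x : fext f) : bx f :=
  bxe f (x.1^T *m const_mx 1)%R (const_mx x.2) 1.

Lemma fext_to_bxM : {in [set: fext f] &, {morph fext_to_bx : x y / x * y}}.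
Proof.
move=> x y _ _; rewrite /fext_to_bx bxM gmx1 !mulmx1 mulg1; congr (_, _, _).
  by rewrite /= linearD mulmxDl.
by rewrite tform_diag; apply/rowP=> j; rewrite !mxE.
Qed.
Canonical fext_to_bx_morphism := Morphism fext_to_bxM.

Lemma injm_fext_to_bx : 'injm fext_to_bx.
Proof.
apply/injmP=> x y _ _ [/matrixP e1 /rowP e2]; case: x y e1 e2 => [u a] [v b] /= e1 e2.
congr (_, _); last by have := e2 ord0; rewrite !mxE.
by apply/rowP=> i; have := e1 i ord0; rewrite !mxE !big_ord1 !mxE !mulr1.
Qed.

(** Being fixed by the swap means having equal columns, that is, being a multiple of (1, 1) in each
    row. *)
Lemma fext_to_bx_im gs : gmx gs = mx22 0 1 1 0 ->
  fext_to_bx @* [set: fext f] = 'C_Q[bxe f 0 0 gs].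
Proof.
move=> egs; have swapP k (w : 'M['F_2]_(k, 2)) : (w *m gmx gs = w)%R <-> col ord0 w = col ord_max w.
  split=> [e|/matrixP e].
    apply/matrixP=> i j; rewrite -{1}e egs !mxE big_ord2 !mxE /=.
    by rewrite mulr0 add0r mulr1.
  apply/matrixP=> i j; rewrite egs !mxE big_ord2 !mxE /=; have := e i ord0; rewrite !mxE.
  by have [->|->] := ord2P j => /= ew; rewrite ?mulr0 ?mulr1 ?add0r ?addr0.
have CP x : (x \in 'C_Q[bxe f 0 0 gs]) = (x \in Q) && (x ^ bxe f 0 0 gs == x).
  rewrite inE; congr (_ && _); apply/cent1P/eqP=> [c|c].
    by apply/conjg_fixP/commgP.
  by apply/commgP/conjg_fixP.
apply/setP=> x; rewrite CP; apply/morphimP/andP=> [[y _ _ ->]|[Qx]].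
  split; first exact: bxQ_mem.
  rewrite /= /fext_to_bx bxJ tform0l tform0r !addr0; apply/eqP; congr (_, _, _).
    by apply/swapP/matrixP=> i j; rewrite !mxE !big_ord1 !mxE.
  by apply/swapP/matrixP=> i j; rewrite !mxE.
rewrite (bxQE Qx) bxJ tform0l tform0r !addr0 => /eqP[/swapP/matrixP ew /swapP/matrixP ez].
exists (((col ord0 x.1.1)^T, x.1.2 ord0 ord0)%R : fext f); rewrite ?inE //= /fext_to_bx /=.
congr (_, _, _).
  apply/matrixP=> i j; rewrite !mxE big_ord1 !mxE mulr1.
  by have := ew i ord0; rewrite !mxE; have [->|->] := ord2P j.
apply/matrixP=> i j; rewrite !mxE !ord1.
by have := ez ord0 ord0; rewrite !mxE; have [->|->] := ord2P j.
Qed.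

(** All pairs (s, t) are conjugate by [frame_conj], so the centralizer may be computed for explicit
    matrices. *)
Lemma bx_frame_fext Q' s t : frame [set: bx f] Q' s t -> 'C_Q'[s] \isog [set: fext f].
Proof.
move=> fr; have [s1 [t1 fr1]] := biextraspecial_frame bx_biextraspecial.
have eQ : Q' = Q by apply: val_inj; rewrite /= -(frame_pcore fr) (frame_pcore fr1).
have [gs egs] : exists g, gmx g = mx22 0 1 1 0 by apply: mx22_GL; apply: val_inj.
have [gt egt] : exists g, gmx g = mx22 0 1 1 1 by apply: mx22_GL; apply: val_inj.
have gs2 : gs * gs = 1.
  apply: val_inj; change (gmx gs *m gmx gs = 1%:M)%R; rewrite egs; apply/matrixP=> i j.
  by rewrite !mxE big_ord2 !mxE; have [->|->] := ord2P i; have [->|->] := ord2P j; apply: val_inj.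
have gt3 : gt * gt * gt = 1.
  apply: val_inj; change (gmx gt *m gmx gt *m gmx gt = 1%:M)%R; rewrite egt; apply/matrixP=> i j.
  by rewrite !mxE big_ord2 !mxE !big_ord2 !mxE; have [->|->] := ord2P i; have [->|->] := ord2P j; apply: val_inj.
have gst : gs * gt * gs = gt * gt.
  apply: val_inj; change (gmx gs *m gmx gt *m gmx gs = gmx gt *m gmx gt)%R; rewrite egs egt; apply/matrixP=> i j.
  by rewrite !mxE !big_ord2 !mxE !big_ord2 !mxE; have [->|->] := ord2P i; have [->|->] := ord2P j; apply: val_inj.
have s1' : gs != 1.
  apply/eqP=> /(congr1 (fun g => gmx g ord0 ord0)); rewrite egs gmx1 !mxE /=.
  by move/(congr1 val).
have t1' : gt != 1.
  apply/eqP=> /(congr1 (fun g => gmx g ord0 ord0)); rewrite egt gmx1 !mxE /=.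
  by move/(congr1 val).
pose s0 := bxe f 0 0 gs; pose t0 := bxe f 0 0 gt.
have ne g : g != 1 -> bxe f 0 0 g != 1 by apply: contra => /eqP[->].
have os : #[s0] = 2 by apply: nt_prime_order; rewrite ?ne // sqg bxe0M gs2.
have ot : #[t0] = 3.
  by apply: nt_prime_order; rewrite ?ne // expgS sqg !bxe0M mulgA gt3.
have sV : s0^-1 = s0 by apply/eqP; rewrite eq_invg_mul bxe0M gs2.
have ts : t0 ^ s0 = t0^-1.
  rewrite conjgE sV mulgA !bxe0M gst; apply/eqP; rewrite eq_sym eq_invg_mul bxe0M.
  by rewrite mulgA gt3.
have [g _ [es _]] := frame_conj fr (in_setT s0) (in_setT t0) os ot ts.
have -> : 'C_Q'[s] \isog [set: fext f] = ('C_Q[s0] \isog [set: fext f]).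
  have nQg : g \in 'N(Q) by rewrite (subsetP bx_quotient_dom) ?inE.
  have e : 'C_Q[s0] = 'C_Q'[s] :^ g by rewrite eQ es conjIg cent1J (normP nQg).
  have i : 'C_Q'[s] \isog 'C_Q[s0] by rewrite e conj_isog.
  by apply/idP/idP=> [|j]; [apply: isog_trans; rewrite isog_sym | apply: isog_trans i j].
by rewrite -(fext_to_bx_im egs) isog_sym sub_isog ?injm_fext_to_bx.
Qed.

End ModelBiextraspecial.

(** * Quadratic forms and extraspecial 2-groups *)

Section QuadraticForm.

Local Open Scope ring_scope.

Variables (m : nat) (q : 'rV['F_2]_m -> 'F_2).

Lemma quadratic_form0 : quadratic_form q -> q 0 = 0.
Proof. by case=> qZ _; rewrite -(scale0r 0) qZ expr2 mul0r mul0r. Qed.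

Lemma polarD u v w : quadratic_form q -> polar q u (v + w) = polar q u v + polar q u w.
Proof. by case=> _ lin; have := lin u 1 v w; rewrite scale1r mul1r. Qed.

Lemma polarC u v : polar q u v = polar q v u.
Proof. by rewrite /polar [v + u]addrC; ring. Qed.

Lemma quadratic_formD u v : q (u + v) = q u + q v + polar q u v.
Proof. by rewrite /polar; ring. Qed.

(** f is upper triangular: values of q on the diagonal, polar values above it. Then q(v) - f(v, v)
    is additive and vanishes on the unit vectors. *)
Lemma quadratic_form_blf : quadratic_form q ->
  exists2 f, forall v, q v = blf f v v & forall u v, polar q u v = blf (sym_form f) u v.
Proof.
move=> qf; pose e i : 'rV['F_2]_m := delta_mx 0 i.
pose f := \matrix_(i, j) if (i < j)%N then polar q (e i) (e j)
                         else if i == j then q (e i) else 0.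
have q0 := quadratic_form0 qf.
have p0 u : polar q u 0 = 0 by rewrite /polar addr0 q0 subr0 subrr.
have pZ a u v : polar q u (a *: v) = a * polar q u v.
  by have [->|->] := F2P a; rewrite ?scale0r ?mul0r ?scale1r ?mul1r.
have puu u : polar q u u = 0 by rewrite /polar addmx2 q0 sub0r -opprD addF2 oppr0.
have fE i j : blf f (e i) (e j) = f i j.
  by rewrite /blf -rowE trmx_delta -colE !mxE.
have eE i j : polar q (e i) (e j) = blf (sym_form f) (e i) (e j).
  rewrite sym_formE !fE !mxE; case: (ltngtP i j) => [lt|lt|/val_inj->].
  - by rewrite -val_eqE (gtn_eqF lt) addr0.
  - by rewrite -val_eqE (gtn_eqF lt) add0r polarC.
  by rewrite eqxx puu addF2.
have expand (h : 'rV['F_2]_m -> 'F_2) : h 0 = 0 ->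
    (forall u v, h (u + v) = h u + h v) -> forall v, h v = \sum_j v 0 j * h (e j).
  move=> h0 hD v; rewrite {1}[v]row_sum_delta (big_morph h hD h0).
  by apply: eq_bigr => j _; have [->|->] := F2P (v 0 j);
    rewrite ?scale0r ?mul0r ?scale1r ?mul1r.
have pE u v : polar q u v = blf (sym_form f) u v.
  rewrite (expand _ (p0 u) (fun v w => polarD u v w qf)).
  rewrite (expand (blf (sym_form f) u) (blf0r _ _) (blfDr _ _)).
  apply: eq_bigr => j _; congr (_ * _); rewrite polarC.
  rewrite (expand _ (p0 (e j)) (fun v w => polarD (e j) v w qf)).
  rewrite sym_formC (expand (blf (sym_form f) (e j)) (blf0r _ _) (blfDr _ _)).
  by apply: eq_bigr => i _; rewrite eE.
exists f => // v; apply/eqP; rewrite -subr_eq0; apply/eqP.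
pose d v := q v - blf f v v.
have dD u w : d (u + w) = d u + d w.
  rewrite /d quadratic_formD pE sym_formE blfDl !blfDr.
  set x := blf f u w; set y := blf f w u; ring.
have d0 : d 0 = 0 by rewrite /d q0 blf0l subrr.
rewrite -/(d v) (expand d d0 dD) big1 // => j _.
by rewrite /d fE mxE ltnn eqxx subrr mulr0.
Qed.

Lemma nondegenerate_unit (b : 'M['F_2]_m) :
  (forall u, (forall v, blf b u v = 0) -> u = 0) -> b \in unitmx.
Proof.
move=> nd; rewrite -row_free_unit -kermx_eq0; apply/negPn/negP => /rowV0Pn[u /sub_kermxP ub].
by case/eqP; apply: nd => v; rewrite /blf ub mul0mx mxE.
Qed.

End QuadraticForm.

Section ExtraspecialForm.

Variables (gT : finGroupType) (E : {group gT}) (m : nat).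
Hypotheses (pE : 2.-group E) (esE : extraspecial E) (oE : #|E| = (2 ^ m.+1)%N).

Let oZ : #|'Z(E)| = 2.
Proof. exact: card_center_extraspecial pE esE. Qed.

Lemma extraspecial_sqZ x : x \in E -> x ^+ 2 \in 'Z(E).
Proof.
have [[ePhi _] _] := esE; move=> Ex; rewrite -ePhi (Phi_joing pE).
by rewrite mem_gen // inE (Mho_p_elt 1) ?orbT // (mem_p_elt pE).
Qed.

Lemma extraspecial_commZ x y : x \in E -> y \in E -> [~ x, y] \in 'Z(E).
Proof. by have [[_ <-] _] := esE; move=> Ex Ey; rewrite mem_commg. Qed.

Lemma extraspecial_quotient_abelem : 2.-abelem (E / 'Z(E)).
Proof. by have [[<- _] _] := esE; apply: Phi_quotient_abelem. Qed.

Lemma extraspecial_coordinates : exists d : gT -> 'rV['F_2]_m,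
  [/\ {in E &, forall x y, d (x * y) = (d x + d y)%R},
      forall v, exists2 x, x \in E & d x = v
    & {in E, forall x, (d x == 0%R) = (x \in 'Z(E))}].
Proof.
have nZ : 'Z(E) <| E := center_normal E.
have abV : 2.-abelem [set: 'rV['F_2]_m].
  by apply: exponent2_abelem; apply/exponentP=> x _; apply: addmx2.
have : E / 'Z(E) \isog [set: 'rV['F_2]_m].
  rewrite (isog_abelem_card _ extraspecial_quotient_abelem) abV.
  rewrite card_quotient ?(normal_norm nZ) // -divgS ?(normal_sub nZ) // oZ oE.
  by rewrite /= cardsT card_mx card_Fp // mul1n expnS mulKn.
case/isogP=> g injg img; exists (fun x => g (coset 'Z(E) x)).
have NE x : x \in E -> x \in 'N('Z(E)) by apply/subsetP/(normal_norm nZ).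
have qE x : x \in E -> coset 'Z(E) x \in E / 'Z(E) by apply: mem_quotient.
split=> [x y Ex Ey|v|x Ex].
- by rewrite morphM ?NE // morphM ?qE.
- have: v \in g @* (E / 'Z(E)) by rewrite img inE.
  by case/morphimP=> _ _ /morphimP[x _ Ex ->] ->; exists x.
apply/eqP/idP=> [gx|Zx].
  apply: coset_idr; first exact: NE.
  by apply: (injmP injg); rewrite ?qE ?group1 // gx morph1.
by rewrite coset_id // morph1.
Qed.

(** Here q is the squaring map of E read in Z(E), a copy of GF(2), and its polar form is the
    commutator. Only the rank test is kept, as it already determines the group. *)
Lemma extraspecial_form : exists f : 'M['F_2]_m,
  sym_form f \in unitmx /\ ('r_2(E) == (m./2).+1) = ('r_2([set: fext f]) == (m./2).+1).
Proof.
have [d [dM dS dZ]] := extraspecial_coordinates.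
have m0 : (0 < m)%N.
  case: (m) oE => // o2; have := extraspecial_nonabelian esE.
  by rewrite cyclic_abelian // prime_cyclic // o2.
have EZ c : c \in 'Z(E) -> c \in E by apply/subsetP/center_sub.
have Zcom c x : c \in 'Z(E) -> x \in E -> commute c x by case/centerP=> _ H /H.
have [e Ze] : exists e, 'Z(E) = [set 1; e].
  have /cyclicP[e Ze] : cyclic 'Z(E) by rewrite prime_cyclic ?oZ.
  by exists e; rewrite Ze; apply: cycle2g; rewrite /order -Ze oZ.
have ee : e * e = 1.
  have oe : #[e] %| 2.
    have Zee : e \in ('Z(E))%G by rewrite [_ \in _](_ : _ = (e \in 'Z(E))) // Ze set22.
    by have := order_dvdG Zee; rewrite /= oZ.
  by apply/eqP; rewrite -sqg -order_dvdn.
pose chi (c : gT) : 'F_2 := if c == 1 then 0%R else 1%R.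
have chi1 : chi 1 = 0%R by rewrite /chi eqxx.
have chiM c c' : c \in 'Z(E) -> c' \in 'Z(E) -> chi (c * c') = (chi c + chi c')%R.
  rewrite Ze => /set2P[]-> /set2P[]->; rewrite ?mul1g ?mulg1 ?chi1 ?addr0 ?add0r //.
  by rewrite ee chi1 addF2.
have sqd x y : x \in E -> y \in E -> d x = d y -> x ^+ 2 = y ^+ 2.
  move=> Ex Ey exy; have d1 : d 1 = 0%R by apply/eqP; rewrite dZ ?group1.
  have Zxy : x * y \in 'Z(E).
    by rewrite -dZ ?groupM // dM // exy addmx2.
  have Zy := extraspecial_sqZ Ey.
  have -> : x = x * y * (y ^+ 2)^-1 * y by rewrite sqg invMg !mulgA mulgK mulgKV.
  have Zc : x * y * (y ^+ 2)^-1 \in 'Z(E) by rewrite groupM ?groupV.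
  rewrite expgMn; last exact: Zcom.
  have -> : (x * y * (y ^+ 2)^-1) ^+ 2 = 1; last by rewrite mul1g.
  by move: Zc; rewrite {1}Ze => /set2P[]->; rewrite sqg ?ee ?mul1g.
(* [repr] chooses some preimage of v; by [sqd] the square does not depend on it. *)
pose q v := chi (repr [set x in E | d x == v] ^+ 2).
have qd x : x \in E -> q (d x) = chi (x ^+ 2).
  move=> Ex; have: repr [set y in E | d y == d x] \in [set y in E | d y == d x].
    by apply: (mem_repr x); rewrite inE Ex eqxx.
  by rewrite inE => /andP[Ey /eqP dy]; rewrite /q; congr chi; apply: sqd.
have polard x y : x \in E -> y \in E -> polar q (d x) (d y) = chi [~ y, x].
  move=> Ex Ey; rewrite /polar -dM // !qd ?groupM //.
  have -> : (x * y) ^+ 2 = x ^+ 2 * y ^+ 2 * [~ y, x].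
    have Zc := extraspecial_commZ Ey Ex.
    rewrite !sqg -!mulgA; congr (_ * _); rewrite (mulgA y x) (commgC y x).
    by move: (Zcom _ _ Zc Ey); move: [~ y, x] => c; rewrite /commute => <-; rewrite !mulgA.
  have [Zx Zy] := (extraspecial_sqZ Ex, extraspecial_sqZ Ey).
  have Zc := extraspecial_commZ Ey Ex.
  rewrite (chiM (x ^+ 2 * y ^+ 2) _ _ Zc) ?(chiM _ _ Zx Zy); last exact: groupM.
  by move: (chi (x ^+ 2)) (chi (y ^+ 2)) (chi [~ y, x]) => a b c; ring.
have qf : quadratic_form q.
  have q0 : q 0%R = 0%R.
    have d1 : d 1 = 0%R by apply/eqP; rewrite dZ ?group1.
    by rewrite -d1 qd ?group1 // expg1n.
  split=> [a v|u a v w].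
    by have [->|->] := F2P a; rewrite ?scale0r ?scale1r ?expr2 ?mul0r ?mul1r.
  have [x Ex <-] := dS u; have [y Ey <-] := dS v; have [z Ez <-] := dS w.
  have comM : [~ y * z, x] = [~ y, x] * [~ z, x].
    rewrite commMgJ; congr (_ * _); apply/conjg_fixP/commgP/Zcom => //.
    exact: extraspecial_commZ.
  have [->|->] := F2P a.
    by rewrite scale0r add0r mul0r add0r.
  rewrite scale1r mul1r -dM // !polard ?groupM // comM chiM //; exact: extraspecial_commZ.
have [f fq fp] := quadratic_form_blf qf; exists f.
have uf : sym_form f \in unitmx.
  apply: nondegenerate_unit => u H; have [x Ex ex] := dS u.
  rewrite -ex; apply/eqP; rewrite dZ //; apply/centerP; split=> // y Ey.
  have := H (d y); rewrite -fp -ex polard //; rewrite /chi.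
  by case: eqP => // c _; apply/commute_sym/commgP/eqP.
split=> //.
have := fext_type uf m0 fq.
rewrite (@quadratic_type_extraspecial _ E _ 0%R _ q d pE esE dM dS dZ).
- by case: ifP; case: ifP.
- move=> x Ex; rewrite qd // /chi; by case: (x ^+ 2 == 1).
by move=> w; rewrite addr0.
Qed.

End ExtraspecialForm.

(** For n = m/2 the two extraspecial groups of this order are ['D^n], of rank n + 1, and
    ['D^n.-1*Q], of rank n. *)
Lemma isog_2extraspecial_rank (gT hT : finGroupType) (E : {group gT}) (F : {group hT}) m :
    (0 < m)%N -> ~~ odd m -> extraspecial E -> extraspecial F ->
    #|E| = (2 ^ m.+1)%N -> #|F| = (2 ^ m.+1)%N ->
    ('r_2(E) == (m./2).+1) = ('r_2(F) == (m./2).+1) ->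
  E \isog F.
Proof.
move=> m0 om esE esF oE oF.
have em : m = (m./2).*2 by rewrite even_halfK.
have n0 : (0 < m./2)%N by move: m0; rewrite {1}em double_gt0.
rewrite em in oE oF.
have nn : (m./2).-1.+1 = m./2 by rewrite prednK.
have neq : (m./2 == (m./2).+1) = false by rewrite eqn_leq ltnn andbF.
case: (isog_2extraspecial oE esE) => iE; case: (isog_2extraspecial oF esF) => iF;
  rewrite (isog_p_rank iE) (isog_p_rank iF) ?rank_Dn ?rank_DnQ ?nn ?eqxx ?neq // => _;
  by apply: isog_trans iE _; rewrite isog_sym.
Qed.

(** Both types are realized by reading forms off these two known groups. *)
Lemma sign_form m (e : sign) : (0 < m)%N -> ~~ odd m ->
  exists f : 'M['F_2]_m,
    sym_form f \in unitmx /\ ('r_2([set: fext f]) == (m./2).+1) = (if e is Plus then true else false).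
Proof.
move=> m0 om; have em : m = (m./2).*2 by rewrite even_halfK.
have n0 : (0 < m./2)%N by move: m0; rewrite {1}em double_gt0.
have nn : (m./2).-1.+1 = m./2 by rewrite prednK.
have neq : (m./2 == (m./2).+1) = false by rewrite eqn_leq ltnn andbF.
case: e.
  have oE : #|'D^(m./2)| = (2 ^ m.+1)%N by have := card_pX1p2n (m./2) prime2; rewrite -em.
  have pE : 2.-group 'D^(m./2) by rewrite /pgroup oE pnatX.
  have [f [uf fE]] := extraspecial_form pE (pX1p2n_extraspecial prime2 n0) oE.
  by exists f; rewrite -fE rank_Dn eqxx.
have oE : #|'D^((m./2).-1)*Q| = (2 ^ m.+1)%N by rewrite card_DnQ nn -em.
have [f [uf fE]] := extraspecial_form (DnQ_pgroup _) (DnQ_extraspecial _) oE.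
by exists f; rewrite -fE rank_DnQ nn neq.
Qed.

(** * Automorphisms of the extensions *)

Section FextAut.

Variables (m : nat) (f : 'M['F_2]_m).
Hypothesis uf : sym_form f \in unitmx.

Local Notation T := (fext f).
Local Notation E := [set: T].
Local Notation V := 'rV['F_2]_m.
Local Notation b := (blf (sym_form f)).

Implicit Types (a c : {perm T}) (u v w : V).

Definition fext_lin a v : V := (a ((v, 0%R) : T)).1.
Definition fext_coc a v : 'F_2 := (a ((v, 0%R) : T)).2.

Lemma fext_autM a (x y : T) : a \in Aut E -> a (x * y) = a x * a y.
Proof. by move=> Aa; rewrite -(autmE Aa) morphM ?inE. Qed.

Lemma fext_aut_center a (k : 'F_2) : a \in Aut E -> a ((0%R, k) : T) = (0%R, k).
Proof.
move=> Aa; have a1 : a 1 = 1 by rewrite -(autmE Aa) morph1.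
have [->|->] := F2P k; first exact: a1.
have : a ((0%R, 1%R) : T) \in 'Z(E).
  apply/centerP; split=> [|y _]; first by rewrite inE.
  rewrite -[y](permKV a) /commute -!fext_autM //; congr (a _).
  rewrite fext_comm blf0l; exact: mulg1.
rewrite fext_center // inE; case ea: (a _) => [u k'] /= /eqP u0; rewrite u0 in ea *.
have [k0|-> //] := F2P k'; move: ea; rewrite k0 -[(0%R, 0%R)]/(1 : T) -a1.
by move/perm_inj/(congr1 snd)/(congr1 val).
Qed.

Lemma fext_autE a (x : T) : a \in Aut E ->
  a x = (fext_lin a x.1, fext_coc a x.1 + x.2)%R :> T.
Proof.
move=> Aa; have -> : x = ((0%R, x.2) : T) * ((x.1, 0%R) : T).
  by rewrite fext_central add0r; case: (x).
by rewrite fext_autM // fext_aut_center // fext_central fext_central /= add0r.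
Qed.

Lemma fext_linD a u v : a \in Aut E -> fext_lin a (u + v)%R = (fext_lin a u + fext_lin a v)%R.
Proof.
move=> Aa; have := fext_autM ((u, 0%R) : T) ((v, 0%R) : T) Aa.
by rewrite !fextM fext_autE // => /(congr1 fst).
Qed.

Lemma fext_cocD a u v : a \in Aut E ->
  fext_coc a (u + v)%R =
    (fext_coc a u + fext_coc a v + blf f (fext_lin a u) (fext_lin a v) + blf f u v)%R.
Proof.
move=> Aa; have := fext_autM ((u, 0%R) : T) ((v, 0%R) : T) Aa.
rewrite !fextM fext_autE // => /(congr1 snd) /=; rewrite !add0r => /(congr1 (fun x => x + blf f u v)%R).
by rewrite -addrA addF2 addr0.
Qed.

Lemma fext_lin_sq a v : a \in Aut E -> blf f (fext_lin a v) (fext_lin a v) = blf f v v.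
Proof.
move=> Aa; have := fext_autM ((v, 0%R) : T) ((v, 0%R) : T) Aa.
rewrite -!sqg !fext_sq fext_aut_center // => /(congr1 snd) /=.
by move->.
Qed.

Lemma fext_lin_inj a : a \in Aut E -> injective (fext_lin a).
Proof.
move=> Aa u v uv; apply/eqP; rewrite -subr_eq0; apply/eqP.
have : fext_lin a (u - v)%R = 0%R by rewrite oppmx2 fext_linD // uv addmx2.
set w := (u - v)%R => w0; have := fext_autE ((w, 0%R) : T) Aa.
rewrite /= w0 -(fext_aut_center _ Aa) => /perm_inj; by case.
Qed.

Lemma fext_linM a c v : a \in Aut E -> c \in Aut E ->
  fext_lin (a * c) v = fext_lin c (fext_lin a v).
Proof. by move=> Aa Ac; rewrite /fext_lin permM (fext_autE _ Aa) (fext_autE _ Ac). Qed.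

Lemma fext_cocM a c v : a \in Aut E -> c \in Aut E ->
  fext_coc (a * c) v = (fext_coc c (fext_lin a v) + fext_coc a v)%R.
Proof. by move=> Aa Ac; rewrite /fext_coc permM (fext_autE _ Aa) (fext_autE _ Ac) /= addr0. Qed.

Lemma fext_lin1 v : fext_lin 1 v = v. Proof. by rewrite /fext_lin perm1. Qed.
Lemma fext_coc1 v : fext_coc 1 v = 0%R. Proof. by rewrite /fext_coc perm1. Qed.

Lemma fext_aut_eq a c : a \in Aut E -> c \in Aut E ->
  fext_lin a =1 fext_lin c -> fext_coc a =1 fext_coc c -> a = c.
Proof.
move=> Aa Ac el ec; apply/permP=> x.
by rewrite (fext_autE x Aa) (fext_autE x Ac) el ec.
Qed.

Lemma fext_mkaut (g : V -> V) (h : V -> 'F_2) : injective g ->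
    (forall u v, g (u + v) = g u + g v)%R ->
    (forall u v, h (u + v) + blf f u v = h u + h v + blf f (g u) (g v))%R ->
  exists a, [/\ a \in Aut E, fext_lin a =1 g & fext_coc a =1 h].
Proof.
move=> ginj gD hD.
pose k (x : T) : T := (g x.1, h x.1 + x.2)%R.
have kinj : injective k.
  move=> [u r] [v s] e; have uv : u = v := ginj _ _ (congr1 fst e).
  by move/(congr1 snd): e; rewrite /= uv => /addrI->.
exists (perm kinj); split.
- rewrite inE; apply/andP; split; first by apply/subsetP=> x _; rewrite inE.
  apply/morphicP=> x y _ _; rewrite !permE /k !fextM /= gD; congr (_, _).
  transitivity (h (x.1 + y.1) + blf f x.1 y.1 + (x.2 + y.2))%R; first by ring.
  by rewrite hD; ring.
- by move=> v; rewrite /fext_lin permE.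
by move=> v; rewrite /fext_coc permE /= addr0.
Qed.

(** A search, because building the permutation requires injectivity, known only for automorphisms;
    for those it succeeds by [fext_lin_inj]. *)
Definition fext_perm a : {perm V} :=
  if [pick s : {perm V} | [forall v, s v == fext_lin a v]] is Some s then s else 1.

Lemma fext_permE a v : a \in Aut E -> fext_perm a v = fext_lin a v.
Proof.
move=> Aa; rewrite /fext_perm; case: pickP => [s /forallP/(_ v)/eqP //|].
move/(_ (perm (fext_lin_inj Aa))) => /forallP[]; by move=> w; rewrite permE.
Qed.

Lemma fext_permM : {in Aut E &, {morph fext_perm : a c / a * c}}.
Proof.
move=> a c Aa Ac; apply/permP=> v; rewrite permM !fext_permE ?groupM //.
exact: fext_linM.
Qed.

Canonical fext_perm_morphism := Morphism fext_permM.

Lemma fext_inner_ex w : exists a, [/\ a \in Aut E, fext_lin a =1 id & fext_coc a =1 b^~ w].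
Proof.
apply: fext_mkaut => // u v; rewrite blfDl; exact: erefl.
Qed.

(** Conjugation by (w, c), which is independent of c; see [fext_inner_conj]. *)
Definition fext_inner w : {perm T} := 
  if [pick a | [&& a \in Aut E, [forall v, fext_lin a v == v] & [forall v, fext_coc a v == b v w]]]
    is Some a then a else 1.

Lemma fext_innerP w : [/\ fext_inner w \in Aut E, fext_lin (fext_inner w) =1 id
  & fext_coc (fext_inner w) =1 b^~ w].
Proof.
rewrite /fext_inner; case: pickP => [a /and3P[Aa /forallP l /forallP h]|].
  by split=> // v; apply/eqP.
have [a [Aa l h]] := fext_inner_ex w.
move/(_ a); rewrite Aa /= => /negP[]; apply/andP; split; apply/forallP=> v; apply/eqP; [exact: l|exact: h].
Qed.

Lemma fext_innerM : {in [set: V] &, {morph fext_inner : u v / u * v}}.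
Proof.
move=> u v _ _; have [Au lu hu] := fext_innerP u; have [Av lv hv] := fext_innerP v.
have [A l h] := fext_innerP (u + v)%R.
rewrite -[LHS]/(fext_inner (u + v)%R); apply: (fext_aut_eq A (groupM Au Av)) => w.
  exact: etrans (l w) (esym (etrans (fext_linM w Au Av) (etrans (lv _) (lu w)))).
rewrite (fext_cocM _ Au Av); apply: etrans (h w) _; rewrite blfDr addrC.
by apply: esym; congr (_ + _)%R; [rewrite lu; apply: hv | apply: hu].
Qed.

Canonical fext_inner_morphism := Morphism fext_innerM.

Lemma fext_inner_injm : 'injm fext_inner.
Proof.
apply/injmP=> u v _ _ uv; apply/eqP; rewrite -subr_eq0; apply/eqP.
apply: blf_unit uf _ => w; rewrite oppmx2 sym_formC blfDr.
have [_ _ hu] := fext_innerP u; have [_ _ hv] := fext_innerP v.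
by rewrite -hu -hv uv addF2.
Qed.

(** When the linear part is trivial, the cocycle rule makes [fext_coc a] additive, and nondegeneracy
    represents it as b(-, w). *)
Lemma fext_inner_ker : fext_inner @* [set: V] = 'ker fext_perm.
Proof.
apply/setP=> a; apply/morphimP/idP=> [[w _ _ ->]|ka].
  have [Aw lw _] := fext_innerP w; apply/kerP=> //; apply/permP=> v.
  by rewrite fext_permE // lw perm1.
have Aa : a \in Aut E by apply: (dom_ker ka).
have la v : fext_lin a v = v by rewrite -fext_permE // (mker ka) perm1.
have [w hw] : exists w, forall v, fext_coc a v = b v w.
  apply: blf_functional uf _ => u v.
  by rewrite fext_cocD // !la -addrA addF2 addr0.
have [Aw lw hw'] := fext_innerP w.
exists w; rewrite ?inE //; apply: fext_aut_eq => // v; first by rewrite la lw.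
by rewrite hw hw'.
Qed.

(** To lift an isometry s, note that f(su, sv) + f(u, v) is alternating, hence of the form U + U^T
    with U strictly upper triangular; then v |-> U(v, v) is the required cochain. *)
Lemma fext_perm_im (q : V -> 'F_2) : (forall v, q v = blf f v v) ->
  fext_perm @* Aut E = orthogonal_group q.
Proof.
move=> qE; apply/setP=> s; apply/morphimP/idP=> [[a Aa _ ->]|].
  rewrite inE; apply/andP; split.
    apply/forallP=> k; apply/forallP=> u; apply/forallP=> v; apply/eqP.
    rewrite !fext_permE // fext_linD //; have [->|->] := F2P k; last by rewrite !scale1r.
    by rewrite !scale0r -{1}[0%R](addmx2 u) fext_linD // addmx2.
  by apply/forallP=> v; rewrite fext_permE // !qE fext_lin_sq.
rewrite inE => /andP[/forallP sl /forallP sq].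
have sD u v : s (u + v)%R = (s u + s v)%R.
  by have /forallP/(_ u)/forallP/(_ v)/eqP := sl 1%R; rewrite !scale1r.
have s0 : s 0%R = 0%R by rewrite -{1}[0%R](addmx2 0%R) sD addmx2.
pose g := (\matrix_i s (delta_mx 0%R i))%R.
have sE v : s v = (v *m g)%R.
  rewrite {1}[v]row_sum_delta (big_morph _ sD s0) mulmx_sum_row.
  apply: eq_bigr => i _; rewrite rowK.
  by have [->|->] := F2P (v 0%R i); rewrite ?scale0r ?scale1r.
have [N NE] : exists N, forall u v, (blf N u v = blf f (s u) (s v) + blf f u v)%R.
  exists (g *m f *m g^T + f)%R => u v.
  by rewrite blf_addl !sE /blf trmx_mul !mulmxA.
pose U := (\matrix_(i, j) if (i < j)%N then N i j else 0)%R.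
have Nij i j : N i j = blf N (delta_mx 0%R i) (delta_mx 0%R j).
  by rewrite /blf -rowE trmx_delta -colE !mxE.
have Nvv v : blf N v v = 0%R.
  by rewrite NE -!qE (eqP (sq v)) addF2.
have NU : N = sym_form U.
  have NC i j : N i j = N j i.
    have := Nvv (delta_mx 0%R i + delta_mx 0%R j)%R; rewrite blfDl !blfDr !Nvv.
    by rewrite add0r addr0 -!Nij => /eqP; rewrite addr_eq0 oppF2 => /eqP.
  apply/matrixP=> i j; rewrite !mxE; case: (ltngtP i j) => [_|_|/val_inj->].
  - by rewrite addr0.
  - by rewrite add0r NC.
  by rewrite add0r Nij Nvv.
have [a [Aa la ha]] : exists a, [/\ a \in Aut E, fext_lin a =1 s & fext_coc a =1 (fun v => blf U v v)].
  apply: fext_mkaut => [||u v]; [exact: perm_inj | exact: sD |].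
  have -> : blf f u v = (blf f (s u) (s v) + (blf U u v + blf U v u))%R.
    by rewrite -sym_formE -NU NE addrA addF2 add0r.
  rewrite blfDl !blfDr; move: (blf U u v) (blf U v u) => x y.
  transitivity (blf U u u + blf U v v + blf f (s u) (s v) + (x + x) + (y + y))%R; first by ring.
  by rewrite !addF2 !addr0.
by exists a => //; apply/permP=> v; rewrite fext_permE.
Qed.

End FextAut.

(** * Non-splitting in dimension at least 6 *)

Section FextSplitting.

Variables (m : nat) (f : 'M['F_2]_m).
Hypothesis uf : sym_form f \in unitmx.

Local Notation T := (fext f).
Local Notation E := [set: T].
Local Notation V := 'rV['F_2]_m.
Local Notation b := (blf (sym_form f)).
Local Notation q v := (blf f v v).
Local Notation inner := (fext_inner_morphism uf).
Local Notation prm := (fext_perm_morphism uf).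
Local Notation K := (inner @* [set: V]).
Local Notation O := (orthogonal_group (fun v : V => q v)).

Lemma fext_innerK a : a \in Aut E -> fext_lin a =1 id -> a \in K.
Proof.
move=> Aa la; rewrite (fext_inner_ker uf); apply/kerP => //; apply/permP=> v.
by rewrite (fext_permE uf) // la perm1.
Qed.

Lemma fext_Kinner k : k \in K -> k \in Aut E /\ fext_lin k =1 id.
Proof. by case/morphimP=> w _ _ ->; have [] := fext_innerP f w. Qed.

Lemma form_pair u : u != 0%R -> exists v, b v u = 1%R.
Proof.
move=> u0; case: (pickP (fun v => b v u == 1%R)) => [v /eqP|nv]; first by exists v.
case/eqP: u0; apply: blf_unit uf _ => v; rewrite sym_formC.
by have [//|e] := F2P (b v u); move: (nv v); rewrite e eqxx.
Qed.

(** Combine a vector not orthogonal to u with one not orthogonal to u + w. *)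
Lemma form_separate u w : u != 0%R -> u != w -> exists v, b v w = 0%R /\ b v u = 1%R.
Proof.
move=> u0 uw; have [v1 v1u] := form_pair u0.
have [v1w|v1w] := F2P (b v1 w); first by exists v1.
have uw0 : (u + w)%R != 0%R by rewrite addr_eq0 oppmx2.
have [v2] := form_pair uw0; rewrite blfDr.
have [v2w|v2w] := F2P (b v2 w); have [v2u|v2u] := F2P (b v2 u);
  rewrite v2w v2u ?addF2 ?addr0 ?add0r // => _; first by exists v2.
by exists (v1 + v2)%R; rewrite !blfDl v1u v1w v2w v2u addF2 addr0.
Qed.

(** The orthogonal space of the k rows has dimension at least m - k > k, so it cannot lie in their
    span. *)
Lemma form_perp k (A : 'M['F_2]_(k, m)) : (k.*2 < m)%N ->
  exists v, (forall i, b v (row i A) = 0%R) /\ ~~ (v <= A)%MS.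
Proof.
move=> km; pose N := (sym_form f *m A^T)%R.
have : ~~ (kermx N <= A)%MS.
  apply/negP=> /mxrankS; rewrite mxrank_ker => le.
  have: (m <= k + k)%N.
    have rN := rank_leq_col N; have rA := rank_leq_row A.
    by rewrite -leq_subLR; apply: leq_trans (leq_trans (leq_sub2l _ rN) le) rA.
  by rewrite addnn leqNgt km.
case/row_subPn=> i nA; exists (row i (kermx N)); split=> // j.
have : (row i (kermx N) *m N = 0)%R by apply/sub_kermxP/row_sub.
move/(congr1 (fun M : 'rV_k => M 0%R j)); rewrite [RHS]mxE => <-.
by rewrite /N mulmxA /blf tr_row [LHS]mxE [RHS]mxE; apply: eq_bigr => l _; rewrite [col _ _ _ _]mxE.
Qed.

Lemma form_adjust x v : q x = 1%R -> b v x = 0%R ->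
  exists w, [/\ q w = 1%R, b w x = 0%R & w = v \/ w = (v + x)%R].
Proof.
move=> qx vx; have [e|e] := F2P (q v); last by exists v; split=> //; left.
exists (v + x)%R; split; last by right.
  by rewrite blfDl !blfDr qx e add0r addrA -sym_formE vx add0r.
by rewrite blfDl vx sym_formvv addr0.
Qed.

Lemma form_quadD u v : q (u + v)%R = (q u + q v + b u v)%R.
Proof. by rewrite sym_formE blfDl !blfDr; ring. Qed.

Lemma form_triple : (4 < m)%N -> exists x y z : V,
   [/\ [/\ q x = 1%R, q y = 1%R & q z = 1%R],
       [/\ b x y = 0%R, b x z = 0%R & b y z = 0%R] & [/\ x != y, x != z & y != z]].
Proof.
move=> m4.
have [x qx] : exists x, q x = 1%R.
  case: (pickP (fun x : V => q x == 1%R)) => [x /eqP|nx]; first by exists x.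
  have q0 v : q v = 0%R by have [//|e] := F2P (q v); move: (nx v); rewrite e eqxx.
  have m0 : (0 < m)%N by apply: leq_trans m4.
  have d0 : (const_mx 1 : V)%R != 0%R.
    by apply/eqP=> /rowP/(_ (Ordinal m0)); rewrite !mxE => /(congr1 val).
  have [v] := form_pair d0; have := q0 (v + const_mx 1)%R.
  by rewrite blfDl !blfDr !q0 add0r addr0 -sym_formE => -> /(congr1 val).
have m2 : (1.*2 < m)%N by apply: leq_trans m4.
have [y0 [y0x ny0]] := form_perp x m2.
have {}y0x : b y0 x = 0%R by have := y0x 0%R; rewrite row_id.
have [y [qy yx y0y]] := form_adjust qx y0x.
have xy : x != y.
  apply: contra ny0 => /eqP xy; case: y0y => e; first by rewrite -e -xy submx_refl.
  by have -> : y0 = (x + y)%R; [rewrite e addrCA addmx2 addr0 | rewrite -xy addmx2 sub0mx].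
have [z0 [z0A nz0]] := form_perp (col_mx x y) m4.
have z0x : b z0 x = 0%R by have := z0A (lshift 1 0%R); rewrite rowKu row_id.
have z0y : b z0 y = 0%R by have := z0A (rshift 1 0%R); rewrite rowKd row_id.
have [z [qz zx z0z]] := form_adjust qx z0x.
have zE : z0 = z \/ z0 = (z + x)%R.
  by case: z0z => e; [left | right; rewrite e -addrA addmx2 addr0].
have xA : (x <= col_mx x y)%MS by rewrite -addsmxE addsmxSl.
have yA : (y <= col_mx x y)%MS by rewrite -addsmxE addsmxSr.
exists x, y, z; split; split=> //.
- by rewrite sym_formC.
- by rewrite sym_formC.
- rewrite sym_formC; case: z0z => ->; first by [].
  by rewrite blfDl z0y sym_formC yx add0r.
- by apply: contra nz0 => /eqP xz; case: zE => ->; rewrite -xz ?addmx_sub.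
by apply: contra nz0 => /eqP xz; case: zE => ->; rewrite -xz ?addmx_sub.
Qed.

(** With q x = 1, adding b(v, x) x changes q v by b(v, x) + b(v, x) = 0, so the transvection is an
    isometry and lifts. *)
Lemma fext_transvection x : q x = 1%R ->
  exists2 a, a \in Aut E & forall v, fext_lin a v = (v + b v x *: x)%R.
Proof.
move=> qx; pose t v := (v + b v x *: x)%R.
have tK : involutive t.
  move=> v; rewrite /t blfDl blfZl sym_formvv mulr0 addr0 -addrA addmx2 addr0 //.
have : perm (can_inj tK) \in prm @* Aut E.
  rewrite (fext_perm_im uf (q := fun v => q v)) // inE; apply/andP; split.
    apply/forallP=> k; apply/forallP=> u; apply/forallP=> v; apply/eqP.
    rewrite !permE /t blfDl blfZl scalerDl scalerDr scalerA.
    by rewrite addrACA.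
  apply/forallP=> v; rewrite permE /t; have [e|e] := F2P (b v x); rewrite e.
    by rewrite scale0r addr0.
  rewrite scale1r blfDl !blfDr qx; move: e; rewrite sym_formE => e.
  by rewrite addrA -(addrA (q v)) e -addrA addF2 addr0.
case/morphimP=> a Aa _ ea; exists a => // v.
by rewrite -(fext_permE uf) // -[fext_perm a v]/(prm a v) -ea permE.
Qed.

Theorem fext_nonsplit : (4 < m)%N -> ~~ [splits Aut E, over K].
Proof.
move=> m4; apply/negP=> /splitsP[H /complP[tiKH KH]].
have HA h : h \in H -> h \in Aut E by apply/subsetP; rewrite -KH mulG_subr.
(* An element of the complement H is determined by its linear part, so relations between
   transvections hold between their lifts. *)
have Huniq h k : h \in H -> k \in H -> fext_lin h =1 fext_lin k -> h = k.
  move=> Hh Hk e; apply/eqP; rewrite eq_mulgV1; apply/eqP/set1P.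
  rewrite -[[set 1]]tiKH inE; apply/andP; split; last by rewrite groupM ?groupV.
  have [Ah Ak] := (HA _ Hh, HA _ Hk).
  apply: fext_innerK => [|v]; first by rewrite groupM ?groupV.
  rewrite (fext_linM uf v Ah (groupVr Ak)) e -(fext_linM uf v Ak (groupVr Ak)) mulgV.
  exact: fext_lin1.
have Hex x : q x = 1%R -> exists2 h, h \in H & forall v, fext_lin h v = (v + b v x *: x)%R.
  move=> qx; have [a Aa la] := fext_transvection qx.
  have : a \in K * H by rewrite KH.
  case/mulsgP=> k h Kk Hh ea; exists h => // v.
  by have [Ak lk] := fext_Kinner Kk; rewrite -la ea (fext_linM uf v Ak (HA _ Hh)) lk.
have fix_self h x : h \in H -> q x = 1%R ->
    (forall v, fext_lin h v = v + b v x *: x)%R -> fext_coc h x = 1%R.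
  move=> Hh qx hx; have Ah := HA _ Hh.
  have hh : h * h = 1.
    apply: Huniq => // [|v]; first exact: groupM.
    rewrite (fext_linM uf) // !hx fext_lin1 blfDl blfZl sym_formvv mulr0 addr0.
    by rewrite -addrA addmx2 addr0.
  have x0 : x != 0%R by apply/eqP=> x0; move: qx; rewrite x0 blf0l => /(congr1 val).
  (* For v not orthogonal to x, h sends v to v + x; the cochain of h * h = 1 at v then reads 0 =
     h(x) + q(x). *)
  have [v vx] := form_pair x0.
  have := fext_cocM uf v Ah Ah; rewrite hh fext_coc1 hx vx scale1r (fext_cocD uf) //.
  rewrite !hx sym_formvv vx scale0r scale1r addr0 blfDl qx => e.
  apply/eqP; rewrite -subr_eq0 oppF2; apply/eqP; rewrite [RHS]e.
  move: (fext_coc h v) (fext_coc h x) (blf f v x) => p r s.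
  transitivity (r + 1 + (p + p) + (s + s))%R; last by ring.
  by rewrite !addF2 !addr0.
have fix_perp h x y : h \in H -> q x = 1%R -> q y = 1%R -> x != y -> b x y = 0%R ->
    (forall v, fext_lin h v = v + b v x *: x)%R -> fext_coc h y = 0%R.
  move=> Hh qx qy xy bxy hx; have [k Hk ky] := Hex y qy.
  have [Ah Ak] := (HA _ Hh, HA _ Hk).
  have byx : b y x = 0%R by rewrite sym_formC.
  have hk : h * k = k * h.
    apply: Huniq => [||v]; try exact: groupM.
    rewrite (fext_linM uf v Ah Ak) (fext_linM uf v Ak Ah) !(hx, ky) !blfDl !blfZl.
    by rewrite bxy byx !mulr0 !addr0 addrAC.
  have y0 : y != 0%R by apply/eqP=> y0; move: qy; rewrite y0 blf0l => /(congr1 val).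
  (* For v orthogonal to x but not to y, the cochains of h * k and k * h at v differ exactly by
     h(y). *)
  have [v [vx vy]] : exists v, b v x = 0%R /\ b v y = 1%R.
    by apply: form_separate; rewrite // eq_sym.
  have := fext_cocM uf v Ah Ak; rewrite hk (fext_cocM uf v Ak Ah) hx ky vx vy scale0r scale1r addr0.
  rewrite (fext_cocD uf _ _ Ah) !hx vx byx !scale0r !addr0.
  move: (fext_coc h v) (fext_coc h y) (fext_coc k v) (blf f v y) => n r l c e.
  transitivity (n + r + c + c + l - (l + n) - (c + c))%R; first by ring.
  by rewrite e subrr addF2 subr0.
have [x [y [z [[qx qy qz] [xy xz yz] [nxy nxz nyz]]]]] := form_triple m4.
have [h Hh hx] := Hex x qx; have Ah := HA _ Hh.
have hxx := fix_self h x Hh qx hx.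
have hxy : fext_coc h y = 0%R by apply: (fix_perp h x y).
have hxz : fext_coc h z = 0%R by apply: (fix_perp h x z).
(* The fourth vector x + y + z is also nonsingular and orthogonal to x, so h vanishes on it; but h
   is additive on vectors fixed by the transvection, which gives 1 + 0 + 0. *)
have qw : q (x + y + z)%R = 1%R.
  by rewrite !form_quadD blfDl qx qy qz xy xz yz !addr0 addF2 add0r.
have : fext_coc h (x + y + z)%R = 0%R.
  apply: (fix_perp h x) => //.
    by rewrite -addrA -[X in X != _]addr0 (inj_eq (addrI x)) eq_sym addr_eq0 oppmx2.
  by rewrite !blfDr sym_formvv xy xz !addr0.
rewrite !(fext_cocD uf _ _ Ah) !(fext_linD uf _ _ Ah) !hx sym_formvv.
rewrite [b y x]sym_formC xy [b z x]sym_formC xz !scale0r !addr0 hxx hxy hxz !addr0.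
by rewrite -!addrA !addF2 addr0 addF2 addr0 => /(congr1 val).
Qed.

End FextSplitting.

(** * Splitting from block systems *)

Lemma mulrn_evenF2 (x : 'F_2) n : ~~ odd n -> (x *+ n = 0)%R.
Proof. by move/even_halfK <-; rewrite -muln2 mulrnA mulr2n addF2. Qed.

Section BlockSplitting.

Variables (m : nat) (f : 'M['F_2]_m).
Hypothesis uf : sym_form f \in unitmx.

Local Notation T := (fext f).
Local Notation E := [set: T].
Local Notation V := 'rV['F_2]_m.
Local Notation q v := (blf f v v).
Local Notation inner := (fext_inner_morphism uf).
Local Notation prm := (fext_perm_morphism uf).
Local Notation K := (inner @* [set: V]).
Local Notation O := (orthogonal_group (fun v : V => q v)).
Local Notation e i := (delta_mx 0%R i : V).

Variables (J : finType) (blk : 'I_m -> J).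

Definition block_sum j : V := (\sum_(i | blk i == j) e i)%R.
Definition in_block j v := (v == block_sum j) || [exists i, (blk i == j) && (v == e i)].

Variables (X : {set V}) (R : rel V).
Hypothesis blk_even : forall j, ~~ odd #|[pred i | blk i == j]|.
Hypothesis isoX : forall s : {perm V}, s \in O -> forall u, u \in X -> s u \in X.
Hypothesis isoR : forall s : {perm V}, s \in O -> forall u v, R u v -> R (s u) (s v).
Hypothesis RX : forall u v, u \in X -> v \in X -> R u v ->
  exists j, in_block j u && in_block j v.
Hypothesis Xe : forall i, e i \in X.
Hypothesis Xs : forall i, block_sum (blk i) \in X.
Hypothesis Rs : forall i, R (e i) (block_sum (blk i)).

(** X and R describe the enlarged blocks by isometry-invariant conditions; invariance gives closure
    of H under products, and [RX] recovers the blocks. *)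
Theorem block_splits : [splits Aut E, over K].
Proof.
pose H := [set a in Aut E | [forall u in X, forall v in X, R u v ==> (fext_coc a u == fext_coc a v)]].
have HP a : reflect (a \in Aut E /\ forall u v, u \in X -> v \in X -> R u v -> fext_coc a u = fext_coc a v) (a \in H).
  rewrite [a \in H]inE; apply: (iffP andP) => [[Aa h]|[Aa h]]; split=> //.
    by move=> u v Xu Xv Ruv; have /forall_inP/(_ u Xu)/forall_inP/(_ v Xv)/implyP/(_ Ruv)/eqP := h.
  apply/forall_inP=> u Xu; apply/forall_inP=> v Xv; apply/implyP=> Ruv; apply/eqP; exact: h.
have gH : group_set H.
  apply/group_setP; split=> [|a c /HP[Aa ha] /HP[Ac hc]]; apply/HP.
    by split=> [|u v _ _ _]; rewrite ?group1 ?fext_coc1.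
  split=> [|u v Xu Xv Ruv]; first exact: groupM.
  have sO : fext_perm a \in O.
    by rewrite -(fext_perm_im uf (q := fun v => q v)) // -[fext_perm a]/(prm a) mem_morphim.
  rewrite !(fext_cocM uf _ Aa Ac) (ha u v) // -!(fext_permE uf _ Aa); congr (_ + _)%R.
  by apply: hc; rewrite ?isoX ?isoR.
apply/splitsP; exists (Group gH); apply/complP; split=> /=.
  apply: (trivgP (G := (inner @* [set: V] :&: Group gH)%G) _); apply/subsetP=> _ /setIP[/morphimP[w _ _ ->] /HP[_ h]].
  have [Aw lw hw] := fext_innerP f w.
  suff -> : w = 0%R by rewrite inE -(morph1 inner).
  apply: blf_unit uf _ => v; rewrite sym_formC.
  pose g := blf (sym_form f)^~ w.
  have gs i : g (e i) = g (block_sum (blk i)).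
    by have := h _ _ (Xe i) (Xs i) (Rs i); rewrite !hw.
  have gD : {morph g : x y / (x + y)%R} by move=> x y; rewrite /g blfDl.
  have g0 : g 0%R = 0%R by rewrite /g blf0l.
  (* A linear g constant on the enlarged block takes on the block sum an even number of copies of
     that constant, so the constant is 0. *)
  have gs0 j : g (block_sum j) = 0%R.
    rewrite {1}/block_sum (big_morph g gD g0).
    under eq_bigr => i /eqP bi do rewrite gs bi.
    by rewrite sumr_const (mulrn_evenF2 _ (blk_even j)).
  rewrite -/(g v) [v]row_sum_delta (big_morph g gD g0) big1 // => i _.
  by rewrite /g blfZl -/(g _) gs gs0 mulr0.
apply/eqP; rewrite eqEsubset; apply/andP; split.
  apply: mul_subG; last by apply/subsetP=> a /HP[].
  by apply/subsetP=> k /fext_Kinner[].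
apply/subsetP=> a Aa.
(* [d j] is the constant that h + l will take on block j. The choice l(e i) = h(e i) + d achieves it
   on unit vectors; on the block sum the copies of d cancel by evenness, leaving h(block sum) plus
   the sum of the h(e i), which is d. *)
pose h := fext_coc a; pose d j := (h (block_sum j) + \sum_(i | blk i == j) h (e i))%R.
pose l (v : V) := (\sum_i v 0%R i * (h (e i) + d (blk i)))%R.
have lD u v : l (u + v)%R = (l u + l v)%R.
  by rewrite /l -big_split; apply: eq_bigr => i _; rewrite mxE mulrDl.
have l0 : l 0%R = 0%R by rewrite /l big1 // => i _; rewrite mxE mul0r.
have le i : l (e i) = (h (e i) + d (blk i))%R.
  rewrite /l (bigD1 i) //= mxE !eqxx mul1r big1 ?addr0 // => k ki.
  by rewrite mxE (negPf ki) andbF mul0r.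
have hl j v : in_block j v -> (h v + l v)%R = d j.
  case/orP=> [/eqP->|/existsP[i /andP[/eqP <- /eqP->]]]; last first.
    by rewrite le addrA addF2 add0r.
  rewrite {2}/block_sum (big_morph l lD l0).
  under eq_bigr => i /eqP bi do rewrite le bi.
  by rewrite big_split /= sumr_const (mulrn_evenF2 _ (blk_even j)) addr0.
have [w lw] := blf_functional uf lD.
have [Aw linw cw] := fext_innerP f w.
rewrite -[a](mulKg (fext_inner f w)).
apply: mem_mulg; first by rewrite groupV; apply: (mem_morphim inner); rewrite inE.
apply/HP; split=> [|u v Xu Xv Ruv]; first exact: groupM.
rewrite !(fext_cocM uf _ Aw Aa) !linw !cw -!lw.
by have [j /andP[/hl-> /hl->]] := RX Xu Xv Ruv.
Qed.

End BlockSplitting.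

(** * Transport of splittings, and dimension 2 *)

Lemma injm_splits (aT rT : finGroupType) (D A B : {group aT}) (h : {morphism D >-> rT}) :
    'injm h -> A \subset D -> B \subset D ->
  [splits B, over A] -> [splits h @* B, over h @* A].
Proof.
move=> injh sAD sBD /splitsP[C /complP[tiAC AC]].
have sCD : C \subset D by apply: subset_trans sBD; rewrite -AC mulG_subr.
apply/splitsP; exists (h @* C)%G; apply/complP; split.
  by rewrite -injmI // tiAC morphim1.
by rewrite -morphimMl // AC.
Qed.

Lemma injm_splits_iff (aT rT : finGroupType) (D A B : {group aT}) (h : {morphism D >-> rT}) :
    'injm h -> A \subset D -> B \subset D ->
  [splits h @* B, over h @* A] = [splits B, over A].
Proof.
move=> injh sAD sBD; apply/idP/idP; last exact: injm_splits.
move/(injm_splits (injm_invm injh) (morphimS _ sAD) (morphimS _ sBD)).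
by rewrite !morphim_invm.
Qed.

Lemma isog_inner_splits (gT hT : finGroupType) (G : {group gT}) (H : {group hT}) :
  G \isog H -> [splits Aut G, over conj_aut G @* G] ->
  [splits Aut H, over conj_aut H @* H].
Proof.
case/isogP=> h injh imh; have -> : H = (h @* G)%G by apply: group_inj.
pose F := Aut_isom injh (subxx G) => /=.
have sub : conj_aut G @* G \subset Aut G by apply: Aut_conj_aut.
have -> : conj_aut (h @* G) @* (h @* G) = Aut_isom_morphism injh (subxx G) @* (conj_aut G @* G).
  have cE x : x \in G -> F (conj_aut G x) = conj_aut (h @* G) (h x).
    move=> Gx; have Nx := subsetP (normG G) _ Gx.
    have hx := mem_morphim h Gx Gx; have Nhx := subsetP (normG _) _ hx.
    have Ax : conj_aut G x \in Aut G by apply: (subsetP sub); apply: mem_morphim.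
    apply: eq_Aut; [exact: Aut_Aut_isom | |].
      by apply: (subsetP (Aut_conj_aut _ (h @* G))); apply: mem_morphim.
    move=> _ /morphimP[y Gy _ ->]; have hy := mem_morphim h Gy Gy.
    by rewrite /F Aut_isomE // !norm_conj_autE // morphJ.
  apply/setP=> a; apply/morphimP/morphimP=> [[_ _ /morphimP[x _ Gx ->] ->]|].
    have Nx := subsetP (normG G) _ Gx.
    have Kx := mem_morphim (conj_aut_morphism G) Nx Gx.
    by exists (conj_aut G x); [exact: (subsetP sub) | exact: Kx | exact: esym (cE _ Gx)].
  case=> _ _ /morphimP[x _ Gx ->] ->.
  have hx := mem_morphim h Gx Gx; have Nhx := subsetP (normG _) _ hx.
  by exists (h x); [exact: Nhx | exact: hx | exact: cE].
rewrite -(im_Aut_isom injh (subxx G)).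
exact: (injm_splits (injm_Aut_isom injh (subxx G)) sub (subxx _)).
Qed.

(** Identifies the kernel with the inner automorphism group, so that splitting depends only on the
    isomorphism type and may be tested on one convenient f. *)
Lemma fext_inner_conj m (f : 'M['F_2]_m) (uf : sym_form f \in unitmx) :
  fext_inner_morphism uf @* [set: 'rV['F_2]_m] = conj_aut [set: fext f] @* [set: fext f].
Proof.
have NT (x : fext f) : x \in 'N([set: fext f]) by apply: (subsetP (normG _)); rewrite inE.
have cA (x : fext f) : conj_aut [set: fext f] x \in Aut [set: fext f].
  apply: (subsetP (Aut_conj_aut _ [set: fext f])).
  by apply: mem_morphim; [exact: NT | exact: in_setT].
have cE (x y : fext f) :
    conj_aut [set: fext f] x y = y * ((0%R, blf (sym_form f) y.1 x.1) : fext f).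
  rewrite norm_conj_autE ?in_setT ?NT //; apply: (mulgI x).
  apply: etrans (esym (conjgC y x)) _; apply: etrans (fext_comm y x) _.
  exact: (esym (mulgA x y _)).
have lE (x : fext f) v : fext_lin (conj_aut [set: fext f] x) v = v.
  by rewrite /fext_lin cE fextM /= addr0.
apply/setP=> a; apply/idP/morphimP => [/morphimP[w _ _ ->]|[x _ _ ->]]; last first.
  by apply: fext_innerK; [exact: cA | exact: lE].
have [Aw lw hw] := fext_innerP f w.
exists ((w, 0%R) : fext f); [exact: NT | exact: in_setT |].
apply: (fext_aut_eq uf Aw (cA ((w, 0%R) : fext f))) => v; first by rewrite lE lw.
by rewrite hw /fext_coc cE fextM /= blf0r !addr0 add0r.
Qed.

Lemma fext_isog_splits m (f g : 'M['F_2]_m) (uf : sym_form f \in unitmx) (ug : sym_form g \in unitmx) :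
    [set: fext f] \isog [set: fext g] ->
  [splits Aut [set: fext f], over fext_inner_morphism uf @* [set: 'rV['F_2]_m]] ->
  [splits Aut [set: fext g], over fext_inner_morphism ug @* [set: 'rV['F_2]_m]].
Proof. by rewrite !fext_inner_conj; apply: isog_inner_splits. Qed.

Lemma orthogonal_groupP m (q : 'rV['F_2]_m -> 'F_2) (s : {perm 'rV['F_2]_m}) :
  s \in orthogonal_group q ->
  [/\ forall u v, s (u + v)%R = (s u + s v)%R, s 0%R = 0%R & forall v, q (s v) = q v].
Proof.
rewrite inE => /andP[/forallP sl /forallP sq].
have sD u v : s (u + v)%R = (s u + s v)%R.
  by have /forallP/(_ u)/forallP/(_ v)/eqP := sl 1%R; rewrite !scale1r.
split=> // [|v]; last exact/eqP.
by rewrite -{1}[0%R](addmx2 0%R) sD addmx2.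
Qed.

Lemma block_sumE m (J : finType) (blk : 'I_m -> J) j i :
  block_sum blk j 0%R i = ((blk i == j)%:R)%R.
Proof.
rewrite /block_sum summxE; have [bi|bi] := eqVneq (blk i) j.
  by rewrite (bigD1 i) ?bi //= mxE !eqxx big1 ?addr0 // => k /andP[_ ki]; rewrite mxE eq_sym (negPf ki) andbF.
rewrite big1 // => k bk; rewrite mxE; case: eqP => //= e; case: eqP => // ik.
by move: bi; rewrite ik bk.
Qed.

Definition vec2 (a b : 'F_2) : 'rV['F_2]_2 := (\row_(i < 2) [:: a; b]`_i)%R.

Lemma vec2E v : exists a b, v = vec2 a b.
Proof.
exists (v 0%R 0%R), (v 0%R ord_max); apply/rowP=> i; rewrite mxE.
by have [->|->] := ord2P i.
Qed.

(** The three nonzero vectors are two unit vectors and their sum: a single enlarged block, preserved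
    by every linear permutation. *)
Theorem fext_splits2 (f : 'M['F_2]_2) (uf : sym_form f \in unitmx) :
  [splits Aut [set: fext f], over fext_inner_morphism uf @* [set: 'rV['F_2]_2]].
Proof.
have sE : block_sum (fun _ : 'I_2 => tt) tt = vec2 1%R 1%R.
  by apply/rowP=> i; rewrite block_sumE !mxE; have [->|->] := ord2P i.
have eE i : (delta_mx 0 i : 'rV['F_2]_2)%R = vec2 (i == ord0)%:R%R (i == ord_max)%:R%R.
  by apply/rowP=> k; rewrite !mxE; have [->|->] := ord2P i; have [->|->] := ord2P k.
have v0 a b : (vec2 a b == 0)%R = (a == 0)%R && (b == 0)%R.
  apply/eqP/andP=> [/rowP e|[/eqP-> /eqP->]].
    by have := e 0%R; have := e ord_max; rewrite !mxE /= => -> ->.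
  by apply/rowP=> i; rewrite !mxE; have [->|->] := ord2P i.
apply: (@block_splits _ _ uf _ (fun _ => tt) [set v | v != 0%R] (fun _ _ => true)) => //.
- by case; rewrite -sum1_card big_mkcond /= big_ord2.
- move=> s /orthogonal_groupP[_ s0 _] u; rewrite !inE; apply: contra => /eqP su.
  by rewrite -(inj_eq (@perm_inj _ s)) su s0.
- have key v : v != 0%R -> in_block (fun _ : 'I_2 => tt) tt v.
    have [a [b ->]] := vec2E v; rewrite v0 /in_block sE.
    have [->|->] := F2P a; have [->|->] := F2P b; rewrite //= => _.
    + by apply/orP; right; apply/existsP; exists ord_max; rewrite eE.
    + by apply/orP; right; apply/existsP; exists ord0; rewrite eE.
    by rewrite eqxx.
  by move=> u v; rewrite !inE => /key ku /key kv _; exists tt; rewrite ku kv.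
- by move=> i; rewrite inE eE v0; have [->|->] := ord2P i.
by move=> i; rewrite inE sE v0.
Qed.

(** * Dimension 4 *)

Section DimensionFour.

Local Open Scope ring_scope.
Local Notation V := 'rV['F_2]_4.

Definition vec4 (a b c d : 'F_2) : V := \row_(i < 4) [:: a; b; c; d]`_i.

Let o0 := @Ordinal 4 0 isT.
Let o1 := @Ordinal 4 1 isT.
Let o2 := @Ordinal 4 2 isT.
Let o3 := @Ordinal 4 3 isT.

Lemma ord4P (i : 'I_4) : [\/ i = o0, i = o1, i = o2 | i = o3].
Proof.
case: i => [[|[|[|[|i]]]] lt_i] //; [apply: Or41|apply: Or42|apply: Or43|apply: Or44]; exact: val_inj.
Qed.

Lemma vec4E v : exists a b c d, v = vec4 a b c d.
Proof.
exists (v 0 o0), (v 0 o1), (v 0 o2), (v 0 o3); apply/rowP=> i; rewrite mxE.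
by case: (ord4P i) => ->.
Qed.

Lemma vec4_inj a b c d a' b' c' d' : vec4 a b c d = vec4 a' b' c' d' ->
  [/\ a = a', b = b', c = c' & d = d'].
Proof.
move/rowP=> e; have := (e o0, e o1, e o2, e o3); rewrite !mxE /=.
by case=> [[[-> ->] ->] ->].
Qed.

Lemma vec40 : 0 = vec4 0 0 0 0.
Proof. by apply/rowP=> i; rewrite !mxE; case: (ord4P i) => ->. Qed.

Lemma vec4D a b c d a' b' c' d' :
  vec4 a b c d + vec4 a' b' c' d' = vec4 (a + a') (b + b') (c + c') (d + d').
Proof. by apply/rowP=> i; rewrite !mxE; case: (ord4P i) => ->. Qed.

Lemma vec4_delta (i : 'I_4) :
  delta_mx 0 i = vec4 (i == o0)%:R (i == o1)%:R (i == o2)%:R (i == o3)%:R.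
Proof.
by apply/rowP=> k; rewrite !mxE; case: (ord4P k) => ->; case: (ord4P i) => ->.
Qed.

Section FromCoordinates.

Variable Q : 'F_2 -> 'F_2 -> 'F_2 -> 'F_2 -> 'F_2.

Definition form4 (v : V) := Q (v 0 o0) (v 0 o1) (v 0 o2) (v 0 o3).

Lemma form4E a b c d : form4 (vec4 a b c d) = Q a b c d.
Proof. by rewrite /form4 !mxE. Qed.

End FromCoordinates.

(* The nonzero singular vectors of minus4 are the four unit vectors and their
   sum; the nonsingular vectors of plus4 are two unit vectors and their sum in
   each of two orthogonal planes.  These are the enlarged blocks. *)
Definition minus4 := form4 (fun a b c d => a * b + a * c + a * d + b * c + b * d + c * d).
Definition plus4 := form4 (fun a b c d => a * a + a * b + b * b + c * c + c * d + d * d).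

Lemma minus4E a b c d :
  minus4 (vec4 a b c d) = a * b + a * c + a * d + b * c + b * d + c * d.
Proof. exact: form4E. Qed.

Lemma plus4E a b c d :
  plus4 (vec4 a b c d) = a * a + a * b + b * b + c * c + c * d + d * d.
Proof. exact: form4E. Qed.

Lemma minus4_polar a b c d a' b' c' d' :
  polar minus4 (vec4 a b c d) (vec4 a' b' c' d') =
    a * (b' + c' + d') + b * (a' + c' + d') + c * (a' + b' + d') + d * (a' + b' + c').
Proof. by rewrite /polar vec4D !minus4E; ring. Qed.

Lemma plus4_polar a b c d a' b' c' d' :
  polar plus4 (vec4 a b c d) (vec4 a' b' c' d') = a * b' + b * a' + c * d' + d * c'.
Proof.
rewrite /polar vec4D !plus4E.
transitivity (a * b' + b * a' + c * d' + d * c' + (a * a' + a * a') + (b * b' + b * b')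
  + (c * c' + c * c') + (d * d' + d * d')); first by ring.
by rewrite !addF2 !addr0.
Qed.

Lemma quadratic_form_from_polar m (q : 'rV['F_2]_m -> 'F_2) : q 0 = 0 ->
  (forall u v w, polar q u (v + w) = polar q u v + polar q u w) -> quadratic_form q.
Proof.
move=> q0 pD; split=> [a v|u a v w].
  by have [->|->] := F2P a; rewrite ?scale0r ?scale1r ?expr2 ?mul0r ?mul1r.
by have [->|->] := F2P a; rewrite ?scale0r ?scale1r ?mul0r ?mul1r ?add0r.
Qed.

Lemma minus4_quadratic : quadratic_form minus4.
Proof.
apply: quadratic_form_from_polar => [|u v w]; first by rewrite vec40 minus4E; ring.
have [a [b [c [d ->]]]] := vec4E u; have [a' [b' [c' [d' ->]]]] := vec4E v.
have [a1 [b1 [c1 [d1 ->]]]] := vec4E w.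
by rewrite vec4D !minus4_polar; ring.
Qed.

Lemma plus4_quadratic : quadratic_form plus4.
Proof.
apply: quadratic_form_from_polar => [|u v w]; first by rewrite vec40 plus4E; ring.
have [a [b [c [d ->]]]] := vec4E u; have [a' [b' [c' [d' ->]]]] := vec4E v.
have [a1 [b1 [c1 [d1 ->]]]] := vec4E w.
by rewrite vec4D !plus4_polar; ring.
Qed.

Lemma minus4_nondegenerate u : (forall v, polar minus4 u v = 0) -> u = 0.
Proof.
have [a [b [c [d ->]]]] := vec4E u => H.
have := (H (vec4 1 0 0 0), H (vec4 0 1 0 0), H (vec4 0 0 1 0), H (vec4 0 0 0 1)).
rewrite !minus4_polar vec40.
have [->|->] := F2P a; have [->|->] := F2P b; have [->|->] := F2P c; have [->|->] := F2P d;
 by case=> [[[/(congr1 val) h1 /(congr1 val) h2] /(congr1 val) h3] /(congr1 val) h4].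
Qed.

Lemma plus4_nondegenerate u : (forall v, polar plus4 u v = 0) -> u = 0.
Proof.
have [a [b [c [d ->]]]] := vec4E u => H.
have := (H (vec4 0 1 0 0), H (vec4 1 0 0 0), H (vec4 0 0 0 1), H (vec4 0 0 1 0)).
rewrite !plus4_polar !mulr0 !mulr1 !addr0 !add0r.
by case=> [[[-> ->] ->] ->]; rewrite -vec40.
Qed.

(** The line through the first unit vector is already a maximal totally singular subspace, with 2
    instead of 4 elements. *)
Lemma minus4_type : quadratic_type 0 (fun u v : V => u + v) minus4 4 = Minus.
Proof.
rewrite /quadratic_type ifF //; apply/negP=> /forallP/(_ [set 0; vec4 1 0 0 0])/implyP.
have ne : 0 != vec4 1 0 0 0 by rewrite vec40; apply/eqP=> /vec4_inj[/(congr1 val)].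
rewrite cards2 ne /= => H; suff : false by []; apply: H.
apply/maxsetP; split.
  apply/andP; split.
    apply/andP; split; first by rewrite !inE eqxx.
    apply/forall_inP=> u; rewrite !inE => /orP[]/eqP->; apply/forall_inP=> v;
      rewrite !inE => /orP[]/eqP->; by rewrite ?add0r ?addr0 ?addmx2 ?eqxx ?orbT.
  apply/forall_inP=> u; rewrite !inE => /orP[]/eqP->; by rewrite ?vec40 minus4E; apply/eqP; ring.
move=> W /andP[/andP[_ /forall_inP WD] /forall_inP Wq] sW; apply/eqP; rewrite eqEsubset sW andbT.
have We : vec4 1 0 0 0 \in W by apply: (subsetP sW); rewrite !inE eqxx orbT.
apply/subsetP=> v Wv; have := Wq _ Wv; have := Wq _ (forall_inP (WD _ We) _ Wv).
have [a [b [c [d ->]]]] := vec4E v; rewrite vec4D !minus4E !inE vec40.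
by have [->|->] := F2P a; have [->|->] := F2P b; have [->|->] := F2P c; have [->|->] := F2P d;
  rewrite ?eqxx ?orbT.
Qed.

Lemma in_block_delta (J : finType) (blk : 'I_4 -> J) i : in_block blk (blk i) (delta_mx 0 i).
Proof. by apply/orP; right; apply/existsP; exists i; rewrite !eqxx. Qed.

Lemma minus4_splits (f : 'M['F_2]_4) (uf : sym_form f \in unitmx) :
    (forall v, minus4 v = blf f v v) ->
  [splits Aut [set: fext f], over fext_inner_morphism uf @* [set: V]]%g.
Proof.
move=> fE; pose blk (i : 'I_4) := tt.
have sE : block_sum blk tt = vec4 1 1 1 1.
  by apply/rowP=> i; rewrite block_sumE !mxE; case: (ord4P i) => ->.
have key v : v != 0 -> minus4 v = 0 -> in_block blk tt v.
  have [a [b [c [d ->]]]] := vec4E v; rewrite vec40 minus4E => n0 /(congr1 val) /= z.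
  have [[i ->]|->] : (exists i, vec4 a b c d = delta_mx 0 i) \/ vec4 a b c d = vec4 1 1 1 1.
    have : [|| vec4 a b c d == vec4 1 0 0 0, vec4 a b c d == vec4 0 1 0 0,
      vec4 a b c d == vec4 0 0 1 0, vec4 a b c d == vec4 0 0 0 1 | vec4 a b c d == vec4 1 1 1 1].
      move: n0 z; have [->|->] := F2P a; have [->|->] := F2P b;
      by have [->|->] := F2P c; have [->|->] := F2P d; rewrite ?eqxx ?orbT.
    case/or4P=> [/eqP->|/eqP->|/eqP->|/orP[]/eqP->]; [left; exists o0|left; exists o1
      |left; exists o2|left; exists o3|right]; by rewrite ?vec4_delta.
  - exact: (in_block_delta blk).
  by rewrite /in_block sE eqxx.
apply: (@block_splits _ _ uf _ blk [set v | (v != 0) && (minus4 v == 0)] (fun _ _ => true)) => //.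
- by case; rewrite -sum1_card big_mkcond /= !big_ord_recl big_ord0.
- move=> s /orthogonal_groupP[_ s0 sq] u; rewrite !inE => /andP[u0 qu].
  rewrite fE sq -fE qu andbT; apply: contra u0 => /eqP su.
  by rewrite -(inj_eq (@perm_inj _ s)) su s0.
- move=> u v; rewrite !inE => /andP[u0 /eqP qu] /andP[v0 /eqP qv] _.
  by exists tt; rewrite !key.
- move=> i; rewrite inE vec4_delta vec40 minus4E.
  by case: (ord4P i) => -> /=; apply/andP; split=> //; apply/eqP => /vec4_inj[] // /(congr1 val).
move=> i; rewrite inE sE vec40 minus4E; apply/andP; split=> //.
by apply/eqP=> /vec4_inj[/(congr1 val)].
Qed.

(** The relation [equal or not orthogonal] keeps the two planes apart without fixing their order:
    nonsingular vectors in different planes are orthogonal, and isometries may exchange the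
    planes. *)
Lemma plus4_splits (f : 'M['F_2]_4) (uf : sym_form f \in unitmx) :
    (forall v, plus4 v = blf f v v) ->
  [splits Aut [set: fext f], over fext_inner_morphism uf @* [set: V]]%g.
Proof.
move=> fE; pose blk (i : 'I_4) := (i < 2)%N.
have sT : block_sum blk true = vec4 1 1 0 0.
  by apply/rowP=> i; rewrite block_sumE !mxE; case: (ord4P i) => ->.
have sF : block_sum blk false = vec4 0 0 1 1.
  by apply/rowP=> i; rewrite block_sumE !mxE; case: (ord4P i) => ->.
have key v : plus4 v = 1 ->
    (in_block blk true v /\ exists a b, v = vec4 a b 0 0)
 \/ (in_block blk false v /\ exists a b, v = vec4 0 0 a b).
  have [a [b [c [d ->]]]] := vec4E v; rewrite plus4E => /(congr1 val) /= z.
  have bT0 : in_block blk true (vec4 1 0 0 0) by have := in_block_delta blk o0; rewrite vec4_delta.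
  have bT1 : in_block blk true (vec4 0 1 0 0) by have := in_block_delta blk o1; rewrite vec4_delta.
  have bF0 : in_block blk false (vec4 0 0 1 0) by have := in_block_delta blk o2; rewrite vec4_delta.
  have bF1 : in_block blk false (vec4 0 0 0 1) by have := in_block_delta blk o3; rewrite vec4_delta.
  have bT : in_block blk true (vec4 1 1 0 0) by rewrite /in_block sT eqxx.
  have bF : in_block blk false (vec4 0 0 1 1) by rewrite /in_block sF eqxx.
  move: z; have [->|->] := F2P a; have [->|->] := F2P b;
    have [->|->] := F2P c; have [->|->] := F2P d => // _;
    by [left; split=> //; eexists; eexists | right; split=> //; eexists; eexists].
apply: (@block_splits _ _ uf _ blk [set v | plus4 v == 1]
          (fun u v => (u == v) || (polar plus4 u v == 1))) => //.
- by case; rewrite -sum1_card big_mkcond /= !big_ord_recl big_ord0.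
- by move=> s /orthogonal_groupP[_ _ sq] u; rewrite !inE !fE sq.
- move=> s /orthogonal_groupP[sD _ sq] u v; rewrite (inj_eq perm_inj) /polar -sD.
  by rewrite !fE !sq.
- move=> u v; rewrite !inE => /eqP qu /eqP qv /orP[/eqP uv|].
    by rewrite -uv; case: (key u qu) => -[bu _]; [exists true | exists false]; rewrite bu.
  case: (key u qu) => -[bu [a [b eu]]]; case: (key v qv) => -[bv [c [d ev]]];
    try by [exists true; rewrite bu | exists false; rewrite bu].
  - by rewrite eu ev plus4_polar !mulr0 !mul0r !addr0.
  by rewrite eu ev plus4_polar !mulr0 !mul0r !addr0.
- by move=> i; rewrite inE vec4_delta plus4E; case: (ord4P i) => ->.
- by move=> i; rewrite inE; case: (ord4P i) => ->; rewrite /= ?sT ?sF plus4E.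
move=> i; apply/orP; right.
by case: (ord4P i) => ->; rewrite vec4_delta /= ?sT ?sF plus4_polar.
Qed.

Local Open Scope group_scope.

(** The vectors (a, b, a, b) form a totally singular plane, whose preimage is elementary abelian of
    order 8; the only possible ranks are 2 and 3. *)
Lemma plus4_rank (f : 'M['F_2]_4) : sym_form f \in unitmx ->
  (forall v, plus4 v = blf f v v) -> 'r_2([set: fext f]) == 3.
Proof.
move=> uf fE.
have esE := fext_extraspecial uf (isT : 0 < 4)%N.
have oE : #|[set: fext f]| = (2 ^ (2.*2).+1)%N by rewrite card_fext.
pose g (x : 'F_2 * 'F_2 * 'F_2) : fext f := (vec4 x.1.1 x.1.2 x.1.1 x.1.2, x.2).
have gI : injective g.
  move=> [[a b] c] [[a' b'] c'] e.
  by have [/= -> -> _ _] := vec4_inj (congr1 fst e); congr (_, _); exact: (congr1 snd e).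
have gS x : g x ^+ 2 = 1.
  rewrite fext_sq -fE plus4E; congr (_, _).
  transitivity (x.1.1 * x.1.1 + x.1.1 * x.1.1 + (x.1.1 * x.1.2 + x.1.1 * x.1.2)
     + (x.1.2 * x.1.2 + x.1.2 * x.1.2))%R; first by rewrite /=; ring.
  by rewrite !addF2.
pose A := g @: [set: 'F_2 * 'F_2 * 'F_2].
have gA : group_set A.
  apply/group_setP; split=> [|_ _ /imsetP[[[a b] c] _ ->] /imsetP[[[a' b'] c'] _ ->]].
    by apply/imsetP; exists (0, 0, 0)%R; rewrite ?inE // /g /= -vec40.
  rewrite fextM /= vec4D; apply/imsetP.
  by exists (a + a', b + b', c + c' + blf f (vec4 a b a b) (vec4 a' b' a' b'))%R; rewrite ?inE.
have abA : 2.-abelem (Group gA).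
  by apply: exponent2_abelem; apply/exponentP=> _ /imsetP[x _ ->].
have oA : #|A| = 8 by rewrite card_imset // cardsT !card_prod !card_Fp.
have : (logn 2 #|Group gA| <= 'r_2([set: fext f]))%N.
  by apply: logn_le_p_rank; rewrite !inE subsetT abA.
rewrite /= oA; case: (isog_2extraspecial oE esE) => iE;
  by rewrite (isog_p_rank iE) ?rank_Dn ?rank_DnQ.
Qed.

Lemma fext_split_model m (e : sign) : m = 2 \/ m = 4 ->
  exists (f : 'M['F_2]_m) (uf : sym_form f \in unitmx),
    ('r_2([set: fext f]) == (m./2).+1) = (if e is Plus then true else false) /\
    [splits Aut [set: fext f], over fext_inner_morphism uf @* [set: 'rV['F_2]_m]].
Proof.
case=> ->.
  have [f [uf rf]] := sign_form e (isT : 0 < 2)%N isT.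
  by exists f, uf; split=> //; apply: fext_splits2.
case: e.
  have [f fE fP] := quadratic_form_blf plus4_quadratic.
  have uf : sym_form f \in unitmx.
    by apply: nondegenerate_unit => u H; apply: plus4_nondegenerate => v; rewrite fP.
  by exists f, uf; rewrite plus4_rank //; split=> //; apply: plus4_splits.
have [f fE fP] := quadratic_form_blf minus4_quadratic.
have uf : sym_form f \in unitmx.
  by apply: nondegenerate_unit => u H; apply: minus4_nondegenerate => v; rewrite fP.
exists f, uf; split; last exact: minus4_splits.
by have := fext_type uf (isT : 0 < 4)%N fE; rewrite minus4_type; case: ifP.
Qed.

End DimensionFour.

(** * The main theorem *)

(** For m = 2 or 4 the splitting is transported from the model of the same type; evenness leaves
    only these values below the range of [fext_nonsplit]. *)
Lemma fext_splits_iff m (f : 'M['F_2]_m) (uf : sym_form f \in unitmx) :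
    (0 < m)%N -> ~~ odd m ->
  [splits Aut [set: fext f], over fext_inner_morphism uf @* [set: 'rV['F_2]_m]]
    <-> m = 2 \/ m = 4.
Proof.
move=> m0 om; split=> [spl|m24].
  have m4 : (m <= 4)%N by rewrite leqNgt; apply: contraL spl; apply: fext_nonsplit.
  by move: m0 om m4 {spl}; case: (m) => [|[|[|[|[|k]]]]] //; [left | right].
have [g [ug [rg]]] := fext_split_model (if 'r_2([set: fext f]) == (m./2).+1 then Plus else Minus) m24.
apply: fext_isog_splits.
have esg := fext_extraspecial ug m0; have esf := fext_extraspecial uf m0.
apply: (isog_2extraspecial_rank m0 om esg esf (card_fext g) (card_fext f)).
by apply: etrans rg _; case: ('r_2(_) == _).
Qed.

(** |Q| = |E|^2 gives |E| = 2^(m+1), whereas an extraspecial 2-group has order 2^(2k+1): this is the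
    parity of m. *)
Lemma biextraspecial_fix m (gT : finGroupType) (G Q : {group gT}) :
  biextraspecial_wrt m G Q ->
  exists s t, [/\ frame G Q s t, extraspecial 'C_Q[s], #|'C_Q[s]| = (2 ^ m.+1)%N, ~~ odd m
    & quadratic_type None (@dent_add gT G Q) (@dent_q gT G Q) m =
        if 'r_2('C_Q[s]) == (m./2).+1 then Plus else Minus].
Proof.
move=> bG; have [s [t fr]] := biextraspecial_frame bG; exists s, t.
have [m0 _ oQ _] := bG.
have Q4 : (4 < #|Q|)%N.
  by rewrite oQ expnD ltn_Pmulr // -(expn0 2) ltn_exp2l // muln_gt0.
have esE := frame_extraspecial fr Q4.
have oE : #|'C_Q[s]| = (2 ^ m.+1)%N.
  apply/eqP; rewrite -(eqn_sqr _ (2 ^ m.+1)) -expnM; apply/eqP.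
  by rewrite -[LHS](frame_cardQ fr) oQ [(m.+1 * 2)%N]mulnC mulnS.
split; [exact: fr | exact: esE | exact: oE | | exact: (dent_type fr Q4 m)].
have [k _] := card_extraspecial (frame_pgroupE fr) esE.
rewrite [LHS]oE => /eqP; rewrite eqn_exp2l // => /eqP[->].
by rewrite odd_double.
Qed.

(** An isomorphism carries Q to Q' because both are 2-cores, and the pair (s, t) to a conjugate of
    (s', t'). *)
Lemma frame_isog (gT hT : finGroupType) (G Q : {group gT}) (G' Q' : {group hT}) s t s' t' :
  frame G Q s t -> frame G' Q' s' t' -> (G \isog G') = ('C_Q[s] \isog 'C_Q'[s']).
Proof.
move=> fr fr'; apply/idP/idP; last first.
  case/isogP=> f injf imf; have [phi [injphi imphi _ _ _]] := frame_extension fr fr' injf imf.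
  by apply/isogP; exists phi.
case/isogP=> phi injphi imphi.
have sQG : Q \subset G by rewrite -(frame_pcore fr) pcore_sub.
have [Gs Gt] := (frame_mems fr, frame_memt fr).
have phiQ : phi @* Q = Q'.
  by rewrite -(frame_pcore fr) injm_pcore // imphi (frame_pcore fr').
have phiG x : x \in G -> phi x \in G' by move=> Gx; rewrite -imphi mem_morphim.
have [|g Gg [es _]] := frame_conj fr' (phiG _ Gs) (phiG _ Gt) (etrans (order_injm injphi Gs) (frame_order_s fr))
  (etrans (order_injm injphi Gt) (frame_order_t fr)).
  by rewrite -morphJ // (frame_inv fr) morphV.
have e1 : phi @* 'C_Q[s] = 'C_Q'[s'] :^ g.
  rewrite injm_subcent1 // phiQ es conjIg -normJ -?conjg_set1 //.
  by congr (_ :&: _); rewrite (normsP (normal_norm (frame_normal fr'))).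
have : 'C_Q[s] \isog phi @* 'C_Q[s] by apply: sub_isog => //; rewrite subIset ?sQG.
by move/isog_trans; apply; rewrite /= e1 isog_sym conj_isog.
Qed.

Theorem theorem1p1 :
  (forall (m : nat) (gT : finGroupType) (G : {group gT}),
     biextraspecial m G -> ~~ odd m)
  /\
  (forall m : nat, (0 < m)%N -> ~~ odd m ->
     exists (gT : sign -> finGroupType) (B : forall e : sign, {group gT e}),
       [/\ forall e : sign, biextraspecial_of_type m e (B e),
           ~~ (B Plus \isog B Minus)
         & forall (hT : finGroupType) (G : {group hT}),
             biextraspecial m G -> exists e : sign, G \isog B e])
  /\
  (forall (m : nat) (e : sign) (gT : finGroupType) (G : {group gT})
          (q : 'rV['F_2]_m -> 'F_2),
     (0 < m)%N -> ~~ odd m ->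
     biextraspecial_of_type m e G -> orthogonal_space q e ->
     exists (i : {morphism [set: 'rV['F_2]_m] >-> coset_of (Inn G)})
            (p : {morphism Out G >-> {perm 'rV['F_2]_m}}),
       [/\ 'injm i,
           i @* [set: 'rV['F_2]_m] = 'ker p,
           p @* Out G = orthogonal_group q
         & [splits Out G, over i @* [set: 'rV['F_2]_m]] <-> m = 2 \/ m = 4]).
Proof.
split; first by move=> m gT G [Q /biextraspecial_fix[s [t []]]].
split=> [m m0 om|m e gT G q m0 om [Q [bG tG]] [qf nd tq]].
  have [fp [ufp rp]] := sign_form Plus m0 om; have [fm [ufm rm]] := sign_form Minus m0 om.
  pose f e := if e is Plus then fp else fm.
  have uf e : sym_form (f e) \in unitmx by case: e; [exact: ufp | exact: ufm].
  have rf e : ('r_2([set: fext (f e)]) == (m./2).+1) = if e is Plus then true else false.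
    by case: e; [exact: rp | exact: rm].
  have bB e := bx_biextraspecial (uf e) m0.
  have rB e s t : frame [set: bx (f e)] (bxQ (f e)) s t ->
      ('r_2('C_(bxQ (f e))[s]) == (m./2).+1) = if e is Plus then true else false.
    by move=> fr; rewrite (isog_p_rank (bx_frame_fext (uf e) m0 fr)) rf.
  exists (fun e => bx (f e)), (fun e => [set: bx (f e)]%G); split.
  - move=> e; exists (bxQ (f e)); split=> //.
    have [s [t [fr _ _ _ ->]]] := biextraspecial_fix (bB e).
    by rewrite (rB _ _ _ fr); case: (e).
  - have [s [t [fr _ _ _ _]]] := biextraspecial_fix (bB Plus).
    have [s' [t' [fr' _ _ _ _]]] := biextraspecial_fix (bB Minus).
    rewrite (frame_isog fr fr'); apply/negP=> /isog_p_rank rr.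
    by have := rB _ _ _ fr; rewrite rr (rB _ _ _ fr').
  move=> hT G [Q bG]; have [s [t [fr esE oE _ _]]] := biextraspecial_fix bG.
  exists (if 'r_2('C_Q[s]) == (m./2).+1 then Plus else Minus).
  set e := if _ then _ else _.
  have [s' [t' [fr' esE' oE' _ _]]] := biextraspecial_fix (bB e).
  rewrite (frame_isog fr fr'); apply: (isog_2extraspecial_rank m0 om esE esE' oE oE').
  by rewrite (rB _ _ _ fr') /e; case: ifP.
have [s [t [fr esE oE _ tE]]] := biextraspecial_fix bG.
have [f fE fP] := quadratic_form_blf qf.
have uf : sym_form f \in unitmx.
  by apply: nondegenerate_unit => u H; apply: nd => v; rewrite fP.
(* G and q have the same type e, so E and the extension built from q pass the same rank test. *)
have isoE : 'C_Q[s] \isog [set: fext f].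
  apply: (isog_2extraspecial_rank m0 om esE (fext_extraspecial uf m0) oE (card_fext f)).
  have := fext_type uf m0 fE; rewrite tq; move: tE; rewrite tG => ->.
  by case: ifP; case: ifP.
have : Out G \isog Aut [set: fext f].
  apply: isog_trans (frame_Out_isog fr) _.
  case/isogP: isoE => h injh imh.
  by have := injm_Aut injh (subxx _); rewrite imh isog_sym.
case/isogP=> h injh imh.
have Ah x : x \in Out G -> h x \in Aut [set: fext f].
  by move=> Ox; have := mem_morphim h Ox Ox; rewrite imh.
pose inv := invm injh.
have invK a : a \in Aut [set: fext f] -> inv a \in Out G /\ h (inv a) = a.
  rewrite -imh => Aa; split; last exact: invmK.
  by rewrite -(im_invm injh); apply: mem_morphim.
(* The exact sequence of [Aut [set: fext f]] is carried over to [Out G] along the isomorphism h. *)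
pose i w := inv (fext_inner f w).
have iM : {in [set: 'rV['F_2]_m] &, {morph i : u v / u * v}}.
  move=> u v _ _; have [Au _ _] := fext_innerP f u; have [Av _ _] := fext_innerP f v.
  rewrite /i (fext_innerM uf (in_setT u) (in_setT v)).
  have imA a : a \in Aut [set: fext f] -> a \in h @* Out G by rewrite imh.
  exact: (morphM (invm_morphism injh) (imA _ Au) (imA _ Av)).
pose p x := fext_perm (h x).
have pM : {in Out G &, {morph p : x y / x * y}}.
  by move=> x y Ox Oy; rewrite /p morphM // (fext_permM uf) // Ah.
have him : h @* (Morphism iM @* [set: 'rV['F_2]_m]) = fext_inner_morphism uf @* [set: 'rV['F_2]_m].
  apply/setP=> a; apply/morphimP/morphimP=> [[_ _ /morphimP[w _ Vw ->] ->]|[w _ Vw ->]].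
    have [Aw _ _] := fext_innerP f w; have [_ e1] := invK _ Aw.
    by exists w.
  have [Aw _ _] := fext_innerP f w; have [Ow e1] := invK _ Aw.
  by exists (i w); rewrite ?(mem_morphim (Morphism iM)).
exists (Morphism iM), (Morphism pM); split.
- apply/injmP=> u v _ _ /(congr1 h) e1.
  have [Au _ _] := fext_innerP f u; have [Av _ _] := fext_innerP f v.
  have [_ eu] := invK _ Au; have [_ ev] := invK _ Av.
  apply: (injmP (fext_inner_injm uf) _ _ (in_setT u) (in_setT v)).
  exact: etrans (esym eu) (etrans e1 ev).
- apply/setP=> x; apply/morphimP/idP => [[w _ _ ->]|kx].
    have [Aw _ _] := fext_innerP f w; have [Ow hw] := invK _ Aw.
    apply/kerP; rewrite //= /p hw.
    have : fext_inner_morphism uf w \in 'ker (fext_perm_morphism uf).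
      by rewrite -fext_inner_ker; apply: mem_morphim; rewrite inE.
    by move/mker.
  have Ox : x \in Out G := dom_ker kx.
  have : h x \in 'ker (fext_perm_morphism uf).
    by apply/kerP; [exact: Ah | exact: (mker kx)].
  rewrite -fext_inner_ker => /morphimP[w _ _ ew]; exists w; rewrite ?inE //.
  apply: (injmP injh) => //.
    by have [] := invK (fext_inner f w); have [] := fext_innerP f w.
  have [Aw _ _] := fext_innerP f w; have [_ e1] := invK _ Aw.
  exact: etrans ew (esym e1).
- rewrite -(fext_perm_im uf fE); apply/setP=> a.
  apply/morphimP/morphimP=> [[x Ox _ ->]|[c Ac _ ->]]; first by exists (h x); rewrite ?Ah.
  by have [Oc hc] := invK _ Ac; exists (inv c); rewrite //= /p hc.
have sI : Morphism iM @* [set: 'rV['F_2]_m] \subset Out G.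
  apply/subsetP=> _ /morphimP[w _ _ ->] /=.
  by have [] := invK (fext_inner f w); have [] := fext_innerP f w.
have e1 : [splits Out G, over Morphism iM @* [set: 'rV['F_2]_m]] =
    [splits Aut [set: fext f], over fext_inner_morphism uf @* [set: 'rV['F_2]_m]].
  by rewrite -him -imh injm_splits_iff.
by rewrite e1; apply: fext_splits_iff.
Qed.
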